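(* Let $q_1,q_2\in L_{1,1}(\mathbb{R}_+)$ and $L_j:=-\frac{d^2}{dx^2}+q_j(x)$, $j=1,2$. Then the pair $\{L_1,L_2\}$ has properties $C_+$, $C_\varphi$ and $C_\psi$. If instead $q_1,q_2\in L_{1,1}(\mathbb{R}_-)$, then the pair $\{L_1,L_2\}$ has property $C_-$.
   Context: $\mathbb{R}_+=(0,\infty)$, $\mathbb{R}_-=(-\infty,0)$. For an interval $D$, $L_{1,1}(D)$ is the set of real-valued $q$ with $\int_D(1+|x|)|q(x)|\,dx<\infty$. Consider the equation $u''+k^2u-q_j(x)u=0$. - For $q_j\in L_{1,1}(\mathbb{R}_+)$ and $k\in\mathbb{R}$, the Jost solution $f_j(x,k)$ is the unique solution on $x>0$ with $f_j(x,k)=e^{ikx}+o(1)$ as $x\to+\infty$. - For $q_j\in L_{1,1}(\mathbb{R}_-)$, $g_j(x,k)$ is the unique solution on $x<0$ with $g_j(x,k)=e^{ikx}+o(1)$ as $x\to-\infty$. - $\varphi_j$ and $\psi_j$ are the solutions with $\varphi_j(0,k)=0,\ \varphi_j'(0,k)=1$ and $\psi_j(0,k)=1,\ \psi_j'(0,k)=0$ (prime denotes $\partial/\partial x$). Properties of the pair $\{L_1,L_2\}$: - $C_+$: if $p\in L_{1,1}(\mathbb{R}_+)$ and $\int_0^\infty p(x)f_1(x,k)f_2(x,k)\,dx=0$ for all $k>0$, then $p=0$. - $C_-$: if $p\in L_{1,1}(\mathbb{R}_-)$ and $\int_{-\infty}^0 p(x)g_1(x,k)g_2(x,k)\,dx=0$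 for all $k>0$, then $p=0$. - $C_\varphi$: for every fixed $b\in(0,\infty)$, if $p\in L^1(0,b)$ is real-valued and $\int_0^b p(x)\varphi_1(x,k)\varphi_2(x,k)\,dx=0$ for all $k>0$, then $p=0$ on $(0,b)$. - $C_\psi$: the same as $C_\varphi$ with $\psi_j$ in place of $\varphi_j$. Equality $p=0$ is understood almost everywhere. *)

(* Defs.v *)
From HB Require Import structures.
From mathcomp Require Import all_boot all_order all_algebra.
From mathcomp Require Import all_classical all_reals all_analysis.
From mathcomp Require Import complex.

Set Implicit Arguments.
Unset Strict Implicit.
Unset Printing Implicit Defensive.

Import Order.TTheory GRing.Theory Num.Theory.
Import numFieldNormedType.Exports.

Local Open Scope classical_set_scope.
Local Open Scope ring_scope.

Definition L11 (R : realType) (D : set R) (q : R -> R) : Prop :=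
  measurable_fun D q /\
  (\int[@lebesgue_measure R]_(x in D) ((1 + `|x|) * `|q x|)%:E < +oo)%E.

Definition abs_continuous (R : realType) (a b : R) (f : R -> R) : Prop :=
  forall e : R, 0 < e -> exists2 d : R, 0 < d &
    forall (n : nat) (s t : 'I_n -> R),
      (forall i, a <= s i /\ s i <= t i /\ t i <= b) ->
      (forall i j, i != j -> t i <= s j \/ t j <= s i) ->
      \sum_(i < n) (t i - s i) < d ->
      \sum_(i < n) `|f (t i) - f (s i)| < e.

Definition loc_abs_continuous (R : realType) (D : set R) (f : R -> R) : Prop :=
  forall a b : R, a <= b -> `[a, b] `<=` D -> abs_continuous a b f.

(* Since q is only locally integrable, u'' + k^2 u - q u = 0 is understood in
   the Caratheodory sense: u' is locally absolutely continuous and the equation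
   holds almost everywhere.  D is meant to be open, so that the two-sided
   derivatives at points of D only depend on u on D. *)
Definition solution (R : realType) (D : set R) (q : R -> R) (k : R)
    (u : R -> R) : Prop :=
  [/\ forall x, D x -> derivable u x 1,
      loc_abs_continuous D (derive1 u) &
      {ae @lebesgue_measure R, forall x, D x ->
         derivable (derive1 u) x 1 /\ derive1n 2 u x + k ^+ 2 * u x - q x * u x = 0}].

(* q and k are real, so a complex-valued function solves the equation iff its
   real and imaginary parts do. *)
Definition csolution (R : realType) (D : set R) (q : R -> R) (k : R)
    (f : R -> R[i]) : Prop :=
  solution D q k (fun x => complex.Re (f x)) /\
  solution D q k (fun x => complex.Im (f x)).

Definition cexpi (R : realType) (t : R) : R[i] := Complex (cos t) (sin t).

Definition cintegral (R : realType) (D : set R) (f : R -> R[i]) : R[i] :=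
  Complex (\int[@lebesgue_measure R]_(x in D) complex.Re (f x))
          (\int[@lebesgue_measure R]_(x in D) complex.Im (f x)).

(* Argument order of the families of solutions below: f x k. *)
Definition is_jost_plus (R : realType) (q : R -> R) (f : R -> R -> R[i]) : Prop :=
  forall k : R, csolution `]0, +oo[ q k (f ^~ k) /\
    Normc.normc (f x k - cexpi (k * x)) @[x --> +oo] --> (0 : R).

Definition is_jost_minus (R : realType) (q : R -> R) (g : R -> R -> R[i]) : Prop :=
  forall k : R, csolution `]-oo, 0[ q k (g ^~ k) /\
    Normc.normc (g x k - cexpi (k * x)) @[x --> -oo] --> (0 : R).

(* Cauchy data at the end point 0 of the half-line: u 0 = c0, and the
   derivative at 0 is the right derivative.  The data being real, the solution
   is real-valued. *)
Definition is_cauchy_solution (R : realType) (q : R -> R) (k c0 c1 : R)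
    (u : R -> R) : Prop :=
  [/\ solution `]0, +oo[ q k u, u 0 = c0 &
      h^-1 * (u h - u 0) @[h --> 0^'+] --> c1].

Definition is_phi (R : realType) (q : R -> R) (phi : R -> R -> R) : Prop :=
  forall k : R, is_cauchy_solution q k 0 1 (phi ^~ k).

Definition is_psi (R : realType) (q : R -> R) (psi : R -> R -> R) : Prop :=
  forall k : R, is_cauchy_solution q k 1 0 (psi ^~ k).

Definition ae_zero (R : realType) (D : set R) (p : R -> R) : Prop :=
  {ae @lebesgue_measure R, forall x, D x -> p x = 0}.

(* In the four properties, the pair {L_1, L_2}, L_j = - d^2/dx^2 + q_j, is
   given by its potentials.  The solutions are determined by q_j on the
   half-line, so that quantifying universally over f1, f2 amounts to speaking
   of the Jost (resp. phi, psi) solutions. *)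
Definition property_C_plus (R : realType) (q1 q2 : R -> R) : Prop :=
  forall f1 f2 : R -> R -> R[i], is_jost_plus q1 f1 -> is_jost_plus q2 f2 ->
  forall p : R -> R, L11 `]0, +oo[ p ->
    (forall k : R, 0 < k ->
       cintegral `]0, +oo[ (fun x => Complex (p x) 0 * f1 x k * f2 x k) = 0) ->
    ae_zero `]0, +oo[ p.

Definition property_C_minus (R : realType) (q1 q2 : R -> R) : Prop :=
  forall g1 g2 : R -> R -> R[i], is_jost_minus q1 g1 -> is_jost_minus q2 g2 ->
  forall p : R -> R, L11 `]-oo, 0[ p ->
    (forall k : R, 0 < k ->
       cintegral `]-oo, 0[ (fun x => Complex (p x) 0 * g1 x k * g2 x k) = 0) ->
    ae_zero `]-oo, 0[ p.

Definition property_C_phi (R : realType) (q1 q2 : R -> R) : Prop :=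
  forall phi1 phi2 : R -> R -> R, is_phi q1 phi1 -> is_phi q2 phi2 ->
  forall b : R, 0 < b ->
  forall p : R -> R, (@lebesgue_measure R).-integrable `]0, b[ (EFin \o p) ->
    (forall k : R, 0 < k ->
       \int[@lebesgue_measure R]_(x in `]0, b[) (p x * phi1 x k * phi2 x k) = 0) ->
    ae_zero `]0, b[ p.

Definition property_C_psi (R : realType) (q1 q2 : R -> R) : Prop :=
  forall psi1 psi2 : R -> R -> R, is_psi q1 psi1 -> is_psi q2 psi2 ->
  forall b : R, 0 < b ->
  forall p : R -> R, (@lebesgue_measure R).-integrable `]0, b[ (EFin \o p) ->
    (forall k : R, 0 < k ->
       \int[@lebesgue_measure R]_(x in `]0, b[) (p x * psi1 x k * psi2 x k) = 0) ->
    ae_zero `]0, b[ p.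

(* Main.v *)
Require Import Defs.
From HB Require Import structures.
From mathcomp Require Import all_boot all_order all_algebra.
From mathcomp Require Import all_classical all_reals all_analysis.
From mathcomp Require Import measurable_realfun complex ring lra.

(* For frequencies k_j > 0, the function
     V(x, z) = Re sum_j c_j e^(i k_j z) f(x, k_j)
   solves the integral form of the wave equation V_xx - V_zz = q V, with data
   psi(x + z), psi(s) = sum_j c_j cos(k_j s).  Since waves have finite speed,
   V(x, z) is controlled by the values of psi on [x + z, +oo[, and weighted
   majorants make this quantitative.  Doing this for f_2 and then, x being
   fixed, for f_1 shows that, if psi is small on [2 (a + ep), Y], then
     U(x) = sum_j c_j Re (f_1 f_2)(x, k_j)
   is close to psi(2 x) for x >= a: up to 1/2 on [a, a + ep[ and up to an
   arbitrarily small error beyond, where ep depends neither on a nor on psi.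
   For k_j = (2 j + 1) k_0, Bernstein polynomials in cos^2 let psi(2 x)
   approximate any continuous g with |g| <= 1 supported in ]a, a + ep[.  As p is
   orthogonal to U, p = 0 on ]0, a[ implies
     |int p g| <= 1/2 int_a^(a + ep) |p|,
   hence p = 0 on ]0, a + ep[, and one iterates.  The regular solutions are
   treated in the same way, going down from b; C_- follows by reflection. *)

Set Implicit Arguments.
Unset Strict Implicit.
Unset Printing Implicit Defensive.

Import Order.TTheory GRing.Theory Num.Theory.
Import numFieldNormedType.Exports.

Local Open Scope classical_set_scope.
Local Open Scope ring_scope.

(** * Real-valued Lebesgue integrals *)

Section RealIntegrals.
Context {R : realType}.
Notation mu := (@lebesgue_measure R).
Implicit Types (D A B : set R) (f g h : R -> R).

(** The coefficients c_j are not under control: the approximation step bounds psi, but not the sum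
    of the |c_j|. Bounds for single frequencies are therefore of no help, and every estimate must
    treat the whole sum in terms of the size of psi. For this the Volterra kernel sin (k h) / k is
    read as half the integral of cos (k z) over [-h, h]: the Duhamel term of V becomes q times an
    integral of V over a segment in z, where no frequency is visible. The second obstacle is that
    psi (s + pi / k_0) = - psi (s), so psi cannot be small on a whole half-line. Beyond Y only |psi|
    <= 2 is known. What comes from there is charged to the tail of q after a large X_1, and the
    points x > X_1 themselves to the tail of p. Odd multiples of k_0 are taken because orthogonality
    is given for k > 0 only: functions cos t P(cos^2 t) have no constant term. The width ep can be
    chosen once and for all because large data confined to a strip of width 2 ep in x + z contribute
    at most ep times the integral of a majorant of |q|, wherever the strip lies. *)

Lemma le_integrableR D f h : measurable D -> measurable_fun D f ->
  (forall x, D x -> `|f x| <= h x) -> mu.-integrable D (EFin \o h) ->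
  mu.-integrable D (EFin \o f).
Proof.
move=> mD mf fh; apply: le_integrable => //; first exact/measurable_EFinP.
move=> x Dx /=; rewrite lee_fin (le_trans (fh _ Dx))//.
exact: ler_norm.
Qed.

Lemma integrable_meas D f : mu.-integrable D (EFin \o f) -> measurable_fun D f.
Proof. by move/measurable_int/measurable_EFinP. Qed.

Lemma integrable_normR D f : mu.-integrable D (EFin \o f) ->
  mu.-integrable D (EFin \o (fun x => `|f x|)).
Proof. by move=> fi; exact: (integrable_norm fi). Qed.

Lemma integrableZlR D f (M : R) : measurable D ->
  mu.-integrable D (EFin \o f) ->
  mu.-integrable D (EFin \o (fun x => M * f x)).
Proof.
by move=> mD fi; exact: (@integrableZl _ _ R mu D mD M _ fi).
Qed.

Lemma integrableMb D f h (M : R) : measurable D -> measurable_fun D h ->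
  (forall x, D x -> `|h x| <= M) -> mu.-integrable D (EFin \o f) ->
  mu.-integrable D (EFin \o (fun x => f x * h x)).
Proof.
move=> mD mh hM fi; apply: (@le_integrableR _ _ (fun x => M * `|f x|)) => //.
- by apply: measurable_funM => //; exact: integrable_meas.
- by move=> x Dx; rewrite normrM mulrC ler_wpM2r// hM.
- exact: integrableZlR (integrable_normR fi).
Qed.

Lemma ler_norm_Rintegral D f h : measurable D ->
  mu.-integrable D (EFin \o f) -> mu.-integrable D (EFin \o h) ->
  (forall x, D x -> `|f x| <= h x) ->
  `|\int[mu]_(x in D) f x| <= \int[mu]_(x in D) h x.
Proof.
move=> mD fi hi fh; apply: (@le_trans _ _ (\int[mu]_(x in D) `|f x|)).
  exact: le_normr_Rintegral.
by apply: le_Rintegral => //; exact: integrable_normR.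
Qed.

Lemma le_Rintegral_subset A B f : measurable A -> measurable B -> A `<=` B ->
  mu.-integrable B (EFin \o f) -> (forall x, B x -> 0 <= f x) ->
  \int[mu]_(x in A) f x <= \int[mu]_(x in B) f x.
Proof.
move=> mA mB AB fi f0; rewrite /Rintegral fine_le//.
- by apply: integrable_fin_num => //; exact: integrableS fi.
- exact: integrable_fin_num.
- by apply: ge0_subset_integral => //; exact: measurable_int fi.
Qed.

Lemma eq_Rintegral_ae D f g : measurable D -> measurable_fun D f ->
  measurable_fun D g -> {ae mu, forall x, D x -> f x = g x} ->
  \int[mu]_(x in D) f x = \int[mu]_(x in D) g x.
Proof.
move=> mD mf mg fg; rewrite /Rintegral; congr fine.
apply: ae_eq_integral => //; try exact/measurable_EFinP.
apply: filterS fg; first exact: (ae_filter_ringOfSetsType mu).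
by move=> x fg Dx /=; rewrite fg.
Qed.

Lemma Rintegral_split D A f : measurable D -> measurable A ->
  mu.-integrable D (EFin \o f) ->
  \int[mu]_(x in D) f x =
  \int[mu]_(x in D `&` A) f x + \int[mu]_(x in D `\` A) f x.
Proof.
move=> mD mA fi; rewrite -Rintegral_setU.
- by rewrite setDE -setIUr setUv setIT.
- exact: measurableI.
- exact: measurableD.
- by rewrite setDE -setIUr setUv setIT.
- by rewrite disj_set2E; apply/eqP; rewrite setDE setIACA setICr setI0.
Qed.

Lemma Rintegral_eq0_setD D A f : measurable D -> measurable A ->
  mu.-integrable D (EFin \o f) -> (forall x, D x -> ~ A x -> f x = 0) ->
  \int[mu]_(x in D) f x = \int[mu]_(x in D `&` A) f x.
Proof.
move=> mD mA fi f0; rewrite (Rintegral_split mD mA fi).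
rewrite [X in _ + X](_ : _ = 0) ?addr0// (@eq_Rintegral _ _ _ _ _ (fun=> 0)).
  by rewrite Rintegral_cst ?mul0r//; exact: measurableD.
by move=> x; rewrite inE => -[]; exact: f0.
Qed.

Lemma measurable_fun_ltn D f g : measurable_fun setT f -> measurable_fun setT g ->
  measurable_fun D (fun t => (f t < g t)%R%:R : R).
Proof.
move=> mf mg; apply: measurable_funTS.
rewrite (_ : (fun t : R => _) = (fun t : R => if f t < g t then 1 else 0)).
  by apply: measurable_fun_ifT => //; exact: measurable_fun_ltr.
by apply/funext => t; case: (f t < g t).
Qed.

Lemma integrable_natmul_bool D f (P : pred R) : measurable D ->
  measurable_fun D (fun x => (P x)%:R : R) -> mu.-integrable D (EFin \o f) ->
  mu.-integrable D (EFin \o (fun x => f x * (P x)%:R)).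
Proof.
move=> mD mP; apply: (@integrableMb _ _ _ 1) => //.
by move=> x _; case: (P x); rewrite ?normr1 ?normr0.
Qed.

End RealIntegrals.

(** * Absolutely continuous functions *)

Section AbsoluteContinuity.
Context {R : realType}.
Notation mu := (@lebesgue_measure R).
Implicit Types (F G f g : R -> R).

(** Real induction through the supremum of the points where [P] holds. A step leads from some x on
    the left of c to y on its right in one move, so that a property attached to the interval [a, x],
    such as a list of subintervals, can be carried across c. *)
Lemma continuous_induction (P : R -> Prop) (a b : R) : a <= b -> P a ->
  (forall c, a <= c <= b -> exists2 r, 0 < r & forall x y,
     a <= x <= c -> c <= y <= b -> c - r < x -> y < c + r -> P x -> P y) ->
  P b.
Proof.
move=> ab Pa loc.
pose S := [set x | a <= x <= b /\ P x].
have Sa : S a by split => //; rewrite lexx.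
have ubS : ubound S b by move=> x [/andP[]].
have supS : has_sup S by split; [exists a|exists b].
pose c := sup S.
have ac : a <= c by exact: ub_le_sup supS.2 _ Sa.
have cb : c <= b by apply: ge_sup => //; exists a.
have [|r r0 cr] := loc c; first by rewrite ac cb.
have [x [/andP[ax xb] Px] crx] := sup_adherent r0 supS.
have xc : x <= c by apply: ub_le_sup => //; [exact: supS.2|split => //; rewrite ax xb].
pose y := Order.min b (c + r / 2).
have yb : y <= b by rewrite ge_min lexx.
have cy : c <= y by rewrite le_min cb; lra.
have yr : y < c + r by rewrite gt_min; apply/orP; right; lra.
have Py : P y by apply: (cr x y) => //; rewrite ?ax ?xc ?cy ?yb.
have : y <= c.
  by apply: ub_le_sup => //; [exact: supS.2|split => //; rewrite yb (le_trans ac)].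
rewrite ge_min => /orP[bc|]; last by lra.
have yE : y = b by apply/eqP; rewrite eq_le yb (le_trans bc).
by rewrite -yE.
Qed.

(** Meant for the Wronskian, whose increments are bounded by those of [derive1 u] plus a Lipschitz
    term; absolute continuity is transferred to it in one go. *)
Lemma abs_continuous_dominated (a b M : R) F G : 0 <= M ->
  abs_continuous a b F ->
  (forall s t, a <= s -> s <= t -> t <= b ->
     `|G t - G s| <= M * `|F t - F s| + M * (t - s)) ->
  abs_continuous a b G.
Proof.
move=> M0 acF GF e e0.
pose e' := e / (2 * (M + 1)).
have M1 : 0 < M + 1 by lra.
have e'0 : 0 < e' by rewrite divr_gt0// mulr_gt0.
have e'E : M * e' + M * e' < e.
  rewrite -mulrDl /e' mulrA ltr_pdivrMr ?mulr_gt0//; nra.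
have [d d0 dF] := acF _ e'0.
exists (Order.min d e'); first by rewrite lt_min d0.
move=> n s t st nov; rewrite lt_min => /andP[sd se].
have Fe := dF n s t st nov sd.
apply: le_lt_trans (_ : _ <= M * \sum_(i < n) `|F (t i) - F (s i)| +
   M * \sum_(i < n) (t i - s i)) _.
  rewrite !mulr_sumr -big_split /=; apply: ler_sum => i _.
  by have [? [? ?]] := st i; exact: GF.
apply: le_lt_trans e'E; apply: lerD; apply: ler_wpM2l => //; exact: ltW.
Qed.

Lemma Rintegral_itv_split (a x y : R) g : a <= x -> x <= y ->
  mu.-integrable `[a, y] (EFin \o g) ->
  \int[mu]_(t in `[a, y]) g t =
  \int[mu]_(t in `[a, x]) g t + \int[mu]_(t in `]x, y]) g t.
Proof.
move=> ax xy gi; rewrite -(@Rintegral_itvB _ g (BLeft a) (BRight y) x)//.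
  by rewrite addrC subrK.
Qed.

Lemma open_ball_sub (O : set R) (c : R) : open O -> O c ->
  exists2 r, 0 < r & forall x, `|x - c| < r -> O x.
Proof.
move=> oO Oc; have /nbhs_ballP[r /= r0 rO] := open_nbhs_nbhs (conj oO Oc).
by exists r => // x xc; apply: rO; rewrite /ball/= distrC.
Qed.

Lemma is_derive0_small F (c e : R) : is_derive c 1 F 0 -> 0 < e ->
  exists2 r, 0 < r & forall x, `|x - c| < r -> `|F x - F c| <= e * `|x - c|.
Proof.
move=> [dF dE] e0.
have cv : h^-1 *: ((F \o shift c) (h *: 1) - F c) @[h --> 0^'] --> 'D_1 F c.
  exact: dF.
rewrite dE in cv; move/cvgrPdist_lt : cv => /(_ _ e0)[r /= r0 rH].
exists r => // x xc; have [->|xNc] := eqVneq x c.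
  by rewrite !subrr normr0 mulr0.
have := rH (x - c); rewrite /= sub0r normrN => /(_ xc).
rewrite subr_eq0 => /(_ xNc); rewrite /GRing.scale /= mulr1 subrK.
rewrite sub0r normrN normrM normfV ltr_pdivrMl ?normr_gt0 ?subr_eq0// mulrC.
exact: ltW.
Qed.

(* At a point where H' = 0, the increment of H is at most e times the
   length; the other points lie in an open set of small measure, where the
   absolute continuity of F and of the integral of g control the increments. *)
Lemma abs_continuous_FTC (a b : R) F g : a < b -> abs_continuous a b F ->
  mu.-integrable `[a, b] (EFin \o g) ->
  {ae mu, forall x, a < x < b -> derivable F x 1 /\ derive1 F x = g x} ->
  F b - F a = \int[mu]_(t in `[a, b]) g t.
Proof.
move=> ab acF gi Fg.
pose g1 : R -> R := g \_ `[a, b].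
have g1i : mu.-integrable setT (EFin \o g1).
  by rewrite /g1 -restrict_EFin -integrable_mkcond.
have g1n : mu.-integrable setT (EFin \o (fun x => `|g1 x|)).
  exact: integrable_normR.
have iS (A : set R) : measurable A -> mu.-integrable A (EFin \o g1).
  by move=> mA; exact: integrableS g1i.
have iSn (A : set R) : measurable A ->
    mu.-integrable A (EFin \o (fun x => `|g1 x|)).
  by move=> mA; exact: integrableS g1n.
pose G x := \int[mu]_(t in `[a, x]) g1 t.
have G1 : {ae mu, forall x, a < x -> derivable G x 1 /\ derive1 G x = g1 x}.
  have := @FTC1 R g1 (BLeft a) (fun y => iS _ (measurable_itv _)).
  have lg1 : locally_integrable [set: R] g1.
    apply: integrable_locally => //; exact: openT.
  move/(_ lg1); apply: filterS; first exact: (ae_filter_ringOfSetsType mu).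
  move=> x h ax; have ax' : (a%:E < x%:E)%E by rewrite lte_fin.
  exact: (h ax').
pose H x := F x - G x.
have Hd : {ae mu, forall x, a < x < b -> is_derive x 1 H 0}.
  apply: filterS2 Fg G1; first exact: (ae_filter_ringOfSetsType mu).
  move=> x h1 h2 axb; have /andP[ax xb] := axb.
  have [dF F'] := h1 axb; have [dG G'] := h2 ax.
  rewrite (_ : 0 = g x - g1 x); last first.
    by rewrite /g1 patchE mem_set ?subrr//= in_itv/= !ltW.
  have hF : is_derive x 1 F (g x) by rewrite -F' derive1E; exact: DeriveDef dF erefl.
  have hG : is_derive x 1 G (g1 x) by rewrite -G' derive1E; exact: DeriveDef dG erefl.
  exact: is_deriveB.
suff small e : 0 < e -> `|H b - H a| <= e.
  have H0 : H b - H a = 0.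
    apply/eqP; rewrite -normr_le0; apply/ler_addgt0Pl => e e0.
    by rewrite addr0 small.
  have : F b - F a = G b - G a by move: H0; rewrite /H; lra.
  rewrite /G set_itv1 Rintegral_set1 subr0 => ->.
  by apply: eq_Rintegral => x; rewrite inE/= => xab; rewrite /g1 patchE mem_set.
move=> e0.
(* Three shares: the small slopes cost e1 * (b - a), the increments of [F] over the exceptional
   cover cost e1, and the integral of [|g1|] there costs another e1. *)
pose e1 : R := e / (b - a + 2).
have e10 : 0 < e1 by rewrite divr_gt0//; lra.
have [d1 d10 acd] := acF _ e10.
have [d2 [d20 intd]] := integral_normr_continuous g1i e10.
have [N [mN N0 NH]] := Hd.
(* The end points join the exceptional set, since the derivative is known only strictly between a
   and b. *)
pose N' : set R := N `|` [set a] `|` [set b].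
have mN' : measurable N' by do 2 apply: measurableU => //.
have N'0 : mu N' = 0%E.
  apply: null_set_setU => //; last exact: lebesgue_measure_set1.
  - exact: measurableU.
  - by apply: null_set_setU => //; exact: lebesgue_measure_set1.
have [||O [oO NO muO]] := @lebesgue_regularity_outer R N' (Order.min d1 d2) mN'.
- by change (mu N' < +oo)%E; rewrite N'0 ltry.
- by rewrite lt_min d10.
have mO : measurable O by exact: open_measurable.
have muOlt : (mu O < (Order.min d1 d2)%:E)%E.
  apply: le_lt_trans muO; rewrite -[X in (mu X <= _)%E](setDUK NO).
  apply: (@le_trans _ _ (mu N' + mu (O `\` N'))%E).
    by apply: measureU2 => //; exact: measurableD.
  by rewrite [X in (X + _)%E]N'0 add0e.
have mOi x : measurable (O `&` `[a, x]) by exact: measurableI.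
pose J x := \int[mu]_(t in O `&` `[a, x]) `|g1 t|.
(* Bookkeeping up to x: the disjoint intervals already spent inside the cover [O], with total length
   at most the measure of the cover so far, and the bound on the increment of [H] that they pay
   for. *)
pose P x := exists n (s t : nat -> R),
  [/\ forall i, (i < n)%N -> a <= s i /\ s i <= t i /\ t i <= x,
      forall i j, (i < n)%N -> (j < n)%N -> i != j -> t i <= s j \/ t j <= s i,
      ((\sum_(i < n) (t i - s i))%:E <= mu (O `&` `[a, x]))%E &
      `|H x - H a| <= e1 * (x - a) + \sum_(i < n) `|F (t i) - F (s i)| + J x].
have J0 x : 0 <= J x by exact: Rintegral_ge0.
have Jle x y : x <= y -> J x <= J y.
  move=> xy; apply: le_Rintegral_subset => //; last exact: iSn.
  by apply: setIS; apply: subset_itvl; rewrite bnd_simp.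
have Pa : P a.
  exists 0%N, (fun=> a), (fun=> a); split => //.
  - by rewrite big_ord0 measure_ge0.
  - by rewrite !subrr normr0 big_ord0 mulr0 !add0r.
have Pb : P b.
  apply: continuous_induction (ltW ab) Pa _ => c /andP[ac cb].
  have [Oc|Oc] := pselect (O c).
    have [r r0 rO] := open_ball_sub oO Oc.
    exists r => // x y /andP[ax xc] /andP[cy yb] xr yr [n [s [t [st nov sm Hx]]]].
    have xy : x <= y by exact: le_trans cy.
    have xyO : `]x, y] `<=` O.
      move=> z/=; rewrite in_itv/= => /andP[xz zy]; apply: rO.
      by rewrite ltr_norml; apply/andP; move: xz zy xr yr xc cy; clear => *; split; lra.
    have OE : O `&` `[a, y] = (O `&` `[a, x]) `|` `]x, y].
      apply/seteqP; split => z /=; rewrite !in_itv/=.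
        by move=> [Oz /andP[az zy]]; case: (leP z x) => zx; [left|right; rewrite zy]; rewrite ?az.
      move=> [[Oz /andP[az zx]]|zxy]; first by rewrite az (le_trans zx).
      split; first by apply: xyO; rewrite /= in_itv.
      by move/andP : zxy => [/ltW xz ->]; rewrite (le_trans ax).
    have disj : (O `&` `[a, x]) `&` `]x, y] = set0.
      apply/seteqP; split => z //= [[_]]; rewrite !in_itv/= => /andP[_ zx] /andP[].
      by rewrite ltNge zx.
    have JE : J y = J x + \int[mu]_(t in `]x, y]) `|g1 t|.
      rewrite /J OE Rintegral_setU//.
      - exact: mOi.
      - by apply: iSn; apply: measurableU => //; exact: mOi.
      - by rewrite disj_set2E; apply/eqP.
    (* Inside the cover the whole interval from x to y is spent: it is appended to the list at index
       n. *)
    exists n.+1, (fun i => if i == n then x else s i),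
      (fun i => if i == n then y else t i).
    have lt_neq i : (i < n)%N -> (i == n) = false by move=> /ltn_eqF.
    split.
    - move=> i; rewrite ltnS leq_eqVlt => /predU1P[->|i_n]; first by rewrite eqxx.
      by rewrite lt_neq//; have [? [? h]] := st _ i_n; split => //; split => //; exact: le_trans xy.
    - move=> i j; rewrite ltnS leq_eqVlt => /predU1P i_n; rewrite ltnS leq_eqVlt => /predU1P j_n.
      move: i_n j_n => [->|i_n] [->|j_n]; rewrite ?eqxx// => ij.
      + by rewrite lt_neq//; right; have [? []] := st _ j_n.
      + by rewrite lt_neq//; left; have [? []] := st _ i_n.
      + by rewrite !lt_neq//; exact: nov.
    - have muU : mu (O `&` `[a, y]) = (mu (O `&` `[a, x]) + mu `]x, y]%classic)%E.
        by rewrite OE; apply: measureU => //; exact: mOi.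
      have muxy : mu `]x, y]%classic = (y - x)%:E.
        rewrite lebesgue_measure_itv/= lte_fin; case: ltP => // yx.
        by rewrite (_ : y = x) ?subrr//; apply/eqP; rewrite eq_le xy yx.
      rewrite big_ord_recr/= eqxx muU muxy EFinD; apply: leeD => //.
      apply: le_trans sm.
      rewrite lee_fin; apply: ler_sum => i _; rewrite lt_neq//.
    - rewrite big_ord_recr/= eqxx.
      under eq_bigr do rewrite lt_neq//.
      have GE : G y - G x = \int[mu]_(t in `]x, y]) g1 t.
        have := Rintegral_itv_split ax xy (iS _ (measurable_itv _)).
        by rewrite -/(G x) -/(G y) => ->; rewrite [G x + _]addrC addrK.
      have Gn : `|G y - G x| <= \int[mu]_(t in `]x, y]) `|g1 t|.
        by rewrite GE; apply: le_normr_Rintegral => //; exact: iS.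
      have Hn : `|H y - H x| <= `|F y - F x| + `|G y - G x|.
        rewrite (_ : H y - H x = (F y - F x) - (G y - G x)); last by rewrite /H; ring.
        exact: ler_normB.
      have := ler_normD (H y - H x) (H x - H a).
      rewrite addrA subrK JE => tri.
      have e1xy : 0 <= e1 * (y - x) by apply: mulr_ge0; [exact: ltW | rewrite subr_ge0].
      move: Hx Gn Hn tri e1xy; set S1 := \sum_(i < n) _; clear; lra.
  have acb : a < c < b.
    rewrite !lt_neqAle ac cb !andbT; apply/andP; split; apply/eqP => E; apply: Oc; apply: NO.
      by rewrite /N' -E; left; right.
    by rewrite /N' E; right.
  have Hc : is_derive c 1 H 0.
    apply: contrapT => nHc; apply: Oc; apply: NO; left; left; apply: NH => /=.
    by move/(_ acb).
  have [r r0 Hr] := is_derive0_small Hc e10.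
  exists r => // x y /andP[ax xc] /andP[cy yb] xr yr [n [s [t [st nov sm Hx]]]].
  have xy : x <= y by exact: le_trans cy.
  exists n, s, t; split => //.
  - by move=> i /st[? [? h]]; split => //; split => //; exact: le_trans xy.
  - apply: le_trans sm _; apply: le_measure; [by rewrite inE; exact: mOi|by rewrite inE; exact: mOi|].
    by apply: setIS; apply: subset_itvl; rewrite bnd_simp.
  - have h1 := Hr x; have h2 := Hr y.
    rewrite distrC (ger0_norm (_ : 0 <= c - x)) in h1; last by rewrite subr_ge0.
    rewrite (ger0_norm (_ : 0 <= y - c)) in h2; last by rewrite subr_ge0.
    have {}h1 : `|H x - H c| <= e1 * (c - x) by apply: h1; move: xr xc; clear; lra.
    have {}h2 : `|H y - H c| <= e1 * (y - c) by apply: h2; move: yr cy; clear; lra.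
    have t1 := ler_distD (H c) (H y) (H a).
    have t2 := ler_distD (H x) (H c) (H a).
    rewrite [`|H c - H x|]distrC in t2.
    have Jxy := Jle _ _ xy; move: Hx t1 t2 h1 h2 Jxy; clear.
    move: (J) (H) e1 (\sum_(i < n) _) => {}J {}H e2 S1.
    by move: (J x) (J y) => Jx Jy; lra.
have [n [s [t [st nov sm Hb]]]] := Pb.
have muOb : (mu (O `&` `[a, b]) < (Order.min d1 d2)%:E)%E.
  apply: le_lt_trans muOlt; apply: le_measure; [by rewrite inE; exact: mOi|by rewrite inE|].
  exact: subIsetl.
have Fs : \sum_(i < n) `|F (t i) - F (s i)| < e1.
  apply: (acd n (fun i : 'I_n => s i) (fun i : 'I_n => t i)).
  - by move=> i; exact: st.
  - by move=> i j ij; exact: nov.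
  - have := le_lt_trans sm muOb; rewrite lte_fin => /lt_le_trans; apply.
    by rewrite ge_min lexx.
have Jb : J b < e1.
  rewrite /J; apply: intd; first exact: mOi.
  apply: (lt_le_trans muOb); rewrite lee_fin.
  by rewrite ge_min lexx orbT.
have eE : e1 * (b - a + 2) = e by rewrite /e1 divfK// gt_eqF//; move: ab; clear; lra.
move: Hb Fs Jb eE; set S1 := \sum_(i < n) _; clear; lra.
Qed.

End AbsoluteContinuity.

(** * Solutions and their integral equations *)

Section CaratheodorySolutions.
Context {R : realType}.
Notation mu := (@lebesgue_measure R).
Implicit Types (F G f g q u : R -> R).

Lemma abs_continuous_bounded (a b : R) F : a <= b -> abs_continuous a b F ->
  exists2 M, 0 <= M & forall x, a <= x <= b -> `|F x| <= M.
Proof.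
move=> ab acF; have [d d0 dF] := acF 1 ltr01.
have inc s t : a <= s -> s <= t -> t <= b -> t - s < d -> `|F t - F s| < 1.
  move=> as_ st tb tsd.
  have := dF 1%N (fun=> s) (fun=> t); rewrite !big_ord1; apply => //.
  by move=> i j; rewrite !ord1 eqxx.
have [M MP] : exists M, forall x, a <= x <= b -> `|F x| <= M.
  apply: (@continuous_induction _
    (fun y => exists M, forall x, a <= x <= y -> `|F x| <= M) a b) => //.
    by exists `|F a| => x; rewrite -eq_le => /eqP <-.
  move=> c cab; exists (d / 2); first by rewrite divr_gt0.
  move=> x y /andP[ax xc] /andP[cy yb] xr yr [M MP].
  exists (M + 1) => z /andP[az zy].
  have [zx|xz] := leP z x; first by rewrite (le_trans (MP z _)) ?az// lerDl.
  have zd : z - x < d by clear -xr yr zy; lra.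
  have := inc x z ax (ltW xz) (le_trans zy yb) zd.
  have Fx : `|F x| <= M by apply: MP; rewrite ax lexx.
  have := ler_normD (F z - F x) (F x); rewrite subrK; clear -Fx; lra.
exists (Num.max 0 M); first by rewrite le_max lexx.
by move=> x /MP h; rewrite le_max h orbT.
Qed.

Lemma lipschitz_of_derive F G (M s t : R) : s <= t ->
  (forall x, s <= x <= t -> is_derive x 1 F (G x)) ->
  (forall x, s <= x <= t -> `|G x| <= M) -> `|F t - F s| <= M * (t - s).
Proof.
move=> st FG GM.
have [c cst ->] : exists2 c, c \in `[s, t]%R & F t - F s = G c * (t - s).
  apply: MVT_segment => //.
    by move=> x; rewrite in_itv/= => /andP[/ltW h1 /ltW h2]; apply: FG; rewrite h1.
  apply: derivable_within_continuous => x; rewrite in_itv/= => h.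
  by have := FG x h => -[].
rewrite normrM (@ger0_norm _ (t - s)) ?subr_ge0// ler_wpM2r ?subr_ge0//.
by apply: GM; move: cst; rewrite in_itv.
Qed.

Lemma is_derive_affine (k x0 t : R) : is_derive t 1 (fun t => k * (t - x0)) k.
Proof.
have h : is_derive t 1 (fun s : R => s - x0) 1.
  by have := is_deriveB (is_derive_id t 1) (is_derive_cst x0 t 1); rewrite subr0.
have := @is_deriveZ _ _ _ _ k _ _ _ h.
by rewrite /GRing.scale /= mulr1.
Qed.

Lemma is_derive_sin_affine (k x0 t : R) :
  is_derive t 1 (fun t => sin (k * (t - x0))) (k * cos (k * (t - x0))).
Proof.
have := @is_derive1_comp _ (@sin R) _ t _ _ (is_derive_sin (k * (t - x0))) (is_derive_affine k x0 t).
by rewrite mulrC.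
Qed.

Lemma is_derive_cos_affine (k x0 t : R) :
  is_derive t 1 (fun t => cos (k * (t - x0))) (- (k * sin (k * (t - x0)))).
Proof.
have := @is_derive1_comp _ (@cos R) _ t _ _ (is_derive_cos (k * (t - x0))) (is_derive_affine k x0 t).
by rewrite mulNr mulrC.
Qed.

Lemma normr_sin_le1 (x : R) : `|sin x| <= 1.
Proof. by rewrite ler_norml sin_geN1 sin_le1. Qed.

Lemma normr_cos_le1 (x : R) : `|cos x| <= 1.
Proof. by rewrite ler_norml cos_geN1 cos_le1. Qed.

Lemma lipschitz_sin_affine (k x0 s t : R) : s <= t ->
  `|sin (k * (t - x0)) - sin (k * (s - x0))| <= `|k| * (t - s).
Proof.
move=> st; apply: (lipschitz_of_derive st (fun x _ => is_derive_sin_affine k x0 x)).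
by move=> x _; rewrite normrM ler_piMr// normr_cos_le1.
Qed.

Lemma lipschitz_cos_affine (k x0 s t : R) : s <= t ->
  `|cos (k * (t - x0)) - cos (k * (s - x0))| <= `|k| * (t - s).
Proof.
move=> st; apply: (lipschitz_of_derive st (fun x _ => is_derive_cos_affine k x0 x)).
by move=> x _; rewrite normrN normrM ler_piMr// normr_sin_le1.
Qed.

Lemma solution_bounded (D : set R) q (k : R) u (a b : R) : a <= b ->
  `[a, b] `<=` D -> solution D q k u ->
  exists2 M, 0 <= M & forall x, a <= x <= b -> `|u x| <= M /\ `|derive1 u x| <= M.
Proof.
move=> ab abD [du acu _].
have [M1 M10 M1P] := abs_continuous_bounded ab (acu a b ab abD).
have du' x : a <= x <= b -> is_derive x 1 u (derive1 u x).
  move=> xab; rewrite derive1E; apply: DeriveDef => //.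
  by apply: du; apply: abD; rewrite /= in_itv.
exists (`|u a| + M1 * (b - a) + M1).
  by rewrite !addr_ge0// mulr_ge0// subr_ge0.
move=> x /andP[ax xb].
have ux : `|u x - u a| <= M1 * (x - a).
  apply: (lipschitz_of_derive ax (G := derive1 u)) => z /andP[h1 h2].
    by apply: du'; rewrite h1 (le_trans h2).
  by apply: M1P; rewrite h1 (le_trans h2).
have M1x : M1 * (x - a) <= M1 * (b - a) by rewrite ler_wpM2l// lerD2r.
have M1b : 0 <= M1 * (b - a) by rewrite mulr_ge0// subr_ge0.
have := ler_normD (u x - u a) (u a); rewrite subrK => ux'.
have u'x : `|derive1 u x| <= M1 by apply: M1P; rewrite ax.
have ua : 0 <= `|u a| by [].
by split; move: ux M1x M1b ux' u'x ua M10; clear; lra.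
Qed.

Lemma derivable_measurable (i : interval R) u :
  (forall x, x \in i -> derivable u x 1) -> measurable_fun [set` i] u.
Proof.
move=> du; apply: subspace_continuous_measurable_fun => //.
exact: derivable_within_continuous.
Qed.

Lemma measurable_sin_affine (D : set R) (k x0 : R) :
  measurable_fun D (fun t => sin (k * (t - x0))).
Proof.
apply: measurable_funTS; apply: continuous_measurable_fun => t.
apply: differentiable_continuous; apply/derivable1_diffP.
by have [] := is_derive_sin_affine k x0 t.
Qed.

(** The Wronskian of u and s(t) = sin (k (t - x0)) has derivative q u s almost everywhere, because
    s'' = - k^2 s cancels the term k^2 u. It inherits absolute continuity from u', hence is the
    integral of that derivative. *)
Lemma solution_wronskian (D : set R) q (k : R) u (x0 a b : R) : a < b ->
  `[a, b] `<=` D -> solution D q k u -> mu.-integrable `[a, b] (EFin \o q) ->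
  (derive1 u b * sin (k * (b - x0)) - u b * (k * cos (k * (b - x0)))) -
  (derive1 u a * sin (k * (a - x0)) - u a * (k * cos (k * (a - x0)))) =
  \int[mu]_(t in `[a, b]) (q t * (u t * sin (k * (t - x0)))).
Proof.
move=> ab abD solu qi.
have [M M0 MP] := solution_bounded (ltW ab) abD solu.
have [du acu u2] := solu.
have duD x : a <= x <= b -> derivable u x 1.
  by move=> xab; apply: du; apply: abD; rewrite /= in_itv.
have du' x : a <= x <= b -> is_derive x 1 u (derive1 u x).
  by move=> xab; rewrite derive1E; apply: DeriveDef => //; exact: duD.
pose W t := derive1 u t * sin (k * (t - x0)) - u t * (k * cos (k * (t - x0))).
rewrite -/(W b) -/(W a).
have k0 : 0 <= `|k| by [].
have Mk : 0 <= M * `|k| by rewrite mulr_ge0.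
have Mkk : 0 <= M * `|k| * `|k| by rewrite mulr_ge0.
apply: (@abs_continuous_FTC _ a b W) => //.
- apply: (@abs_continuous_dominated _ a b (1 + M * `|k| + M * `|k| + M * `|k| * `|k|) (derive1 u)).
  + by rewrite !addr_ge0.
  + exact: acu (ltW ab) abD.
  + move=> s t as_ st tb.
    have ts0 : 0 <= t - s by rewrite subr_ge0.
    have sab : a <= s <= b by rewrite as_ (le_trans st).
    have e1 : `|(derive1 u t - derive1 u s) * sin (k * (t - x0))| <=
        `|derive1 u t - derive1 u s|.
      by rewrite normrM ler_piMr// normr_sin_le1.
    have e2 : `|derive1 u s * (sin (k * (t - x0)) - sin (k * (s - x0)))| <=
        M * `|k| * (t - s).
      rewrite normrM -mulrA; apply: ler_pM => //; first exact: (MP s sab).2.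
      exact: lipschitz_sin_affine.
    have e3 : `|(u t - u s) * (k * cos (k * (t - x0)))| <= M * `|k| * (t - s).
      rewrite normrM -mulrA [`|k| * _]mulrC mulrA; apply: ler_pM => //.
        apply: (lipschitz_of_derive st (G := derive1 u)) => z /andP[h1 h2].
          by apply: du'; rewrite (le_trans as_) ?(le_trans h2).
        by apply: (MP z _).2; rewrite (le_trans as_) ?(le_trans h2).
      by rewrite normrM ler_piMr// normr_cos_le1.
    have e4 : `|u s * (k * (cos (k * (t - x0)) - cos (k * (s - x0))))| <=
        M * `|k| * `|k| * (t - s).
      rewrite !normrM mulrA -[leRHS]mulrA; apply: ler_pM => //.
        by rewrite ler_wpM2r// (MP s sab).1.
      exact: lipschitz_cos_affine.
    have -> : W t - W s = (derive1 u t - derive1 u s) * sin (k * (t - x0)) +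
       derive1 u s * (sin (k * (t - x0)) - sin (k * (s - x0))) -
       ((u t - u s) * (k * cos (k * (t - x0))) +
        u s * (k * (cos (k * (t - x0)) - cos (k * (s - x0))))).
      by rewrite /W; ring.
    apply: (le_trans (ler_normB _ _)).
    apply: (le_trans (lerD (ler_normD _ _) (ler_normD _ _))).
    apply: (le_trans (lerD (lerD e1 e2) (lerD e3 e4))).
    have d0 : 0 <= `|derive1 u t - derive1 u s| by [].
    move: d0 ts0 M0 Mk Mkk; move: `|k| (t - s) `|_ - _| => K T V; clear.
    move=> V0 T0 M0 MK MKK.
    have h1 : 0 <= (M * K) * V by rewrite mulr_ge0.
    have h2 : 0 <= (M * K * K) * V by rewrite mulr_ge0.
    by lra.
- apply: (@integrableMb _ _ _ _ M) => //.
  + apply: measurable_funM; last exact: measurable_sin_affine.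
    by apply: derivable_measurable => z; rewrite in_itv/= => /duD.
  + move=> x; rewrite /= in_itv/= => xab; rewrite normrM.
    have := ler_pM (normr_ge0 _) (normr_ge0 _) (MP x xab).1 (normr_sin_le1 (k * (x - x0))).
    by rewrite mulr1.
- apply: filterS u2; first exact: (ae_filter_ringOfSetsType mu).
  move=> x h /andP[ax xb].
  have xab : a <= x <= b by rewrite !ltW.
  have Dx : D x by apply: abD; rewrite /= in_itv.
  have [d2 eq2] := h Dx.
  have u'' : is_derive x 1 (derive1 u) (derive1 (derive1 u) x).
    by rewrite [X in is_derive _ _ _ X]derive1E; apply: DeriveDef.
  have dW := is_deriveB (is_deriveM u'' (is_derive_sin_affine k x0 x))
    (is_deriveM (du' x xab) (@is_deriveZ _ _ _ _ k _ _ _ (is_derive_cos_affine k x0 x))).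
  have {}dW : is_derive x 1 W (q x * (u x * sin (k * (x - x0)))).
    apply: is_derive_eq dW _; rewrite /GRing.scale /=.
    move: eq2; rewrite /derive1n /=.
    set w : R := derive1 (derive1 u) x; set s := sin _; set c := cos _ => eq2.
    have -> : w = q x * u x - k ^+ 2 * u x.
      by apply/eqP; rewrite -subr_eq0; apply/eqP; rewrite -eq2; ring.
    by rewrite -[k *: c]/(k * c); ring.
  by rewrite derive1E derive_val; split => //; case: dW.
Qed.

Lemma integral_tail (D : set R) f (e : R) : measurable D ->
  mu.-integrable D (EFin \o f) -> 0 < e ->
  exists N : R, forall X, N <= X ->
    \int[mu]_(x in D `&` `]X, +oo[) `|f x| < e.
Proof.
move=> mD fi e0.
pose f_ (n : nat) (x : R) := (((fun x => `|f x|) \_ `]n%:R, +oo[%classic) x)%:E.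
have fni := integrable_normR fi.
have mf_ n : measurable_fun D (f_ n).
  apply/measurable_EFinP; apply/measurable_restrict => //.
  apply: measurable_funS (integrable_meas fni) => //; exact: subIsetl.
have f_0 : {ae mu, forall x, D x -> f_ ^~ x @ \oo --> 0%E}.
  apply: aeW => x _; apply: cvg_near_cst; near=> n.
  rewrite /f_ patchE memNset//= in_itv/= andbT; apply/negP; rewrite -leNgt.
  by near: n; exact: nbhs_infty_ger.
have f_g : {ae mu, forall x n, D x -> (`|f_ n x| <= (`|f x|)%:E)%E}.
  apply: aeW => x n _; rewrite /f_ patchE /=; case: ifP => _.
    by rewrite lee_fin normr_id.
  by rewrite lee_fin normr0.
have [_ _ c] := @dominated_convergence _ _ _ mu D mD f_ (cst 0%E) _ mf_
  (measurable_cst _) f_0 fni f_g.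
rewrite integral0 in c.
move/fine_cvgP : c => [_ /cvgrPdist_lt /(_ _ e0)[N _ /(_ N (leqnn N)) /=]].
rewrite sub0r normrN => h.
exists N%:R => X NX; apply: le_lt_trans h; rewrite ger0_norm; last first.
  by apply: fine_ge0; apply: integral_ge0 => x _; rewrite lee_fin patchE; case: ifP.
rewrite [leRHS](_ : _ = \int[mu]_(x in D `&` `]N%:R, +oo[) `|f x|); last first.
  by rewrite Rintegral_mkcondr.
apply: le_Rintegral_subset => //; try exact: measurableI.
  by apply: setIS; apply: subset_itvr; rewrite bnd_simp.
apply: integrableS fni => //; first exact: measurableI.
Unshelve. all: by end_near. Qed.

Lemma integral_near0 (b : R) f (e : R) : mu.-integrable `]0, b[ (EFin \o f) ->
  0 < e -> exists2 d, 0 < d & forall y, 0 < y -> y < d -> y < b ->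
    \int[mu]_(x in `]0, y[) `|f x| < e.
Proof.
move=> fi e0.
have fi' : mu.-integrable setT (EFin \o (f \_ `]0, b[)).
  by rewrite -restrict_EFin -integrable_mkcond.
have [d [d0 dP]] := integral_normr_continuous fi' e0.
exists d => // y y0 yd yb.
have := dP `]0, y[%classic (measurable_itv _).
rewrite [X in (X < _)%E -> _](_ : _ = y%:E); last first.
  by have := @lebesgue_measure_itv R `]0, y[; rewrite /= lte_fin y0 sube0.
rewrite lte_fin => /(_ yd); congr (_ < _); apply: eq_Rintegral => x.
rewrite inE/= in_itv/= => /andP[x0 xy]; rewrite patchE mem_set//= in_itv/= x0.
exact: lt_trans yb.
Qed.

Lemma L11_integrable (D : set R) q : measurable D -> L11 D q ->
  mu.-integrable D (EFin \o q) /\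
  mu.-integrable D (EFin \o (fun x => (1 + `|x|) * `|q x|)).
Proof.
move=> mD [mq qi].
have mh : measurable_fun D (fun x => (1 + `|x|) * `|q x|).
  apply: measurable_funM; last exact: measurableT_comp.
  apply: measurable_funD => //; exact: measurableT_comp.
have hi : mu.-integrable D (EFin \o (fun x => (1 + `|x|) * `|q x|)).
  apply/integrableP; split; first exact/measurable_EFinP.
  apply: le_lt_trans qi; apply: ge0_le_integral => //.
  - by apply/measurable_EFinP; exact: measurableT_comp.
  - exact/measurable_EFinP.
  - by move=> x _; rewrite /= lee_fin ger0_norm// mulr_ge0// addr_ge0.
split => //; apply: le_integrableR hi => // x _.
by rewrite ler_peMl// lerDl.
Qed.

End CaratheodorySolutions.

(** * Duhamel formulas for Jost solutions and for Cauchy data at 0 *)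

Section IntegralEquations.
Context {R : realType}.
Notation mu := (@lebesgue_measure R).
Implicit Types (q u : R -> R).

Lemma sin_2pin (n : nat) : sin (pi *+ 2 *+ n) = 0 :> R.
Proof. by have := periodicn (@sinD2pi R) n 0; rewrite add0r sin0. Qed.

Lemma cos_2pin (n : nat) : cos (pi *+ 2 *+ n) = 1 :> R.
Proof. by have := periodicn (@cosD2pi R) n 0; rewrite add0r cos0. Qed.

Lemma eq_of_small (x y C : R) : (forall e, 0 < e -> `|x - y| <= C * e) -> x = y.
Proof.
move=> h; apply/eqP; rewrite -subr_eq0 -normr_le0; apply/ler_addgt0Pl => e e0.
rewrite addr0; have C1 : 0 < `|C| + 1 by rewrite ltr_wpDl.
apply: le_trans (h (e / (`|C| + 1)) _) _; first by rewrite divr_gt0.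
rewrite mulrA ler_pdivrMr// mulrC ler_wpM2l ?ltW//.
by rewrite (le_lt_trans (ler_norm C))// ltrDl.
Qed.

(** Also half the integral of cos (k s) over [-h, h], which links the Duhamel formula of one
    frequency to d'Alembert's formula for waves. *)
Definition dAlembert_kernel (k h : R) : R := sin (k * h) / k.

(** Far out u stays within 1 of E, and a compact interval is left. The bound depends on x0 and says
    nothing yet about the behaviour at 0. *)
Lemma solution_tail_bounded q (k : R) u E (x0 : R) : 0 < x0 ->
  solution `]0, +oo[ q k u -> (forall x, `|E x| <= 1) ->
  u x - E x @[x --> +oo] --> (0 : R) ->
  exists2 M, 0 <= M & forall x, x0 <= x -> `|u x| <= M.
Proof.
move=> x00 solu E1 /cvgrPdist_lt /(_ _ ltr01)[N [Nr NP]].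
pose b := Num.max x0 N.
have x0b : x0 <= b by rewrite le_max lexx.
have bD : `[x0, b] `<=` `]0, +oo[%classic.
  by move=> x /=; rewrite !in_itv/= => /andP[h _]; rewrite (lt_le_trans x00).
have [M M0 MP] := solution_bounded x0b bD solu.
exists (M + 2); first by rewrite addr_ge0.
move=> x x0x; have [xb|bx] := leP x b.
  have := (MP x _).1; rewrite x0x xb => /(_ isT); clear; lra.
have Nx : N < x by apply: le_lt_trans bx; rewrite le_max lexx orbT.
have := NP x Nx; rewrite sub0r normrN => uE.
have := ler_normD (u x - E x) (E x); rewrite subrK.
move: uE (E1 x) M0; clear; lra.
Qed.

Lemma derivable_solution q (k : R) u x : solution `]0, +oo[ q k u -> 0 < x ->
  derivable u x 1.
Proof. by move=> [du _ _] x0; apply: du; rewrite /= in_itv/= x0. Qed.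

Lemma integrable_duhamel_tail q (k : R) u (x0 M : R) : 0 < x0 ->
  solution `]0, +oo[ q k u -> mu.-integrable `]0, +oo[ (EFin \o q) ->
  (forall x, x0 <= x -> `|u x| <= M) ->
  mu.-integrable `]x0, +oo[ (EFin \o (fun t => q t * (u t * sin (k * (t - x0))))).
Proof.
move=> x00 solu qi uM.
apply: (@integrableMb _ _ _ _ M) => //.
- apply: measurable_funM; last exact: measurable_sin_affine.
  apply: derivable_measurable => x; rewrite in_itv/= andbT => x0x.
  exact: derivable_solution solu (lt_trans x00 x0x).
- move=> x; rewrite /= in_itv/= andbT => x0x; rewrite normrM.
  by rewrite (le_trans (ler_piMr _ (normr_sin_le1 _)))// uM// ltW.
- apply: integrableS qi => //; apply: subset_itvr.
  by rewrite bnd_simp ltW.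
Qed.

(* The Wronskian with sin (k (t - x0)) is evaluated between x0 and points at
   which this function vanishes and its derivative is k. *)
Lemma asymptotic_integral_eq q (k : R) u E (x0 : R) : 0 < k -> 0 < x0 ->
  mu.-integrable `]0, +oo[ (EFin \o q) ->
  solution `]0, +oo[ q k u -> (forall x, `|E x| <= 1) ->
  (forall x (n : nat), E (x + pi *+ 2 *+ n / k) = E x) ->
  u x - E x @[x --> +oo] --> (0 : R) ->
  u x0 = E x0 +
    \int[mu]_(t in `]x0, +oo[) (q t * (u t * dAlembert_kernel k (t - x0))).
Proof.
move=> k0 x00 qi solu E1 Eper uE.
have kn0 : k != 0 by rewrite gt_eqF.
have [M M0 MP] := solution_tail_bounded x00 solu E1 uE.
have Fi := integrable_duhamel_tail x00 solu qi MP.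
pose F t := q t * (u t * sin (k * (t - x0))).
suff key : k * (u x0 - E x0) = \int[mu]_(t in `]x0, +oo[) F t.
  have -> : \int[mu]_(t in `]x0, +oo[) (q t * (u t * dAlembert_kernel k (t - x0))) =
     \int[mu]_(t in `]x0, +oo[) (k^-1 * F t).
    by apply: eq_Rintegral => t _; rewrite /F /dAlembert_kernel; ring.
  by rewrite RintegralZl// -key mulKf// addrC subrK.
apply: (@eq_of_small _ _ (k + 1)) => e e0.
have [N NP] := integral_tail (measurable_itv _) Fi e0.
move/cvgrPdist_lt : uE => /(_ _ e0)[N2 [N2r N2P]].
(* At b, a whole number of periods after x0 and beyond both thresholds, E has its value at x0 again.
   The sine vanishes there, so only u b is left of the Wronskian and u' at infinity never enters. *)
pose n := Num.bound (k * (`|N| + `|N2|)).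
pose b := x0 + pi *+ 2 *+ n / k.
have nb : `|N| + `|N2| < pi *+ 2 *+ n / k.
  rewrite ltr_pdivlMr// mulrC.
  apply: (@lt_le_trans _ _ n%:R); first by rewrite archi_boundP// mulr_ge0// ?ltW// addr_ge0.
  rewrite -[leRHS]mulr_natr -[leLHS]mul1r ler_wpM2r//.
  by have := @pi_ge2 R; rewrite mulr2n; clear; lra.
have Nb : N < b.
  have := ler_norm N; have := normr_ge0 N2; move: nb x00; rewrite /b; clear; lra.
have N2b : N2 < b.
  have := ler_norm N2; have := normr_ge0 N; move: nb x00; rewrite /b; clear; lra.
have x0b : x0 < b.
  have := normr_ge0 N2; have := normr_ge0 N; move: nb x00; rewrite /b; clear; lra.
have bx0 : k * (b - x0) = pi *+ 2 *+ n by rewrite /b; field.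
have bD : `[x0, b] `<=` `]0, +oo[%classic.
  by move=> x /=; rewrite !in_itv/= => /andP[h _]; rewrite (lt_le_trans x00).
have qi' : mu.-integrable `[x0, b] (EFin \o q) by exact: integrableS qi.
have := solution_wronskian x0 x0b bD solu qi'.
rewrite bx0 sin_2pin cos_2pin subrr !mulr0 sin0 cos0 mulr0 mulr1 !sub0r => W.
have split : \int[mu]_(t in `]x0, +oo[) F t =
    \int[mu]_(t in `[x0, b]) F t + \int[mu]_(t in `]x0, +oo[ `&` `]b, +oo[) F t.
  rewrite (Rintegral_split (A := `]b, +oo[%classic) _ _ Fi)// addrC.
  congr (_ + _).
  rewrite -Rintegral_itv_obnd_cbnd; last first.
    apply: integrableS Fi => //; apply: subset_itvl.
    by rewrite bnd_simp.
  congr (Rintegral _ _ _); apply/seteqP; split => x /=; rewrite !in_itv/= !andbT.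
    by move=> [-> /negP]; rewrite -leNgt.
  by move=> /andP[-> xb]; split=> //; apply/negP; rewrite -leNgt.
rewrite split -W.
have tl : `|\int[mu]_(t in `]x0, +oo[ `&` `]b, +oo[) F t| < e.
  apply: le_lt_trans (NP b (ltW Nb)).
  apply: le_normr_Rintegral; first exact: measurableI.
  by apply: integrableS Fi => //; exact: measurableI.
have := N2P b N2b; rewrite sub0r normrN.
rewrite (_ : E b = E x0); last exact: Eper.
move: tl; set T := Rintegral _ _ _; move=> tl ub.
rewrite (_ : k * (u x0 - E x0) - _ = k * (u b - E x0) - T); last by ring.
apply: (le_trans (ler_normB _ _)); rewrite normrM (gtr0_norm k0) mulrDl mul1r.
by apply: lerD; [rewrite ler_wpM2l// ltW|exact: ltW].
Qed.

(** A right difference quotient at 0 does not make the derivative converge there. The mean value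
    theorem still supplies points y arbitrarily near 0 where the derivative is close to c1. *)
Lemma mean_value_near0 (v dv : R -> R) (c0 c1 e : R) :
  (forall x : R, 0 < x -> is_derive x 1 v (dv x)) -> v 0 = c0 ->
  h^-1 * (v h - v 0) @[h --> 0^'+] --> c1 -> 0 < e ->
  exists2 d, 0 < d & forall r, 0 < r -> r < d ->
    `|v r - c0| < e /\ exists2 y, 0 < y < r & `|dv y - c1| < e.
Proof.
move=> vd v0 vc e0.
have vcont : v x @[x --> 0^'+] --> v 0.
  have h1 : v 0 + h * (h^-1 * (v h - v 0)) @[h --> 0^'+] --> v 0 + 0 * c1.
    apply: cvgD; first exact: cvg_cst.
    by apply: cvgM => //; apply: cvg_at_right_filter; exact: cvg_id.
  rewrite mul0r addr0 in h1; apply: cvg_trans h1; apply: near_eq_cvg.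
  near=> h; have h0 : h != 0 by rewrite gt_eqF//; near: h; exact: nbhs_right_gt.
  by rewrite mulVKf// addrC subrK.
move/cvgrPdist_lt : (vc) => /(_ _ e0)[d1 /= d10 d1P].
move/cvgrPdist_lt : (vcont) => /(_ _ e0)[d2 /= d20 d2P].
exists (Num.min d1 d2); first by rewrite lt_min d10.
move=> r r0; rewrite lt_min => /andP[rd1 rd2].
have rb (d : R) : r < d -> ball (0 : R) d r.
  by move=> rd; rewrite /ball/= sub0r normrN gtr0_norm.
split; first by have := d2P r (rb _ rd2) r0; rewrite v0 distrC.
have [y yr yE] : exists2 y, y \in `]0, r[%R & v r - v 0 = dv y * (r - 0).
  apply: MVT => // [x|]; first by rewrite in_itv/= => /andP[x0 _]; exact: vd.
  apply/continuous_within_itvP => //; split.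
  - move=> x; rewrite in_itv/= => /andP[x0 _].
    apply: differentiable_continuous; apply/derivable1_diffP.
    by have [] := vd x x0.
  - exact: vcont.
  - apply: cvg_at_left_filter.
    apply: differentiable_continuous; apply/derivable1_diffP.
    by have [] := vd r r0.
exists y; first by move: yr; rewrite in_itv.
have := d1P r (rb _ rd1) r0; rewrite yE subr0 mulrC mulfK ?gt_eqF//.
by rewrite distrC.
Unshelve. all: by end_near. Qed.

Lemma cauchy_near0 q (k c0 c1 e : R) u : is_cauchy_solution q k c0 c1 u -> 0 < e ->
  exists2 d, 0 < d & forall r, 0 < r -> r < d ->
    `|u r - c0| < e /\ exists2 y, 0 < y < r & `|derive1 u y - c1| < e.
Proof.
move=> [solu u0 du] e0; apply: mean_value_near0 => // x x0.
rewrite derive1E; apply: DeriveDef => //; exact: derivable_solution solu x0.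
Qed.

Lemma cauchy_bounded q (k c0 c1 x : R) u : is_cauchy_solution q k c0 c1 u -> 0 < x ->
  exists2 M, 0 <= M & forall t, 0 < t <= x -> `|u t| <= M.
Proof.
move=> cu x0; have [d d0 dP] := cauchy_near0 cu ltr01.
have [solu _ _] := cu.
pose y := Num.min (d / 2) x.
have y0 : 0 < y by rewrite lt_min x0 divr_gt0.
have yx : y <= x by rewrite ge_min lexx orbT.
have yd : y < d.
  apply: (@le_lt_trans _ _ (d / 2)); first by rewrite ge_min lexx.
  by move: d0; clear; lra.
have bD : `[y, x] `<=` `]0, +oo[%classic.
  by move=> z /=; rewrite !in_itv/= => /andP[h _]; rewrite (lt_le_trans y0).
have [M M0 MP] := solution_bounded yx bD solu.
exists (M + (`|c0| + 1)); first by rewrite !addr_ge0.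
move=> t /andP[t0 tx]; have [yt|ty] := leP y t.
  by rewrite (le_trans (MP t _).1) ?yt// lerDl addr_ge0.
have := (dP t t0 (lt_trans ty yd)).1.
have := ler_normD (u t - c0) c0; rewrite subrK; move: M0; clear; lra.
Qed.

Lemma integrable_duhamel0 q (k x M : R) u : 0 < x ->
  solution `]0, +oo[ q k u -> mu.-integrable `]0, +oo[ (EFin \o q) ->
  (forall t, 0 < t <= x -> `|u t| <= M) ->
  mu.-integrable `]0, x[ (EFin \o (fun t => q t * (u t * sin (k * (t - x))))).
Proof.
move=> x0 solu qi uM.
apply: (@integrableMb _ _ _ _ M) => //.
- apply: measurable_funM; last exact: measurable_sin_affine.
  apply: derivable_measurable => t; rewrite in_itv/= => /andP[t0 _].
  exact: derivable_solution solu t0.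
- move=> t; rewrite /= in_itv/= => /andP[t0 tx]; rewrite normrM.
  by rewrite (le_trans (ler_piMr _ (normr_sin_le1 _)))// uM// t0 ltW.
- by apply: integrableS qi => //; apply: subset_itvl; rewrite bnd_simp.
Qed.

Lemma cauchy_integral_eq q (k c0 c1 x : R) u : 0 < k -> 0 < x ->
  mu.-integrable `]0, +oo[ (EFin \o q) -> is_cauchy_solution q k c0 c1 u ->
  u x = c0 * cos (k * x) + c1 * (sin (k * x) / k) +
    \int[mu]_(t in `]0, x[) (q t * (u t * dAlembert_kernel k (x - t))).
Proof.
move=> k0 x0 qi cu; have kn0 : k != 0 by rewrite gt_eqF.
have [solu _ _] := cu.
have [M M0 MP] := cauchy_bounded cu x0.
have Fi := integrable_duhamel0 x0 solu qi MP.
pose F t := q t * (u t * sin (k * (t - x))).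
suff key : k * u x - (k * c0 * cos (k * x) + c1 * sin (k * x)) =
    - \int[mu]_(t in `]0, x[) F t.
  have -> : \int[mu]_(t in `]0, x[) (q t * (u t * dAlembert_kernel k (x - t))) =
     \int[mu]_(t in `]0, x[) (- k^-1 * F t).
    apply: eq_Rintegral => t _; rewrite /F /dAlembert_kernel -[x - t]opprB mulrN sinN.
    by ring.
  by rewrite RintegralZl// mulNr -mulrN -key; field.
(* The errors come from the integral over ]0, y[, from u' y and u y against c1 and c0, and from
   moving the sine and the cosine from y to 0. *)
apply: (@eq_of_small _ _ (1 + `|c1| * k + k + `|c0| * k * k + 1)) => e e0.
have [d1 d10 d1P] := cauchy_near0 cu e0.
have [d2 d20 d2P] := integral_near0 Fi e0.
pose r := Num.min (Num.min d1 d2) (Num.min e x) / 2.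
have m0 : 0 < Num.min (Num.min d1 d2) (Num.min e x).
  by rewrite !lt_min d10 d20 e0 x0.
have r0 : 0 < r by rewrite divr_gt0.
have : r < Num.min (Num.min d1 d2) (Num.min e x).
  by move: m0; rewrite /r; move: (Num.min _ _) => m; clear; lra.
rewrite !lt_min => /andP[/andP[rd1 rd2] /andP[re rx]].
(* The lower end of the Wronskian is one of the points near 0 where u' is close to c1; at the upper
   end x the sine vanishes and k u x remains. *)
have [_ [y /andP[y0 yr] yP]] := d1P r r0 rd1.
have uyP := (d1P y y0 (lt_trans yr rd1)).1.
have yx := lt_trans yr rx.
have tl := d2P y y0 (lt_trans yr rd2) yx.
have bD : `[y, x] `<=` `]0, +oo[%classic.
  by move=> z /=; rewrite !in_itv/= => /andP[h _]; rewrite (lt_le_trans y0).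
have qi' : mu.-integrable `[y, x] (EFin \o q) by exact: integrableS qi.
have := solution_wronskian x yx bD solu qi'.
rewrite subrr mulr0 sin0 cos0 mulr0 mulr1 sub0r => W.
have split : \int[mu]_(t in `]0, x[) F t =
    \int[mu]_(t in `]0, y[) F t + \int[mu]_(t in `[y, x]) F t.
  rewrite (Rintegral_split (A := `]-oo, y[%classic) _ _ Fi)//.
  congr (_ + _).
    congr (Rintegral _ _ _); apply/seteqP; split => z /=; rewrite !in_itv/=.
      by move=> [/andP[-> _] ->].
    by move=> /andP[-> zy]; rewrite zy (lt_trans zy).
  rewrite -Rintegral_itv_bndo_bndc; last first.
    by apply: integrableS Fi => //; apply: subset_itvr; rewrite bnd_simp.
  congr (Rintegral _ _ _); apply/seteqP; split => z /=; rewrite !in_itv/=.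
    by move=> [/andP[_ ->] /negP]; rewrite -leNgt => ->.
  move=> /andP[yz ->]; rewrite (lt_le_trans y0 yz); split => //.
  by apply/negP; rewrite -leNgt.
have tl' : `|\int[mu]_(t in `]0, y[) F t| <= e.
  apply: le_trans (ltW tl); apply: le_normr_Rintegral => //.
  by apply: integrableS Fi => //; apply: subset_itvl; rewrite bnd_simp ltW.
rewrite split -W.
have dsin : `|sin (k * (y - x)) - sin (k * (0 - x))| <= k * e.
  apply: (le_trans (lipschitz_sin_affine k x (ltW y0))).
  by rewrite subr0 gtr0_norm// ler_wpM2l ?ltW// (lt_trans yr).
have dcos : `|cos (k * (y - x)) - cos (k * (0 - x))| <= k * e.
  apply: (le_trans (lipschitz_cos_affine k x (ltW y0))).
  by rewrite subr0 gtr0_norm// ler_wpM2l ?ltW// (lt_trans yr).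
move: dsin dcos; rewrite sub0r mulrN sinN cosN.
have s1 := normr_sin_le1 (k * (y - x)); have s2 := normr_cos_le1 (k * (y - x)).
move: tl' yP uyP s1 s2; set T := Rintegral _ _ _.
set sy := sin (k * (y - x)); set cy := cos (k * (y - x)).
set s := sin (k * x); set c := cos (k * x); set u1 := derive1 u y.
move=> tl' u1P uyP s1 s2 dsin dcos.
rewrite (_ : _ - _ = T + (- ((u1 - c1) * sy) - c1 * (sy - - s)) +
   (k * ((u y - c0) * cy) + k * (c0 * (cy - c)))); last by ring.
have h1 : `|(u1 - c1) * sy| <= e.
  by rewrite normrM (le_trans (ler_piMr _ s1))// ltW.
have h2 : `|c1 * (sy - - s)| <= `|c1| * (k * e) by rewrite normrM ler_wpM2l.
have h3 : `|k * ((u y - c0) * cy)| <= k * e.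
  by rewrite !normrM (gtr0_norm k0) (ler_wpM2l (ltW k0))// (le_trans (ler_piMr _ s2))// ltW.
have h4 : `|k * (c0 * (cy - c))| <= k * (`|c0| * (k * e)).
  by rewrite !normrM (gtr0_norm k0) (ler_wpM2l (ltW k0))// ler_wpM2l.
apply: (le_trans (ler_normD _ _)).
apply: (le_trans (lerD (ler_normD _ _) (ler_normD _ _))).
apply: (le_trans (lerD (lerD tl' (ler_normB _ _)) (lerD h3 h4))).
rewrite normrN; apply: (le_trans (lerD (lerD (lexx e) (lerD h1 h2)) (lexx _))).
by rewrite le_eqVlt; apply/orP; left; apply/eqP; ring.
Qed.

Lemma jost_components (f : R -> R -> R[i]) q (k : R) : is_jost_plus q f ->
  [/\ solution `]0, +oo[ q k (fun x => complex.Re (f x k)),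
      solution `]0, +oo[ q k (fun x => complex.Im (f x k)),
      complex.Re (f x k) - cos (k * x) @[x --> +oo] --> (0 : R) &
      complex.Im (f x k) - sin (k * x) @[x --> +oo] --> (0 : R)].
Proof.
move=> /(_ k)[[s1 s2] lim]; split => //.
- apply/cvgrPdist_lt => e e0; move/cvgrPdist_lt : lim => /(_ _ e0).
  apply: filterS => x; rewrite !sub0r !normrN; apply: le_lt_trans.
  case: (f x k) => a b; rewrite /cexpi/= [leRHS]ger0_norm ?sqrtr_ge0//.
  by rewrite -sqrtr_sqr ler_wsqrtr// lerDl sqr_ge0.
- apply/cvgrPdist_lt => e e0; move/cvgrPdist_lt : lim => /(_ _ e0).
  apply: filterS => x; rewrite !sub0r !normrN; apply: le_lt_trans.
  case: (f x k) => a b; rewrite /cexpi/= [leRHS]ger0_norm ?sqrtr_ge0//.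
  by rewrite -sqrtr_sqr ler_wsqrtr// lerDr sqr_ge0.
Qed.

End IntegralEquations.

(** * Wave equations with a potential *)

Section Majorants.
Context {R : realType}.
Notation mu := (@lebesgue_measure R).

(** The infimum of the admissible constants is admissible, and the step turns C into 1 + th C, so
    the infimum is at most 1 / (1 - th). Any finite constant starts the argument and then
    disappears; this matters because the initial one depends on the frequencies and the
    coefficients. *)
Lemma contraction_bound (D : R -> R -> Prop) (v v0 Om : R -> R -> R) (th : R) :
  0 < th < 1 -> (forall x z, D x z -> 0 <= Om x z) ->
  (forall x z, D x z -> `|v0 x z| <= Om x z) ->
  (exists2 C, 0 <= C & forall x z, D x z -> `|v x z| <= C * Om x z) ->
  (forall C, 0 <= C -> (forall x z, D x z -> `|v x z| <= C * Om x z) ->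
     forall x z, D x z -> `|v x z - v0 x z| <= th * C * Om x z) ->
  forall x z, D x z -> `|v x z| <= (1 - th)^-1 * Om x z /\
    `|v x z - v0 x z| <= th * (1 - th)^-1 * Om x z.
Proof.
move=> /andP[th0 th1] Om0 v0Om [C0 C00 vC0] step.
pose S := [set C : R | 0 <= C /\ forall x z, D x z -> `|v x z| <= C * Om x z].
have SC0 : S C0 by [].
have lbS : lbound S 0 by move=> C [].
have infS : has_inf S by split; [exists C0|exists 0].
have th1' : 0 < 1 - th by rewrite subr_gt0.
have Sstep C : S C -> S (1 + th * C).
  move=> [CC CP]; split; first by rewrite addr_ge0// mulr_ge0// ltW.
  move=> x z Dxz; have := step C CC CP x z Dxz; have := v0Om x z Dxz.
  have := ler_normD (v x z - v0 x z) (v0 x z); rewrite subrK mulrDl mul1r.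
  by clear; lra.
have Sinf : S (inf S).
  split; first by apply: lb_le_inf => //; exists C0.
  move=> x z Dxz; have Om_ge0 := Om0 x z Dxz.
  apply/ler_addgt0Pl => e e0.
  have e1 : 0 < e / (Om x z + 1) by rewrite divr_gt0// ltr_wpDl.
  have [C [CC CP] Ce] := inf_adherent e1 infS.
  apply: (le_trans (CP x z Dxz)).
  apply: (@le_trans _ _ ((inf S + e / (Om x z + 1)) * Om x z)).
    by apply: ler_wpM2r => //; exact: ltW.
  rewrite mulrDl addrC lerD2r mulrAC ler_pdivrMr ?ltr_wpDl//.
  by rewrite ler_wpM2l ?ltW// ltrDl.
have cb : inf S <= (1 - th)^-1.
  rewrite -[leRHS]mul1r ler_pdivlMr// mulrBr mulr1 lerBlDr.
  rewrite [_ * th]mulrC; apply: ge_inf; [by exists 0|exact: Sstep].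
have S1 x z : D x z -> `|v x z| <= (1 - th)^-1 * Om x z.
  move=> Dxz; apply: (le_trans (Sinf.2 x z Dxz)).
  by apply: ler_wpM2r => //; exact: Om0.
move=> x z Dxz; split; first exact: S1.
by apply: step => //; rewrite invr_ge0 ltW.
Qed.

(* The bound P + Q [k2 < z] of the derivative is integrated exactly. *)
Lemma lipschitz_kinkr (G dG : R -> R) (P Q k2 x y : R) : x <= y -> 0 <= Q ->
  (forall z : R, is_derive z 1 G (dG z)) ->
  (forall z : R, x < z < y -> `|dG z| <= P + Q * (k2 < z)%R%:R) ->
  `|G y - G x| <= P * (y - x) + Q * (Num.max (y - k2) 0 - Num.max (x - k2) 0).
Proof.
move=> xy Q0 dGP bnd.
have lip (a b M : R) : x <= a -> a <= b -> b <= y ->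
    (forall z, a < z < b -> `|dG z| <= M) -> `|G b - G a| <= M * (b - a).
  move=> xa ab by_ MP; have [->|aNb] := eqVneq a b; first by rewrite !subrr normr0 mulr0.
  have ab' : a < b by rewrite lt_neqAle aNb.
  have [c cab ->] : exists2 c, c \in `]a, b[%R & G b - G a = dG c * (b - a).
    apply: MVT => //; apply: derivable_within_continuous => z _.
    by have [] := dGP z.
  rewrite normrM (@ger0_norm _ (b - a)) ?subr_ge0// ler_wpM2r ?subr_ge0//.
  by apply: MP; move: cab; rewrite in_itv.
have [yk|ky] := leP y k2.
  rewrite !max_r ?subrr ?mulr0 ?addr0 ?subr_le0// ?(le_trans xy)//.
  apply: lip => // z /andP[xz zy]; have := bnd z; rewrite xz zy => /(_ isT).
  by rewrite ltNge (le_trans (ltW zy) yk) mulr0 addr0.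
have [kx|xk] := leP k2 x.
  rewrite !max_l ?subr_ge0// ?(ltW ky)//.
  rewrite (_ : P * _ + _ = (P + Q) * (y - x)); last by ring.
  apply: lip => // z /andP[xz zy]; have := bnd z; rewrite xz zy => /(_ isT).
  by rewrite (le_lt_trans kx xz) mulr1.
rewrite max_l ?subr_ge0 ?(ltW ky)// max_r ?subr_le0 ?(ltW xk)// subr0.
have h1 : `|G k2 - G x| <= P * (k2 - x).
  apply: lip => //; rewrite ?ltW// => z /andP[xz zk].
  have := bnd z; rewrite xz (lt_trans zk ky) => /(_ isT).
  by rewrite ltNge (ltW zk) mulr0 addr0.
have h2 : `|G y - G k2| <= (P + Q) * (y - k2).
  apply: lip => //; rewrite ?ltW// => z /andP[kz zy].
  have := bnd z; rewrite zy (lt_trans xk kz) => /(_ isT).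
  by rewrite kz mulr1.
have := ler_distD (G k2) (G y) (G x); move: h1 h2.
move: `|_| `|_| `|_| => a b c; clear; nra.
Qed.

(** The interval is cut at k1, and the one-sided case is applied to both pieces. The kinks are the
    edges of the region where the data are small: Jost waves have one such edge, waves with data at
    0 have two. *)
Lemma lipschitz_kinks (G dG : R -> R) (P Q k1 k2 x y : R) : x <= y -> 0 <= Q ->
  (forall z : R, is_derive z 1 G (dG z)) ->
  (forall z : R, x < z < y -> `|dG z| <= P + Q * (z < k1)%R%:R + Q * (k2 < z)%R%:R) ->
  `|G y - G x| <= P * (y - x) + Q * Num.max (k1 - x) 0 + Q * Num.max (y - k2) 0.
Proof.
move=> xy Q0 dGP bnd.
have mx0 : 0 <= Q * Num.max (x - k2) 0 by rewrite mulr_ge0// le_max lexx orbT.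
have [kx|xk] := leP k1 x.
  rewrite [Num.max (k1 - x) 0]max_r ?subr_le0// mulr0 addr0.
  apply: (le_trans (lipschitz_kinkr xy Q0 dGP (P := P) (k2 := k2) _)).
    move=> z xzy; have := bnd z xzy; have /andP[xz _] := xzy.
    by rewrite [z < k1]ltNge (le_trans kx (ltW xz)) mulr0 addr0.
  by rewrite lerD2l mulrBr lerBlDr lerDl.
rewrite [Num.max (k1 - x) 0]max_l; last by rewrite subr_ge0 ltW.
have [yk|ky] := leP y k1.
  apply: (le_trans (lipschitz_kinkr xy Q0 dGP (P := P + Q) (k2 := k2) _)).
    move=> z xzy; have := bnd z xzy; have /andP[_ zy] := xzy.
    by rewrite (lt_le_trans zy yk) mulr1.
  have : Q * (y - x) <= Q * (k1 - x) by rewrite ler_wpM2l// lerD2r.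
  move: mx0; move: (Num.max (y - k2) 0) (Num.max (x - k2) 0) => a b; clear; nra.
have h1 := lipschitz_kinkr (ltW xk) Q0 dGP (P := P + Q) (k2 := k2).
have {}h1 := h1 _; have {}h1 : `|G k1 - G x| <=
    (P + Q) * (k1 - x) + Q * (Num.max (k1 - k2) 0 - Num.max (x - k2) 0).
  apply: h1 => z /andP[xz zk]; have := bnd z; rewrite xz (lt_trans zk ky) => /(_ isT).
  by rewrite zk mulr1.
have h2 := lipschitz_kinkr (ltW ky) Q0 dGP (P := P) (k2 := k2).
have {}h2 : `|G y - G k1| <=
    P * (y - k1) + Q * (Num.max (y - k2) 0 - Num.max (k1 - k2) 0).
  apply: h2 => z /andP[kz zy]; have := bnd z; rewrite zy (lt_trans xk kz) => /(_ isT).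
  by rewrite [z < k1]ltNge (ltW kz) mulr0 addr0.
have := ler_distD (G k1) (G y) (G x); move: h1 h2 mx0.
move: (Num.max (y - k2) 0) (Num.max (k1 - k2) 0) (Num.max (x - k2) 0) `|_| `|_| `|_| => a b c d e f.
by clear; nra.
Qed.

Lemma Rintegral_small (m : R -> R) (e : R) : mu.-integrable setT (EFin \o m) ->
  (forall t, 0 <= m t) -> 0 < e -> exists2 d, 0 < d &
    forall x y, y - x <= d -> \int[mu]_(t in `]x, y]) m t <= e.
Proof.
move=> mi m0 e0; have [d [d0 dP]] := integral_normr_continuous mi e0.
exists (d / 2); first by rewrite divr_gt0.
move=> x y xy.
have muxy : (mu `]x, y]%classic < d%:E)%E.
  rewrite lebesgue_measure_itv/=; case: ifP => _; rewrite ?lte_fin//.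
  by move: xy d0; clear; lra.
have := dP _ (measurable_itv _) muxy => /ltW; congr (_ <= _).
by apply: eq_Rintegral => t _; rewrite ger0_norm.
Qed.

Lemma Rintegral_itvy_split (x y : R) f : x <= y ->
  mu.-integrable `]x, +oo[ (EFin \o f) ->
  \int[mu]_(t in `]x, +oo[) f t =
  \int[mu]_(t in `]x, y]) f t + \int[mu]_(t in `]y, +oo[) f t.
Proof.
move=> xy fi; rewrite -(@Rintegral_itvB _ f (BRight x) +oo%O y)//.
by rewrite addrC subrK.
Qed.

Lemma Rintegral0_itv_split (x y : R) f : 0 <= x -> x <= y ->
  mu.-integrable `]0, y[ (EFin \o f) ->
  \int[mu]_(t in `]0, y[) f t =
  \int[mu]_(t in `]0, x]) f t + \int[mu]_(t in `]x, y[) f t.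
Proof.
move=> x0 xy fi; have [E|xNy] := eqVneq x y.
  rewrite -E in fi *; rewrite (set_itvoo0 x) Rintegral_set0 addr0.
  by rewrite Rintegral_itv_bndo_bndc.
rewrite -(@Rintegral_itvB _ f (BRight 0) (BLeft y) x)// ?bnd_simp//.
  by rewrite addrC subrK.
by rewrite lt_neqAle xNy.
Qed.

(* A weight that at least doubles from one cell to the next, the integral of
   m over each cell being at most th / 2. *)
Lemma exists_decreasing_weight (m : R -> R) (th : R) : 0 < th ->
  mu.-integrable setT (EFin \o m) -> (forall t, 0 <= m t) ->
  exists w : R -> R, exists2 K, 1 <= K &
   [/\ forall x, 1 <= w x <= K, measurable_fun setT w,
       forall x y, 0 <= x -> x <= y -> w y <= w x &
       forall x, 0 <= x -> \int[mu]_(t in `]x, +oo[) (m t * w t) <= th * w x].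
Proof.
move=> th0 mi m0; have th2 : 0 < th / 2 by rewrite divr_gt0.
have [d d0 dP] := Rintegral_small mi m0 th2.
have [N NP] := integral_tail measurableT mi th2.
(* Beyond X the integral of m is at most th / 2, so the weight 1 will do there; cells of length d
   are then added from right to left until 0 is passed. *)
pose X := Num.max N 0.
have iS (D : set R) : measurable D -> mu.-integrable D (EFin \o m).
  by move=> mD; exact: integrableS mi.
have iSw (D : set R) (w : R -> R) (K : R) : measurable D -> measurable_fun setT w ->
   (forall x, 1 <= w x <= K) -> mu.-integrable D (EFin \o (fun t => m t * w t)).
  move=> mD mw wK; apply: (@integrableMb _ _ _ _ K) => //.
  - exact: measurable_funTS.
  - move=> x _; have /andP[w1 wk] := wK x; rewrite ger0_norm//.
    exact: le_trans w1.
  - exact: iS.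
have cells (n : nat) : exists w : R -> R, exists2 K, 1 <= K &
   [/\ forall x, 1 <= w x <= K, measurable_fun setT w,
       forall x y, X - d * n%:R <= x -> x <= y -> w y <= w x &
       forall x, X - d * n%:R <= x -> \int[mu]_(t in `]x, +oo[) (m t * w t) <= th * w x].
  elim: n => [|n [w [K K1 [wK mw wdecr wint]]]].
    exists (cst 1), 1 => //; split => //; first by move=> x; rewrite lexx.
    move=> x; rewrite mulr0 subr0 => Xx; rewrite mulr1.
    under eq_Rintegral do rewrite mulr1.
    have Nx : N <= x by apply: le_trans Xx; rewrite le_max lexx.
    have := NP x Nx; rewrite setTI => h.
    apply: (@le_trans _ _ (th / 2)); last by move: th0; clear; lra.
    apply: le_trans (ltW h); rewrite le_eqVlt; apply/orP; left; apply/eqP.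
    by apply: eq_Rintegral => t _; rewrite ger0_norm.
  pose y := X - d * n%:R.
  (* With the value 2 K on the new cell, the cell contributes at most th / 2 * (2 K) and everything
     to its right at most th K, in total th times the new value. *)
  pose w' x := if y <= x then w x else 2 * K.
  have K2 : 1 <= 2 * K by move: K1; clear; lra.
  have w'K x : 1 <= w' x <= 2 * K.
    rewrite /w'; case: ifP => _; last by rewrite K2 lexx.
    have /andP[-> wk] := wK x; rewrite (le_trans wk)//; move: K1; clear; lra.
  have mw' : measurable_fun setT w'.
    apply: measurable_fun_ifT => //.
    by apply: measurable_fun_ler.
  exists w', (2 * K) => //; split => //.
    move=> x z yx xz; rewrite /w'; case: (leP y x) => [yx'|xy].
      by rewrite (le_trans yx' xz); apply: wdecr.
    case: ifP => // _; have /andP[_ wk] := wK z; rewrite (le_trans wk)//.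
    by move: K1; clear; lra.
  have ge_y x : y <= x -> \int[mu]_(t in `]x, +oo[) (m t * w' t) <= th * w x.
    move=> yx; apply: le_trans (wint x yx).
    rewrite le_eqVlt; apply/orP; left; apply/eqP; apply: eq_Rintegral => t.
    rewrite inE/= in_itv/= andbT => xt; rewrite /w' (le_trans yx (ltW xt))//.
  move=> x yx; rewrite {2}/w'; case: (leP y x) => [|xy]; first exact: ge_y.
  rewrite (Rintegral_itvy_split (ltW xy)); last exact: (iSw _ _ (2 * K)).
  have i1 : \int[mu]_(t in `]x, y]) (m t * w' t) <= th / 2 * (2 * K).
    have K20 : 0 <= 2 * K by exact: le_trans K2.
    apply: (@le_trans _ _ (\int[mu]_(t in `]x, y]) (m t * (2 * K)))).
      apply: le_Rintegral => //; first exact: (iSw _ _ (2 * K)).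
        by apply: (iSw _ (cst (2 * K)) (2 * K)) => // z; rewrite lexx K2.
      by move=> t _; rewrite ler_wpM2l//; have /andP[] := w'K t.
    rewrite RintegralZr//; last exact: iS.
    rewrite ler_wpM2r//; apply: dP.
    by move: yx; rewrite /y -natr1; clear; lra.
  have i2 := ge_y y (lexx y).
  have /andP[_ wy] := wK y.
  have : th * w y <= th * K by rewrite ler_wpM2l// ltW.
  move: i1 i2; clear; lra.
have [w [K K1 [wK mw wdecr wint]]] := cells (Num.bound (X / d)).
have X0 : 0 <= X by rewrite le_max lexx orbT.
have small : X - d * (Num.bound (X / d))%:R <= 0.
  have := archi_boundP (divr_ge0 X0 (ltW d0)).
  by rewrite ltr_pdivrMr// mulrC => /ltW; rewrite subr_le0.
exists w, K => //; split => //.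
- by move=> x y x0 xy; apply: wdecr => //; exact: le_trans small _.
- by move=> x x0; apply: wint; exact: le_trans small _.
Qed.

(** Mirror image of the decreasing weight: the cells are added from left to right, starting at 0,
    until b is passed. *)
Lemma exists_increasing_weight (m : R -> R) (b th : R) : 0 < th ->
  mu.-integrable setT (EFin \o m) -> (forall t, 0 <= m t) ->
  exists w : R -> R, exists2 K, 1 <= K &
   [/\ forall x, 1 <= w x <= K, measurable_fun setT w &
       forall x, 0 <= x <= b -> \int[mu]_(t in `]0, x[) (m t * w t) <= th * w x].
Proof.
move=> th0 mi m0; have th2 : 0 < th / 2 by rewrite divr_gt0.
have [d d0 dP] := Rintegral_small mi m0 th2.
have iS (D : set R) : measurable D -> mu.-integrable D (EFin \o m).
  by move=> mD; exact: integrableS mi.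
have iSw (D : set R) (w : R -> R) (K : R) : measurable D -> measurable_fun setT w ->
   (forall x, 1 <= w x <= K) -> mu.-integrable D (EFin \o (fun t => m t * w t)).
  move=> mD mw wK; apply: (@integrableMb _ _ _ _ K) => //.
  - exact: measurable_funTS.
  - move=> x _; have /andP[w1 wk] := wK x; rewrite ger0_norm//.
    exact: le_trans w1.
  - exact: iS.
have cells (n : nat) : exists w : R -> R, exists2 K, 1 <= K &
   [/\ forall x, 1 <= w x <= K, measurable_fun setT w &
       forall x, 0 <= x <= d * n%:R -> \int[mu]_(t in `]0, x[) (m t * w t) <= th * w x].
  elim: n => [|n [w [K K1 [wK mw wint]]]].
    exists (cst 1), 1 => //; split => //; first by move=> x; rewrite lexx.
    move=> x; rewrite mulr0 -eq_le => /eqP <-.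
    by rewrite set_itvoo0 Rintegral_set0 mulr1 ltW.
  pose y := d * n%:R.
  have y0 : 0 <= y by rewrite mulr_ge0// ltW.
  pose w' x := if x <= y then w x else 2 * K.
  have K2 : 1 <= 2 * K by move: K1; clear; lra.
  have w'K x : 1 <= w' x <= 2 * K.
    rewrite /w'; case: ifP => _; last by rewrite K2 lexx.
    have /andP[-> wk] := wK x; rewrite (le_trans wk)//; move: K1; clear; lra.
  have mw' : measurable_fun setT w'.
    apply: measurable_fun_ifT => //.
    by apply: measurable_fun_ler.
  exists w', (2 * K) => //; split => //.
  have le_y x : 0 <= x <= y -> \int[mu]_(t in `]0, x[) (m t * w' t) <= th * w x.
    move=> /andP[x0 xy]; apply: le_trans (wint x _); last by rewrite x0.
    rewrite le_eqVlt; apply/orP; left; apply/eqP; apply: eq_Rintegral => t.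
    by rewrite inE/= in_itv/= => /andP[_ tx]; rewrite /w' (le_trans (ltW tx) xy).
  move=> x /andP[x0 xd]; rewrite {2}/w'; case: (leP x y) => [xy|yx].
    by apply: le_y; rewrite x0.
  rewrite (Rintegral0_itv_split y0 (ltW yx)); last exact: (iSw _ _ (2 * K)).
  have i1 : \int[mu]_(t in `]y, x[) (m t * w' t) <= th / 2 * (2 * K).
    have K20 : 0 <= 2 * K by exact: le_trans K2.
    rewrite Rintegral_itv_bndo_bndc; last exact: (iSw _ _ (2 * K)).
    apply: (@le_trans _ _ (\int[mu]_(t in `]y, x]) (m t * (2 * K)))).
      apply: le_Rintegral => //; first exact: (iSw _ _ (2 * K)).
        by apply: (iSw _ (cst (2 * K)) (2 * K)) => // z; rewrite lexx K2.
      by move=> t _; rewrite ler_wpM2l//; have /andP[] := w'K t.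
    rewrite RintegralZr//; last exact: iS.
    rewrite ler_wpM2r//; apply: dP.
    by move: xd; rewrite /y -natr1; clear; lra.
  have i2 : \int[mu]_(t in `]0, y]) (m t * w' t) <= th * w y.
    rewrite -Rintegral_itv_bndo_bndc; last exact: (iSw _ _ (2 * K)).
    by apply: le_y; rewrite y0 lexx.
  have /andP[_ wy] := wK y.
  have : th * w y <= th * K by rewrite ler_wpM2l// ltW.
  move: i1 i2; clear; lra.
have [w [K K1 [wK mw wint]]] := cells (Num.bound (`|b| / d)).
exists w, K => //; split => // x /andP[x0 xb]; apply: wint; rewrite x0/=.
apply: (le_trans xb); apply: (le_trans (ler_norm b)).
have := archi_boundP (divr_ge0 (normr_ge0 b) (ltW d0)).
by rewrite ltr_pdivrMr// mulrC => /ltW.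
Qed.

End Majorants.

(** * Sums over frequencies as waves in an auxiliary variable z *)

Section WaveFamilies.
Context {R : realType}.
Notation mu := (@lebesgue_measure R).

(* The real part of sum_j e^(i k_j z) (A_j + i B_j)(x). *)
Definition wave (n : nat) (k : nat -> R) (A B : nat -> R -> R) (x z : R) : R :=
  \sum_(j < n) (cos (k j * z) * A j x - sin (k j * z) * B j x).

Definition wave_primitive (n : nat) (k : nat -> R) (A B : nat -> R -> R) (x z : R) : R :=
  \sum_(j < n) (sin (k j * z) * (A j x / k j) + cos (k j * z) * (B j x / k j)).

Lemma is_derive_sin_scale (k t : R) :
  is_derive t 1 (fun t => sin (k * t)) (k * cos (k * t)).
Proof.
have := is_derive_sin_affine k 0 t; rewrite subr0.
by under eq_fun do rewrite subr0.
Qed.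

Lemma is_derive_cos_scale (k t : R) :
  is_derive t 1 (fun t => cos (k * t)) (- (k * sin (k * t))).
Proof.
have := is_derive_cos_affine k 0 t; rewrite subr0.
by under eq_fun do rewrite subr0.
Qed.

Lemma is_derive_mulr_cst (f : R -> R) (df c t : R) :
  is_derive t 1 f df -> is_derive t 1 (fun t => f t * c) (df * c).
Proof.
move=> h; have := @is_deriveZ _ _ _ f c t 1 df h.
rewrite /GRing.scale /= [df * c]mulrC; congr (is_derive _ _ _ _).
by apply/funext => s; rewrite mulrC.
Qed.

Lemma is_derive_wave_primitive n k A B (x z : R) : (forall j, (j < n)%N -> k j != 0) ->
  is_derive z 1 (wave_primitive n k A B x) (wave n k A B x z).
Proof.
move=> k0; rewrite /wave_primitive /wave.
elim: n k0 => [|n IH] k0.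
  rewrite big_ord0; under eq_fun do rewrite big_ord0.
  exact: is_derive_cst.
rewrite big_ord_recr/=; under eq_fun do rewrite big_ord_recr/=.
have kn := k0 n (ltnSn n).
apply: is_deriveD; first by apply: IH => j jn; apply: k0; exact: ltnW.
have h1 := is_derive_mulr_cst (A n x / k n) (is_derive_sin_scale (k n) z).
have h2 := is_derive_mulr_cst (B n x / k n) (is_derive_cos_scale (k n) z).
apply: is_derive_eq (is_deriveD h1 h2) _.
by field.
Qed.

(** The addition formulas turn the increment over [z - h, z + h] into one factor sin (k h) / k per
    frequency. Read from right to left, the frequencies disappear into an integral of the wave over
    its segment of dependence. *)
Lemma wave_primitive_increment n k A B (x z h : R) : (forall j, (j < n)%N -> k j != 0) ->
  (wave_primitive n k A B x (z + h) - wave_primitive n k A B x (z - h)) / 2 =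
  \sum_(j < n) (cos (k j * z) * (A j x * dAlembert_kernel (k j) h) -
                sin (k j * z) * (B j x * dAlembert_kernel (k j) h)).
Proof.
move=> k0; rewrite /wave_primitive -sumrB mulr_suml; apply: eq_bigr => j _.
have kj := k0 j (ltn_ord j).
rewrite /dAlembert_kernel mulrDr mulrBr sinD sinB cosD cosB.
by field.
Qed.

Lemma Rintegral_wave (D : set R) n (a b : nat -> R) (u v : nat -> R -> R) (q : R -> R) :
  measurable D ->
  (forall j, (j < n)%N -> mu.-integrable D (EFin \o (fun t => q t * u j t))) ->
  (forall j, (j < n)%N -> mu.-integrable D (EFin \o (fun t => q t * v j t))) ->
  mu.-integrable D
    (EFin \o (fun t => q t * \sum_(j < n) (a j * u j t - b j * v j t))) /\
  \int[mu]_(t in D) (q t * \sum_(j < n) (a j * u j t - b j * v j t)) =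
  \sum_(j < n) (a j * \int[mu]_(t in D) (q t * u j t) -
                b j * \int[mu]_(t in D) (q t * v j t)).
Proof.
move=> mD; elim: n => [|n IH] ui vi.
  rewrite big_ord0; under eq_fun do rewrite big_ord0 mulr0.
  split; first exact: integrable0.
  by rewrite Rintegral_cst// mul0r.
have [|j jn|IHi IHe] := IH; first by move=> j jn; apply: ui; exact: ltnW.
  by apply: vi; exact: ltnW.
have ui' := integrableZlR (a n) mD (ui n (ltnSn n)).
have vi' := integrableZlR (b n) mD (vi n (ltnSn n)).
have E t : q t * \sum_(j < n.+1) (a j * u j t - b j * v j t) =
   q t * \sum_(j < n) (a j * u j t - b j * v j t) +
   (a n * (q t * u n t) - b n * (q t * v n t)).
  by rewrite big_ord_recr/=; ring.
have uvi : mu.-integrable D (EFin \o (fun t => a n * (q t * u n t) - b n * (q t * v n t))).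
  by have := @integrableB _ _ R mu D mD _ _ ui' vi'.
split.
  under eq_fun do rewrite E.
  by have := @integrableD _ _ R mu D mD _ _ IHi uvi.
under eq_Rintegral do rewrite E.
rewrite RintegralD// IHe big_ord_recr/= RintegralB// !RintegralZl//.
- exact: vi.
- exact: ui.
Qed.

(** What the wave estimates retain of a solution. It is stable under real linear combinations, hence
    applies to coefficients frozen at a fixed x. The bound is asked only beyond [Xm], because Jost
    solutions are not yet known to be bounded near 0. *)
Definition volterra_tail (q : R -> R) (k : R) (E : R -> R) (Xm : R) (u : R -> R) : Prop :=
  [/\ measurable_fun `]Xm, +oo[ u,
      exists2 M, 0 <= M & forall x, Xm < x -> `|u x| <= M &
      forall x, Xm < x ->
        u x = E x + \int[mu]_(t in `]x, +oo[) (q t * (u t * dAlembert_kernel k (t - x)))].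

Definition volterra0 (q : R -> R) (k : R) (E : R -> R) (b : R) (u : R -> R) : Prop :=
  [/\ measurable_fun `]0, b[ u,
      exists2 M, 0 <= M & forall x, 0 < x <= b -> `|u x| <= M &
      forall x, 0 < x <= b ->
        u x = E x + \int[mu]_(t in `]0, x[) (q t * (u t * dAlembert_kernel k (x - t)))].

Lemma normr_kernel_le (k h : R) : 0 < k -> `|dAlembert_kernel k h| <= k^-1.
Proof.
move=> k0; rewrite /dAlembert_kernel normrM normfV (gtr0_norm k0).
by rewrite ler_piMl ?invr_ge0 ?(ltW k0)// normr_sin_le1.
Qed.

Lemma measurable_kernel_tail (D : set R) (k x : R) :
  measurable_fun D (fun t => dAlembert_kernel k (t - x)).
Proof. by apply: measurable_funM => //; exact: measurable_sin_affine. Qed.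

Lemma measurable_kernel0 (D : set R) (k x : R) :
  measurable_fun D (fun t => dAlembert_kernel k (x - t)).
Proof.
apply: measurable_funM => //.
under eq_fun do rewrite -opprB mulrN -mulNr.
exact: measurable_sin_affine.
Qed.

Lemma volterra_tail_integrable q k E Xm u x : 0 < k -> 0 <= Xm -> Xm < x ->
  mu.-integrable `]0, +oo[ (EFin \o q) -> volterra_tail q k E Xm u ->
  mu.-integrable `]x, +oo[ (EFin \o (fun t => q t * (u t * dAlembert_kernel k (t - x)))).
Proof.
move=> k0 Xm0 Xmx qi [mu_ [M M0 MP] _].
apply: (@integrableMb _ _ _ _ (M * k^-1)) => //.
- apply: measurable_funM; last exact: measurable_kernel_tail.
  by apply: measurable_funS mu_ => //; apply: subset_itvr; rewrite bnd_simp ltW.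
- move=> t; rewrite /= in_itv/= andbT => xt; rewrite normrM ler_pM//.
    by apply: MP; exact: lt_trans xt.
  exact: normr_kernel_le.
- apply: integrableS qi => //; apply: subset_itvr; rewrite bnd_simp.
  by rewrite ltW// (le_lt_trans Xm0).
Qed.

Lemma volterra0_integrable q k E b u x : 0 < k -> 0 < x <= b ->
  mu.-integrable `]0, b[ (EFin \o q) -> volterra0 q k E b u ->
  mu.-integrable `]0, x[ (EFin \o (fun t => q t * (u t * dAlembert_kernel k (x - t)))).
Proof.
move=> k0 /andP[x0 xb] qi [mu_ [M M0 MP] _].
have xb' : `]0, x[ `<=` `]0, b[ by apply: subset_itvl; rewrite bnd_simp.
apply: (@integrableMb _ _ _ _ (M * k^-1)) => //.
- apply: measurable_funM; last exact: measurable_kernel0.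
  exact: measurable_funS mu_.
- move=> t; rewrite /= in_itv/= => /andP[t0 tx]; rewrite normrM ler_pM//.
    by apply: MP; rewrite t0 (le_trans (ltW tx)).
  exact: normr_kernel_le.
- exact: integrableS qi.
Qed.

Lemma wave_bounded (P : R -> Prop) n k A B :
  (forall j, (j < n)%N -> exists2 M, 0 <= M & forall x, P x -> `|A j x| <= M) ->
  (forall j, (j < n)%N -> exists2 M, 0 <= M & forall x, P x -> `|B j x| <= M) ->
  exists2 M, 0 <= M & forall x z, P x -> `|wave n k A B x z| <= M.
Proof.
rewrite /wave; elim: n => [|n IH] hA hB.
  by exists 0 => // x z _; rewrite big_ord0 normr0.
have [|j jn|M M0 MP] := IH; first by move=> j jn; apply: hA; exact: ltnW.
  by apply: hB; exact: ltnW.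
have [MA MA0 MAP] := hA n (ltnSn n); have [MB MB0 MBP] := hB n (ltnSn n).
exists (M + (MA + MB)); first by rewrite !addr_ge0.
move=> x z Px; rewrite big_ord_recr/=.
apply: (le_trans (ler_normD _ _)); apply: lerD; first exact: MP.
apply: (le_trans (ler_normB _ _)); apply: lerD; rewrite normrM.
  by rewrite (le_trans (ler_piMl _ (normr_cos_le1 _)))// MAP.
by rewrite (le_trans (ler_piMl _ (normr_sin_le1 _)))// MBP.
Qed.

(** Summed over the frequencies, the Duhamel terms form q t times half an increment of the
    primitive, so the estimate sees the wave as a whole and not its coefficients. *)
Lemma wave_tail_bound q n k A B EA EB (Xm x z : R) (P : R -> R) :
  (forall j, (j < n)%N -> 0 < k j) -> 0 <= Xm -> Xm < x ->
  mu.-integrable `]0, +oo[ (EFin \o q) ->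
  (forall j, (j < n)%N -> volterra_tail q (k j) (EA j) Xm (A j)) ->
  (forall j, (j < n)%N -> volterra_tail q (k j) (EB j) Xm (B j)) ->
  mu.-integrable `]x, +oo[ (EFin \o P) ->
  (forall t, x < t -> `|q t| * (`|wave_primitive n k A B t (z + (t - x)) -
     wave_primitive n k A B t (z - (t - x))| / 2) <= P t) ->
  `|wave n k A B x z - wave n k EA EB x z| <= \int[mu]_(t in `]x, +oo[) P t.
Proof.
move=> k0 Xm0 Xmx qi hA hB Pi HP.
have kn j : (j < n)%N -> k j != 0 by move=> /k0; exact: lt0r_neq0.
have [Ii Ie] := @Rintegral_wave `]x, +oo[ n (fun j => cos (k j * z))
  (fun j => sin (k j * z)) (fun j t => A j t * dAlembert_kernel (k j) (t - x))
  (fun j t => B j t * dAlembert_kernel (k j) (t - x)) q (measurable_itv _)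
  (fun j jn => volterra_tail_integrable (k0 j jn) Xm0 Xmx qi (hA j jn))
  (fun j jn => volterra_tail_integrable (k0 j jn) Xm0 Xmx qi (hB j jn)).
have -> : wave n k A B x z - wave n k EA EB x z =
    \int[mu]_(t in `]x, +oo[) (q t * \sum_(j < n)
      (cos (k j * z) * (A j t * dAlembert_kernel (k j) (t - x)) -
       sin (k j * z) * (B j t * dAlembert_kernel (k j) (t - x)))).
  rewrite Ie /wave -sumrB; apply: eq_bigr => j _.
  have [_ _ eA] := hA j (ltn_ord j); have [_ _ eB] := hB j (ltn_ord j).
  by rewrite eA// eB//; ring.
apply: ler_norm_Rintegral => // t; rewrite /= in_itv/= andbT => xt.
rewrite -wave_primitive_increment// !normrM (ger0_norm (_ : 0 <= 2^-1))//.
exact: HP.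
Qed.

Lemma wave0_bound q n k A B EA EB (b x z : R) (P : R -> R) :
  (forall j, (j < n)%N -> 0 < k j) -> 0 < x <= b ->
  mu.-integrable `]0, b[ (EFin \o q) ->
  (forall j, (j < n)%N -> volterra0 q (k j) (EA j) b (A j)) ->
  (forall j, (j < n)%N -> volterra0 q (k j) (EB j) b (B j)) ->
  mu.-integrable `]0, x[ (EFin \o P) ->
  (forall t, 0 < t < x -> `|q t| * (`|wave_primitive n k A B t (z + (x - t)) -
     wave_primitive n k A B t (z - (x - t))| / 2) <= P t) ->
  `|wave n k A B x z - wave n k EA EB x z| <= \int[mu]_(t in `]0, x[) P t.
Proof.
move=> k0 x0b qi hA hB Pi HP.
have kn j : (j < n)%N -> k j != 0 by move=> /k0; exact: lt0r_neq0.
have [Ii Ie] := @Rintegral_wave `]0, x[ n (fun j => cos (k j * z))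
  (fun j => sin (k j * z)) (fun j t => A j t * dAlembert_kernel (k j) (x - t))
  (fun j t => B j t * dAlembert_kernel (k j) (x - t)) q (measurable_itv _)
  (fun j jn => volterra0_integrable (k0 j jn) x0b qi (hA j jn))
  (fun j jn => volterra0_integrable (k0 j jn) x0b qi (hB j jn)).
have -> : wave n k A B x z - wave n k EA EB x z =
    \int[mu]_(t in `]0, x[) (q t * \sum_(j < n)
      (cos (k j * z) * (A j t * dAlembert_kernel (k j) (x - t)) -
       sin (k j * z) * (B j t * dAlembert_kernel (k j) (x - t)))).
  rewrite Ie /wave -sumrB; apply: eq_bigr => j _.
  have [_ _ eA] := hA j (ltn_ord j); have [_ _ eB] := hB j (ltn_ord j).
  by rewrite eA// eB//; ring.
apply: ler_norm_Rintegral => // t; rewrite /= in_itv/= => xt.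
rewrite -wave_primitive_increment// !normrM (ger0_norm (_ : 0 <= 2^-1))//.
exact: HP.
Qed.

End WaveFamilies.

(** * Perturbation estimate for waves coming from infinity *)

Section JostStep.
Context {R : realType}.
Notation mu := (@lebesgue_measure R).

(** The function [m] majorizes both |q t| and |q t| (t - x), which is where the first moment of q
    enters. Its integrals are made small, always by the factor [th], in three ways: relative to the
    weight [w], by going beyond [X1], and by the width [ep] of a strip. *)
Record tail_data (q m w : R -> R) (K th de ep X1 : R) : Prop := TailData {
  td_m0 : forall t, 0 <= m t;
  td_mi : mu.-integrable setT (EFin \o m);
  td_qm : forall t, 0 < t -> `|q t| <= m t;
  td_qmx : forall x t, 0 <= x -> x < t -> `|q t| * (t - x) <= m t;
  td_w : forall x, 1 <= w x <= K;
  td_wm : measurable_fun setT w;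
  td_decr : forall x y, 0 <= x -> x <= y -> w y <= w x;
  td_int : forall x, 0 <= x -> \int[mu]_(t in `]x, +oo[) (m t * w t) <= th * w x;
  td_X1 : 0 <= X1;
  td_tail : \int[mu]_(t in `]X1, +oo[) m t <= th * de;
  td_ep : ep * \int[mu]_(t in `]0, +oo[) m t <= th;
  td_ep0 : 0 < ep;
  td_th0 : 0 < th;
  td_de0 : 0 < de
}.

(* Bound for a wave whose data are at most A1 below be, at most A2 de on [be, Y]
   and at most A2 beyond Y. *)
Definition tail_majorant (w : R -> R) (A1 A2 de X1 Y be x z : R) : R :=
  A1 * (x + z < be)%R%:R +
  A2 * w x * ((X1 < x)%R%:R + (Y <= z - x + 2 * X1)%R%:R + de).

Section Data.
Variables (q m w : R -> R) (K th de ep X1 : R).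
Hypothesis td : tail_data q m w K th de ep X1.

Let m0 := td_m0 td.
Let iS (D : set R) : measurable D -> mu.-integrable D (EFin \o m).
Proof. by move=> mD; exact: integrableS (td_mi td). Qed.

Let w0 x : 0 <= w x.
Proof. by have /andP[] := td_w td x => w1 _; exact: le_trans w1. Qed.

Let iSw (D : set R) : measurable D -> mu.-integrable D (EFin \o (fun t => m t * w t)).
Proof.
move=> mD; apply: (@integrableMb _ _ _ _ K) => //; last exact: iS.
- exact: measurable_funTS (td_wm td).
- by move=> x _; have /andP[] := td_w td x; rewrite ger0_norm.
Qed.

Let mstep (D : set R) : measurable_fun D (fun t : R => (X1 < t)%R%:R : R).
Proof. exact: measurable_fun_ltn. Qed.

Let iSstep (D : set R) : measurable D ->
  mu.-integrable D (EFin \o (fun t => m t * w t * (X1 < t)%R%:R)).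
Proof.
by move=> mD; apply: integrable_natmul_bool => //; exact: iSw.
Qed.

Let step_integral x : 0 <= x ->
  \int[mu]_(t in `]x, +oo[) (m t * w t * (X1 < t)%R%:R) <=
  th * (w x * ((X1 < x)%R%:R + de)).
Proof.
move=> x0; have th0 := td_th0 td; have de0 := td_de0 td; have wx := w0 x.
(* On the left of X1 only the mass of m beyond X1 counts, and [de] absorbs it; as w decreases, its
   value at x can be pulled out. *)
have [xX|Xx] := leP x X1.
  rewrite add0r (Rintegral_itvy_split xX); last exact: iSstep.
  rewrite [X in X + _](_ : _ = 0) ?add0r; last first.
    under eq_Rintegral => t.
      rewrite inE/= in_itv/= => /andP[_ tX]; rewrite ltNge tX mulr0.
      over.
    by rewrite Rintegral_cst// mul0r.
  apply: (@le_trans _ _ (\int[mu]_(t in `]X1, +oo[) (w x * m t))).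
    apply: le_Rintegral => //; first exact: iSstep.
      by apply: integrableZlR => //; exact: iS.
    move=> t; rewrite /= in_itv/= andbT => Xt; rewrite Xt mulr1 mulrC ler_wpM2r//.
    by apply: (td_decr td) => //; exact: le_trans (ltW Xt).
  rewrite RintegralZl//; last exact: iS.
  rewrite mulrCA ler_wpM2l//; exact: td_tail td.
apply: (@le_trans _ _ (\int[mu]_(t in `]x, +oo[) (m t * w t))).
  apply: le_Rintegral => //; [exact: iSstep|exact: iSw|].
  by move=> t _; rewrite ler_piMr ?mulr_ge0//; case: (X1 < t).
apply: le_trans (td_int td x0) _; rewrite (ler_wpM2l (ltW th0))// ler_peMr//.
by rewrite lerDl ltW.
Qed.

Variables (n : nat) (k : nat -> R) (A B EA EB : nat -> R -> R) (Xm A1 A2 Y be : R).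
Hypothesis k0 : forall j, (j < n)%N -> 0 < k j.
Hypothesis Xm0 : 0 <= Xm.
Hypothesis qi : mu.-integrable `]0, +oo[ (EFin \o q).
Hypothesis hA : forall j, (j < n)%N -> volterra_tail q (k j) (EA j) Xm (A j).
Hypothesis hB : forall j, (j < n)%N -> volterra_tail q (k j) (EB j) Xm (B j).
Hypothesis A10 : 0 <= A1.
Hypothesis A20 : 0 < A2.
Hypothesis th1 : 2 * th < 1.

Let Om := tail_majorant w A1 A2 de X1 Y be.
Let D x z := Xm < x /\ be - 2 * ep <= x + z.

(** For t > x and z' within t - x of z one has t + z' >= x + z and z' - t <= z - x. The first
    inequality keeps (t, z') in [D]; by the second the indicator of Y, a function of z' - t, is at
    most its value at (x, z). The strip t + z' < be meets the segment in a length of at most be - x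
    - z <= 2 ep, so its share carries ep in place of t - x. *)
Lemma jost_kernel_bound C x z t : 0 <= C ->
  (forall x z, D x z -> `|wave n k A B x z| <= C * Om x z) -> D x z -> x < t ->
  `|q t| * (`|wave_primitive n k A B t (z + (t - x)) -
     wave_primitive n k A B t (z - (t - x))| / 2) <=
  C * (A1 * ep * (x + z < be)%R%:R) * m t +
  C * (A2 * (m t * w t * (X1 < t)%R%:R) +
       A2 * ((Y <= z - x + 2 * X1)%R%:R + de) * (m t * w t)).
Proof.
move=> C0 VC [Xmx axz] xt; have ep0 := td_ep0 td; have de0 := td_de0 td.
have x0 : 0 <= x by rewrite ltW// (le_lt_trans Xm0).
have wt := w0 t; have mt := m0 t.
pose io : R := (Y <= z - x + 2 * X1)%R%:R.
have io0 : 0 <= io by rewrite /io ler0n.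
pose st : R := (X1 < t)%R%:R.
have st0 : 0 <= st by rewrite /st ler0n.
pose Pc := C * (A2 * w t * (st + io + de)).
have Pc0 : 0 <= Pc.
  by rewrite /Pc !mulr_ge0// ?(ltW A20)// !addr_ge0// ltW.
have zz : z - (t - x) <= z + (t - x) by move: xt; lra.
have CA0 : 0 <= C * A1 by rewrite mulr_ge0.
have kn j : (j < n)%N -> k j != 0 by move=> /k0; exact: lt0r_neq0.
(* The right kink is placed at the right end of the segment, where it contributes nothing. *)
have := @lipschitz_kinks _ _ _ Pc (C * A1) (be - t) (z + (t - x)) _ _ zz CA0
  (fun z => is_derive_wave_primitive A B t z kn).
rewrite subrr maxxx mulr0 addr0.
rewrite (_ : be - t - (z - (t - x)) = be - x - z); last by ring.
rewrite (_ : z + (t - x) - (z - (t - x)) = 2 * (t - x)); last by ring.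
move=> /(_ _)kk; have {kk} bnd : `|wave_primitive n k A B t (z + (t - x)) -
     wave_primitive n k A B t (z - (t - x))| <=
     Pc * (2 * (t - x)) + C * A1 * Num.max (be - x - z) 0.
  apply: kk => z' /andP[az zb].
  have Dt : D t z' by split; [exact: lt_trans xt|move: axz az; lra].
  apply: (le_trans (VC _ _ Dt)).
  rewrite [z + (t - x) < z']ltNge (ltW zb) mulr0 addr0 /Om /tail_majorant mulrDr addrC.
  rewrite -ltrBrDl [C * (A1 * _)]mulrA lerD2r /Pc -/st; apply: ler_wpM2l => //.
  apply: ler_wpM2l; first by rewrite mulr_ge0// ltW.
  rewrite lerD2r lerD2l /io ler_nat.
  case: (leP Y (z' - t + 2 * X1)) => // Yz.
  by rewrite (_ : Y <= _)//; move: Yz zb; lra.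
have s1 : Num.max (be - x - z) 0 <= 2 * (ep * (x + z < be)%R%:R).
  case: (ltP (x + z) be) => xzb.
    rewrite ge_max mulr1; apply/andP; split; last by rewrite mulr_ge0// ltW.
    by move: axz; lra.
  by rewrite !mulr0 ge_max lexx andbT; move: xzb; lra.
have q1 : `|q t| <= m t by apply: (td_qm td); exact: le_lt_trans xt.
have q2 : `|q t| * (t - x) <= m t by exact: (td_qmx td x0 xt).
set g := `|_ - _| in bnd *.
have h1 : g / 2 <= Pc * (t - x) + C * A1 * (ep * (x + z < be)%R%:R).
  have := ler_wpM2l CA0 s1; move: bnd; lra.
apply: (le_trans (ler_wpM2l (normr_ge0 (q t)) h1)).
rewrite mulrDr addrC; apply: lerD.
  rewrite mulrC -[leLHS]mulrA [leRHS](_ : _ = C * A1 * (ep * (x + z < be)%R%:R * m t)); last by ring.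
  by apply: ler_wpM2l => //; apply: ler_wpM2l => //; rewrite mulr_ge0 ?ler0n// ltW.
rewrite [leLHS](_ : _ = Pc * (`|q t| * (t - x))); last by ring.
apply: (le_trans (ler_wpM2l Pc0 q2)).
by rewrite le_eqVlt; apply/orP; left; apply/eqP; rewrite /Pc /st /io; ring.
Qed.

(** Integration against the kernel reproduces each part of the majorant with factor th, except that
    de comes out twice: once from the integral of the step at X1 and once from itself. Hence the
    contraction factor 2 th. *)
Lemma jost_step :
  (forall x z, D x z -> `|wave n k EA EB x z| <= Om x z) ->
  forall x z, D x z -> `|wave n k A B x z| <= (1 - 2 * th)^-1 * Om x z /\
    `|wave n k A B x z - wave n k EA EB x z| <= 2 * th * (1 - 2 * th)^-1 * Om x z.
Proof.
move=> v0Om; have th0 := td_th0 td; have de0 := td_de0 td; have ep0 := td_ep0 td.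
have Om_ge x z : A2 * de <= Om x z.
  have /andP[w1 _] := td_w td x.
  rewrite /Om /tail_majorant -[leLHS]add0r; apply: lerD; first by rewrite mulr_ge0.
  rewrite -mulrA; apply: ler_wpM2l; first exact: ltW.
  rewrite -[leLHS]mul1r; apply: ler_pM => //; first exact: ltW.
  by rewrite lerDr addr_ge0.
have Om0 x z : 0 <= Om x z by apply: le_trans (Om_ge x z); rewrite mulr_ge0 ?ltW.
apply: contraction_bound => //.
- by rewrite mulr_gt0.
- have [|j jn|M M0 MP] := @wave_bounded _ (fun x => Xm < x) n k A B.
  + by move=> j jn; have [_ ? _] := hA jn.
  + by have [_ ? _] := hB jn.
  have Ad0 : 0 < A2 * de by rewrite mulr_gt0.
  (* An a priori constant exists because the majorant never falls below A2 * de. *)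
  exists (M / (A2 * de)); first by rewrite divr_ge0// ltW.
  move=> x z [Xmx _]; apply: (le_trans (MP x z Xmx)).
  rewrite -mulrA ler_peMr// ler_pdivlMl// mulr1; exact: Om_ge.
move=> C C0 VC x z Dxz; have [Xmx axz] := Dxz.
have x0 : 0 <= x by rewrite ltW// (le_lt_trans Xm0).
pose io : R := (Y <= z - x + 2 * X1)%R%:R.
have io0 : 0 <= io by rewrite /io ler0n.
pose be1 : R := (x + z < be)%R%:R.
pose c1 := C * (A1 * ep * be1).
have i1 := integrableZlR c1 (measurable_itv _) (iS (measurable_itv `]x, +oo[)).
have i2 := integrableZlR A2 (measurable_itv _) (iSstep (measurable_itv `]x, +oo[)).
have i3 := integrableZlR (A2 * (io + de)) (measurable_itv _) (iSw (measurable_itv `]x, +oo[)).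
have i23 : mu.-integrable `]x, +oo[ (EFin \o (fun t => A2 * (m t * w t * (X1 < t)%R%:R) +
       A2 * (io + de) * (m t * w t))).
  by have := @integrableD _ _ R mu _ (measurable_itv _) _ _ i2 i3.
have i4 := integrableZlR C (measurable_itv _) i23.
have i5 : mu.-integrable `]x, +oo[ (EFin \o (fun t => c1 * m t +
   C * (A2 * (m t * w t * (X1 < t)%R%:R) + A2 * (io + de) * (m t * w t)))).
  by have := @integrableD _ _ R mu _ (measurable_itv _) _ _ i1 i4.
apply: (le_trans (wave_tail_bound k0 Xm0 Xmx qi hA hB i5 _)).
  by move=> t xt; exact: jost_kernel_bound.
rewrite RintegralD// RintegralZl//; last exact: iS.
rewrite RintegralZl// RintegralD// RintegralZl//; last exact: iSstep.
rewrite RintegralZl//; last exact: iSw.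
have I1 : \int[mu]_(t in `]x, +oo[) m t <= \int[mu]_(t in `]0, +oo[) m t.
  apply: le_Rintegral_subset => //; last exact: iS.
  by apply: subset_itvr; rewrite bnd_simp.
have I2 := step_integral x0.
have I3 := td_int td x0.
have I4 : ep * \int[mu]_(t in `]x, +oo[) m t <= th.
  by apply: le_trans (td_ep td); rewrite ler_wpM2l// ltW.
have wx := w0 x.
have be0 : 0 <= be1 by rewrite /be1 ler0n.
have iode : 0 <= io + de by rewrite addr_ge0// ltW.
rewrite /Om /tail_majorant -/io -/be1.
have J1 : c1 * \int[mu]_(t in `]x, +oo[) m t <= C * (A1 * be1) * th.
  rewrite [leLHS](_ : _ = C * (A1 * be1) * (ep * \int[mu]_(t in `]x, +oo[) m t)).
    by rewrite ler_wpM2l// !mulr_ge0.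
  by rewrite /c1; ring.
have J2 := ler_wpM2l C0 (lerD (ler_wpM2l (ltW A20) I2)
  (ler_wpM2l (mulr_ge0 (ltW A20) iode) I3)).
apply: (le_trans (lerD J1 J2)).
set st : R := (X1 < x)%R%:R.
have st0 : 0 <= st by rewrite /st ler0n.
have CA0 : 0 <= C * th * (A1 * be1) by rewrite !mulr_ge0// ltW.
have CS0 : 0 <= C * th * (A2 * w x) * st by rewrite !mulr_ge0// ltW.
have CI0 : 0 <= C * th * (A2 * w x) * io by rewrite !mulr_ge0// ltW.
rewrite -subr_ge0 (_ : _ - _ = C * th * (A1 * be1) + C * th * (A2 * w x) * st +
  C * th * (A2 * w x) * io); first by rewrite !addr_ge0.
by ring.
Qed.

End Data.
End JostStep.

(** * Perturbation estimate for waves issued from 0 *)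

Section CauchyStep.
Context {R : realType}.
Notation mu := (@lebesgue_measure R).

(** Counterpart of [tail_data] for integrals over ]0, x[. On a bounded interval x - t is bounded, so
    a multiple of |q| serves as [m]. *)
Record cauchy_data (q m w : R -> R) (K th ep b : R) : Prop := CauchyData {
  cd_m0 : forall t, 0 <= m t;
  cd_mi : mu.-integrable setT (EFin \o m);
  cd_qm : forall t, 0 < t < b -> `|q t| <= m t;
  cd_qmx : forall x t, 0 < t < x -> x <= b -> `|q t| * (x - t) <= m t;
  cd_w : forall x, 1 <= w x <= K;
  cd_wm : measurable_fun setT w;
  cd_int : forall x, 0 <= x <= b -> \int[mu]_(t in `]0, x[) (m t * w t) <= th * w x;
  cd_ep : ep * \int[mu]_(t in `]0, b[) m t <= th;
  cd_ep0 : 0 < ep;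
  cd_th0 : 0 < th
}.

(* Bound for a wave whose data are at most A2 on [- be, be] and at most A1
   elsewhere. *)
Definition cauchy_majorant (w : R -> R) (A1 A2 be x z : R) : R :=
  A1 * ((be < x + z)%R%:R + (be < x - z)%R%:R) + A2 * w x.

Section Data.
Variables (q m w : R -> R) (K th ep b : R).
Hypothesis cd : cauchy_data q m w K th ep b.

Let m0 := cd_m0 cd.
Let iS (D : set R) : measurable D -> mu.-integrable D (EFin \o m).
Proof. by move=> mD; exact: integrableS (cd_mi cd). Qed.

Let w0 x : 0 <= w x.
Proof. by have /andP[] := cd_w cd x => w1 _; exact: le_trans w1. Qed.

Let iSw (D : set R) : measurable D -> mu.-integrable D (EFin \o (fun t => m t * w t)).
Proof.
move=> mD; apply: (@integrableMb _ _ _ _ K) => //; last exact: iS.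
- exact: measurable_funTS (cd_wm cd).
- by move=> x _; have /andP[] := cd_w cd x; rewrite ger0_norm.
Qed.

Variables (n : nat) (k : nat -> R) (A B EA EB : nat -> R -> R) (A1 A2 be : R).
Hypothesis k0 : forall j, (j < n)%N -> 0 < k j.
Hypothesis qi : mu.-integrable `]0, b[ (EFin \o q).
Hypothesis hA : forall j, (j < n)%N -> volterra0 q (k j) (EA j) b (A j).
Hypothesis hB : forall j, (j < n)%N -> volterra0 q (k j) (EB j) b (B j).
Hypothesis A10 : 0 <= A1.
Hypothesis A20 : 0 < A2.
Hypothesis th1 : 2 * th < 1.

Let Om := cauchy_majorant w A1 A2 be.
Let D x z := [/\ 0 < x <= b, x + z <= be + 2 * ep & x - z <= be + 2 * ep].

(** For t < x and z' within x - t of z one has t + z' <= x + z and t - z' <= x - z, so (t, z') stays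
    in [D]. The large data occupy the two ends of the segment, each in a length of at most 2 ep. *)
Lemma cauchy_kernel_bound C x z t : 0 <= C ->
  (forall x z, D x z -> `|wave n k A B x z| <= C * Om x z) -> D x z -> 0 < t < x ->
  `|q t| * (`|wave_primitive n k A B t (z + (x - t)) -
     wave_primitive n k A B t (z - (x - t))| / 2) <=
  C * (A1 * ep * ((be < x + z)%R%:R + (be < x - z)%R%:R)) * m t +
  C * A2 * (m t * w t).
Proof.
move=> C0 VC [/andP[x0 xb] d1 d2] /andP[t0 tx]; have ep0 := cd_ep0 cd.
have wt := w0 t; have mt := m0 t.
pose Pc := C * (A2 * w t).
have Pc0 : 0 <= Pc by rewrite /Pc !mulr_ge0// ltW.
have zz : z - (x - t) <= z + (x - t) by lra.
have CA0 : 0 <= C * A1 by rewrite mulr_ge0.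
have kn j : (j < n)%N -> k j != 0 by move=> /k0; exact: lt0r_neq0.
have := @lipschitz_kinks _ _ _ Pc (C * A1) (t - be) (be - t) _ _ zz CA0
  (fun z => is_derive_wave_primitive A B t z kn).
rewrite (_ : t - be - (z - (x - t)) = x - z - be); last by ring.
rewrite (_ : z + (x - t) - (be - t) = x + z - be); last by ring.
rewrite (_ : z + (x - t) - (z - (x - t)) = 2 * (x - t)); last by ring.
move=> /(_ _)kk; have {kk} bnd : `|wave_primitive n k A B t (z + (x - t)) -
     wave_primitive n k A B t (z - (x - t))| <=
     Pc * (2 * (x - t)) + C * A1 * Num.max (x - z - be) 0 +
     C * A1 * Num.max (x + z - be) 0.
  apply: kk => z' /andP[az zb].
  have Dt : D t z'.
    by split; [rewrite t0 (le_trans (ltW tx))|lra|lra].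
  apply: (le_trans (VC _ _ Dt)).
  rewrite le_eqVlt; apply/orP; left; apply/eqP.
  rewrite /Om /cauchy_majorant /Pc ltrBlDl [t - z' > be]ltrBrDr -ltrBrDl.
  by ring.
have sgen (s : R) : s <= be + 2 * ep -> Num.max (s - be) 0 <= 2 * (ep * (be < s)%R%:R).
  move=> sb; case: (ltP be s) => bs.
    rewrite ge_max mulr1; apply/andP; split; last by rewrite mulr_ge0// ltW.
    by lra.
  by rewrite !mulr0 ge_max lexx andbT; lra.
have s1 := sgen _ d1; have s2 := sgen _ d2.
have q1 : `|q t| <= m t by apply: (cd_qm cd); rewrite t0 (lt_le_trans tx).
have q2 : `|q t| * (x - t) <= m t by apply: (cd_qmx cd); rewrite ?t0.
set g := `|_ - _| in bnd *.
have h1 : g / 2 <= Pc * (x - t) + C * A1 * (ep * ((be < x + z)%R%:R + (be < x - z)%R%:R)).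
  have := ler_wpM2l CA0 s1; have := ler_wpM2l CA0 s2; move: bnd; lra.
apply: (le_trans (ler_wpM2l (normr_ge0 (q t)) h1)).
rewrite mulrDr addrC; apply: lerD.
  rewrite mulrC -[leLHS]mulrA [leRHS](_ : _ = C * A1 * (ep * ((be < x + z)%R%:R + (be < x - z)%R%:R) * m t)); last by ring.
  apply: ler_wpM2l => //; apply: ler_wpM2l => //.
  by rewrite mulr_ge0 ?addr_ge0 ?ler0n// ltW.
rewrite [leLHS](_ : _ = Pc * (`|q t| * (x - t))); last by ring.
apply: (le_trans (ler_wpM2l Pc0 q2)).
by rewrite le_eqVlt; apply/orP; left; apply/eqP; rewrite /Pc; ring.
Qed.

Lemma cauchy_step :
  (forall x z, D x z -> `|wave n k EA EB x z| <= Om x z) ->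
  forall x z, D x z -> `|wave n k A B x z| <= (1 - 2 * th)^-1 * Om x z /\
    `|wave n k A B x z - wave n k EA EB x z| <= 2 * th * (1 - 2 * th)^-1 * Om x z.
Proof.
move=> v0Om; have th0 := cd_th0 cd; have ep0 := cd_ep0 cd.
have ind0 x z : 0 <= A1 * ((be < x + z)%R%:R + (be < x - z)%R%:R).
  by rewrite mulr_ge0// addr_ge0 ?ler0n.
have Om_ge x z : A2 <= Om x z.
  have /andP[w1 _] := cd_w cd x.
  rewrite /Om /cauchy_majorant -[leLHS]add0r; apply: lerD; first exact: ind0.
  by rewrite ler_peMr// ltW.
have Om0 x z : 0 <= Om x z by apply: le_trans (Om_ge x z); rewrite ltW.
apply: contraction_bound => //.
- by rewrite mulr_gt0.
- have [|j jn|M M0 MP] := @wave_bounded _ (fun x => 0 < x <= b) n k A B.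
  + by move=> j jn; have [_ ? _] := hA jn.
  + by have [_ ? _] := hB jn.
  exists (M / A2); first by rewrite divr_ge0// ltW.
  move=> x z [xb _ _]; apply: (le_trans (MP x z xb)).
  rewrite -mulrA ler_peMr// ler_pdivlMl// mulr1; exact: Om_ge.
move=> C C0 VC x z Dxz; have [/andP[x0 xb] d1 d2] := Dxz.
pose ind : R := (be < x + z)%R%:R + (be < x - z)%R%:R.
have indp : 0 <= ind by rewrite /ind addr_ge0 ?ler0n.
pose c1 := C * (A1 * ep * ind).
have i1 := integrableZlR c1 (measurable_itv _) (iS (measurable_itv `]0, x[)).
have i2 := integrableZlR (C * A2) (measurable_itv _) (iSw (measurable_itv `]0, x[)).
have i5 : mu.-integrable `]0, x[ (EFin \o (fun t => c1 * m t + C * A2 * (m t * w t))).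
  by have := @integrableD _ _ R mu _ (measurable_itv _) _ _ i1 i2.
have x0b : 0 < x <= b by rewrite x0.
apply: (le_trans (wave0_bound k0 x0b qi hA hB i5 _)).
  by move=> t xt; exact: cauchy_kernel_bound.
rewrite RintegralD// RintegralZl//; last exact: iS.
rewrite RintegralZl//; last exact: iSw.
have I1 : \int[mu]_(t in `]0, x[) m t <= \int[mu]_(t in `]0, b[) m t.
  apply: le_Rintegral_subset => //; last exact: iS.
  by apply: subset_itvl; rewrite bnd_simp.
have I3 : \int[mu]_(t in `]0, x[) (m t * w t) <= th * w x.
  by apply: (cd_int cd); rewrite ltW.
have I4 : ep * \int[mu]_(t in `]0, x[) m t <= th.
  by apply: le_trans (cd_ep cd); rewrite ler_wpM2l// ltW.
have wx := w0 x.
rewrite /Om /cauchy_majorant -/ind.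
have J1 : c1 * \int[mu]_(t in `]0, x[) m t <= C * (A1 * ind) * th.
  rewrite [leLHS](_ : _ = C * (A1 * ind) * (ep * \int[mu]_(t in `]0, x[) m t)).
    by rewrite ler_wpM2l// !mulr_ge0.
  by rewrite /c1; ring.
have J2 := ler_wpM2l (mulr_ge0 C0 (ltW A20)) I3.
apply: (le_trans (lerD J1 J2)).
have CA0 : 0 <= C * th * (A1 * ind) by rewrite !mulr_ge0// ltW.
have CS0 : 0 <= C * th * (A2 * w x) by rewrite !mulr_ge0// ltW.
rewrite -subr_ge0 (_ : _ - _ = C * th * (A1 * ind) + C * th * (A2 * w x)).
  by rewrite addr_ge0.
by ring.
Qed.

End Data.
End CauchyStep.

(** * Trigonometric approximation *)

Section TrigonometricApproximation.
Context {R : realType}.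

Lemma uniform_continuity (h : R -> R) (a b e : R) : a <= b -> 0 < e ->
  (forall c, a <= c <= b -> {for c, continuous h}) ->
  exists2 d, 0 < d & forall s t, a <= s <= b -> a <= t <= b -> `|s - t| < d ->
    `|h s - h t| < e.
Proof.
move=> ab e0 ch.
suff [d d0 dP] : exists2 d, 0 < d & forall s t, a <= s <= b -> a <= t <= b ->
    s <= t -> t - s < d -> `|h s - h t| < e.
  exists d => // s t sab tab; case: (leP s t) => st std.
    by apply: dP => //; apply: le_lt_trans std; rewrite distrC ler_norm.
  rewrite distrC; apply: dP => //; first exact: ltW.
  by apply: le_lt_trans std; rewrite ler_norm.
apply: (@continuous_induction _ (fun y => exists2 d, 0 < d & forall s t,
   a <= s <= y -> a <= t <= y -> s <= t -> t - s < d -> `|h s - h t| < e) a b) => //.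
  exists 1 => // s t; rewrite -!eq_le => /eqP <- /eqP <- _ _.
  by rewrite subrr normr0.
move=> c cab; have e2 : 0 < e / 2 by rewrite divr_gt0.
have [r /= r0 rP] := (@cvgrPdist_lt _ _ _ _ _ _ _).1 (ch c cab) _ e2.
exists (r / 2); first by rewrite divr_gt0.
move=> x y /andP[ax xc] /andP[cy yb] xr yr [d d0 dP].
exists (Num.min d (r / 2)); first by rewrite lt_min d0 divr_gt0.
move=> s t /andP[as_ sy] /andP[at_ ty] st; rewrite lt_min => /andP[td tr].
have [tx|xt] := leP t x.
  by apply: dP; rewrite // ?as_ ?at_ ?(le_trans st).
have near u : c - r < u -> u < c + r -> `|h c - h u| < e / 2.
  by move=> u1 u2; apply: rP; rewrite /ball/= ltr_norml; apply/andP; split; lra.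
have h1 : `|h c - h s| < e / 2 by apply: near; clear - tr xt xr ty yr st r0; lra.
have h2 : `|h c - h t| < e / 2 by apply: near; clear - tr xt xr ty yr st r0; lra.
have := ler_distD (h c) (h s) (h t); rewrite [`|h s - h c|]distrC.
by clear -h1 h2; lra.
Qed.

(* The Bernstein operator: the expectation of f(S_n), where S_n is binomial. *)
Fixpoint binomial_mean (n : nat) (f : nat -> R) (u : R) : R :=
  if n is n'.+1 then
    (1 - u) * binomial_mean n' f u + u * binomial_mean n' (fun i => f i.+1) u
  else f 0%N.

Lemma eq_binomial_mean n f g u : (forall i, (i <= n)%N -> f i = g i) ->
  binomial_mean n f u = binomial_mean n g u.
Proof.
elim: n f g => [|n IH] f g fg /=; first exact: fg.
rewrite (IH f g) => [|i ni]; last by apply: fg; exact: leqW.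
by rewrite (IH (fun i => f i.+1) (fun i => g i.+1)) // => i ni; exact: fg.
Qed.

Lemma binomial_mean_linear n a f b g u :
  binomial_mean n (fun i => a * f i + b * g i) u =
  a * binomial_mean n f u + b * binomial_mean n g u.
Proof. by elim: n f g => [|n IH] f g //=; rewrite !IH; ring. Qed.

Lemma binomial_mean_cst n c u : binomial_mean n (fun=> c) u = c.
Proof. by elim: n => //= n ->; ring. Qed.

Lemma le_binomial_mean n f g u : 0 <= u <= 1 ->
  (forall i, (i <= n)%N -> f i <= g i) -> binomial_mean n f u <= binomial_mean n g u.
Proof.
move=> /andP[u0 u1]; elim: n f g => [|n IH] f g fg /=; first exact: fg.
apply: lerD; apply: ler_wpM2l; rewrite ?subr_ge0//; apply: IH => i ni; apply: fg => //.
exact: leqW.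
Qed.

(** Variance plus squared bias of the binomial law. Every centre x is allowed because conditioning
    on a first success shifts the centre by one in the induction. *)
Lemma binomial_mean_sqr n x u :
  binomial_mean n (fun i => (i%:R - x) ^+ 2) u =
  n%:R * u * (1 - u) + (n%:R * u - x) ^+ 2.
Proof.
elim: n x => [|n IH] x /=; first by ring.
rewrite IH (eq_binomial_mean (g := fun i => (i%:R - (x - 1)) ^+ 2)); last first.
  by move=> i _; rewrite -natr1; congr (_ ^+ 2); ring.
by rewrite IH -natr1; ring.
Qed.

(** Chebyshev's argument: if i / n is within d of u, uniform continuity gives e / 2; otherwise 2 M
    is at most 2 M / d^2 times the squared deviation, whose mean is u (1 - u) / n. *)
Lemma bernstein (h : R -> R) (M e : R) : 0 < e ->
  (forall c, 0 <= c <= 1 -> {for c, continuous h}) ->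
  (forall u, 0 <= u <= 1 -> `|h u| <= M) ->
  exists n, forall u, 0 <= u <= 1 ->
    `|binomial_mean n (fun i => h (i%:R / n%:R)) u - h u| <= e.
Proof.
move=> e0 ch hM; have e2 : 0 < e / 2 by rewrite divr_gt0.
have [d d0 dP] := uniform_continuity (@ler01 R) e2 ch.
have M0 : 0 <= M by apply: le_trans (hM 0 _); rewrite ?lexx ?ler01.
pose n := (Num.bound (4 * M / (d ^+ 2 * e))).+1.
have n0 : 0 < n%:R :> R by rewrite ltr0n.
have nn0 : n%:R != 0 :> R by rewrite gt_eqF.
exists n => u u01; have /andP[u0 u1] := u01.
have d20 : 0 < d ^+ 2 by rewrite exprn_gt0.
have nM : 2 * M / d ^+ 2 / n%:R <= e / 2.
  have := archi_boundP (divr_ge0 (mulr_ge0 (ler0n _ 4) M0) (ltW (mulr_gt0 d20 e0))).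
  move=> /lt_le_trans/(_ (_ : _ <= n%:R)) => /(_ _)nn.
  have {}nn : 4 * M / (d ^+ 2 * e) < n%:R by apply: nn; rewrite ler_nat.
  rewrite ler_pdivrMr// ler_pdivrMr//.
  by move: nn; rewrite ltr_pdivrMr ?mulr_gt0//; nra.
have point i : (i <= n)%N ->
    `|h (i%:R / n%:R) - h u| <= e / 2 * 1 + 2 * M / d ^+ 2 / n%:R ^+ 2 * (i%:R - n%:R * u) ^+ 2.
  move=> ni.
  have i01 : 0 <= (i%:R / n%:R : R) <= 1.
    by rewrite divr_ge0//= ler_pdivrMr// mul1r ler_nat.
  have c0 : 0 <= 2 * M / d ^+ 2 / n%:R ^+ 2.
    by rewrite !divr_ge0 ?mulr_ge0// ?exprn_ge0// ltW.
  have [close|far] := ltP `|i%:R / n%:R - u| d.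
    apply: (@le_trans _ _ (e / 2)); first by apply: ltW; exact: dP.
    by rewrite mulr1 lerDl mulr_ge0// sqr_ge0.
  have hh : `|h (i%:R / n%:R) - h u| <= 2 * M.
    apply: (le_trans (ler_normB _ _)).
    rewrite (_ : 2 * M = M + M); last by ring.
    by rewrite lerD// hM.
  apply: (le_trans hh); rewrite -[leLHS]add0r mulr1; apply: lerD; first exact: ltW.
  have -> : i%:R - n%:R * u = n%:R * (i%:R / n%:R - u) by field.
  rewrite exprMn mulrA -[_ / n%:R ^+ 2 * _]mulrA mulVf ?mulr1 ?expf_neq0//.
  rewrite -mulrA ler_peMr ?mulr_ge0// ler_pdivlMl// mulr1.
  by rewrite -(real_normK (num_real (_ - u))) ler_sqr ?nnegrE// ltW.
set Mn := binomial_mean _ _ _.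
have cE c : binomial_mean n (fun i => c * (h (i%:R / n%:R) - h u)) u = c * (Mn - h u).
  rewrite (eq_binomial_mean (g := fun i => c * h (i%:R / n%:R) + (- c) * h u)); last first.
    by move=> i _; ring.
  by rewrite binomial_mean_linear binomial_mean_cst /Mn; ring.
have up c : c = 1 \/ c = -1 -> c * (Mn - h u) <= e.
  move=> c1; rewrite -cE.
  apply: le_trans (le_binomial_mean (g := fun i => e / 2 * 1 + 2 * M / d ^+ 2 / n%:R ^+ 2 * (i%:R - n%:R * u) ^+ 2) u01 _) _.
    move=> i ni; apply: le_trans (point i ni).
    by case: c1 => ->; rewrite ?mul1r ?mulN1r ?ler_norm// -normrN ler_norm.
  rewrite binomial_mean_linear binomial_mean_cst binomial_mean_sqr subrr expr0n addr0 mulr1.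
  have uu : u * (1 - u) <= 1 by nra.
  have -> : 2 * M / d ^+ 2 / n%:R ^+ 2 * (n%:R * u * (1 - u)) =
     2 * M / d ^+ 2 / n%:R * (u * (1 - u)).
    by field; rewrite nn0 gt_eqF.
  have uu0 : 0 <= u * (1 - u) by rewrite mulr_ge0// subr_ge0.
  have : 2 * M / d ^+ 2 / n%:R * (u * (1 - u)) <= e / 2 * 1.
    apply: ler_pM => //.
    by rewrite !divr_ge0 ?mulr_ge0// ?ltW.
  by clear; lra.
rewrite ler_norml; apply/andP; split.
  have := up (-1) (or_intror erefl); clear; lra.
by have := up 1 (or_introl erefl); rewrite mul1r.
Qed.

Definition odd_freq (k0 : R) (j : nat) : R := j.*2.+1%:R * k0.

Definition odd_cos_sum (n : nat) (c : nat -> R) (t : R) : R :=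
  \sum_(j < n) c j * cos (j.*2.+1%:R * t).

Lemma odd_cos_sum_widen n m c t : (forall j, (n <= j)%N -> c j = 0) -> (n <= m)%N ->
  odd_cos_sum m c t = odd_cos_sum n c t.
Proof.
move=> c0 nm; rewrite /odd_cos_sum.
rewrite -!(big_mkord xpredT (fun j => c j * cos (j.*2.+1%:R * t))).
rewrite (@big_cat_nat _ _ _ n 0 m)//= [X in _ + X]big1_seq ?addr0// => j.
by rewrite mem_index_iota => /andP[_ /andP[nj _]]; rewrite c0// mul0r.
Qed.

(** The coefficients vanish from n on, so that two sums can be widened to a common length before
    being added. *)
Definition odd_trig (F : R -> R) : Prop :=
  exists n c, (forall j, (n <= j)%N -> c j = 0) /\ forall t, F t = odd_cos_sum n c t.

Lemma odd_trig_linear a b F G : odd_trig F -> odd_trig G ->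
  odd_trig (fun t => a * F t + b * G t).
Proof.
move=> [n [c [c0 cE]]] [m [d [d0 dE]]].
exists (maxn n m), (fun j => a * c j + b * d j); split.
  by move=> j; rewrite geq_max => /andP[nj mj]; rewrite c0// d0// !mulr0 addr0.
move=> t; rewrite cE dE -(odd_cos_sum_widen t c0 (leq_maxl n m)).
rewrite -(odd_cos_sum_widen t d0 (leq_maxr n m)) /odd_cos_sum !mulr_sumr -big_split/=.
by apply: eq_bigr => j _; ring.
Qed.

Lemma odd_trig_cos1 i : odd_trig (fun t => cos (i.*2.+1%:R * t)).
Proof.
exists i.+1, (fun j => (j == i)%:R); split.
  by move=> j ij; rewrite gtn_eqF.
move=> t; rewrite /odd_cos_sum (bigD1 ord_max)//= eqxx mul1r big1 ?addr0// => j.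
by rewrite -val_eqE/= => /negPf ->; rewrite mul0r.
Qed.

Lemma odd_trig_sum n (c : nat -> R) (F : nat -> R -> R) : (forall j, odd_trig (F j)) ->
  odd_trig (fun t => \sum_(j < n) c j * F j t).
Proof.
move=> hF; elim: n => [|n IH].
  exists 0%N, (fun=> 0); split => // t; by rewrite /odd_cos_sum !big_ord0.
have [m [d [d0 dE]]] := odd_trig_linear 1 (c n) IH (hF n).
by exists m, d; split => // t; rewrite -dE big_ord_recr/= mul1r.
Qed.

Lemma odd_trig_mul_cos2 F : odd_trig F -> odd_trig (fun t => cos t ^+ 2 * F t).
Proof.
move=> [n [c [c0 cE]]].
have base i : odd_trig (fun t => cos t ^+ 2 * cos (i.*2.+1%:R * t)).
  have prod (x t : R) : cos t ^+ 2 * cos x =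
      2^-1 * cos x + 4^-1 * (cos (x + t *+ 2) + cos (x - t *+ 2)).
    by rewrite cosD cosB [cos (t *+ 2)]cos_mulr2n; field.
  (* For the lowest frequency cos (t - 2 t) folds back onto cos t, so two cosines appear instead of
     three. *)
  case: i => [|i].
    have [m [d [d0 dE]]] := odd_trig_linear (2^-1 + 4^-1) (4^-1) (odd_trig_cos1 0) (odd_trig_cos1 1).
    exists m, d; split => // t; rewrite -dE prod !mul1r.
    have -> : t - t *+ 2 = - t by rewrite mulr2n; ring.
    have -> : t + t *+ 2 = 3 * t by rewrite mulr2n; ring.
    by rewrite cosN; ring.
  have h := odd_trig_linear 1 (4^-1) (odd_trig_linear (2^-1) (4^-1) (odd_trig_cos1 i.+1) (odd_trig_cos1 i.+2)) (odd_trig_cos1 i).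
  have [m [d [d0 dE]]] := h.
  exists m, d; split => // t; rewrite -dE prod.
  have -> : i.+1.*2.+1%:R * t + t *+ 2 = i.+2.*2.+1%:R * t.
    by rewrite !doubleS -!natr1 mulr2n; ring.
  have -> : i.+1.*2.+1%:R * t - t *+ 2 = i.*2.+1%:R * t.
    by rewrite !doubleS -!natr1 mulr2n; ring.
  by ring.
have [m [d [d0 dE]]] := odd_trig_sum n c base.
exists m, d; split => // t; rewrite -dE cE /odd_cos_sum mulr_sumr.
by apply: eq_bigr => j _; ring.
Qed.

Lemma odd_trig_binomial_mean n f :
  odd_trig (fun t => cos t * binomial_mean n f (cos t ^+ 2)).
Proof.
elim: n f => [|n IH] f /=.
  have [m [d [d0 dE]]] := odd_trig_linear (f 0%N) 0 (odd_trig_cos1 0) (odd_trig_cos1 0).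
  by exists m, d; split => // t; rewrite -dE mul1r; ring.
have h1 := odd_trig_linear 1 (-1) (IH f) (odd_trig_mul_cos2 (IH f)).
have [m [d [d0 dE]]] := odd_trig_linear 1 1 h1 (odd_trig_mul_cos2 (IH (fun i => f i.+1))).
by exists m, d; split => // t; rewrite -dE; ring.
Qed.

(** * Approximation by cosines of odd multiples of [k0] *)

Section CosineSubstitution.
Variables (g : R -> R) (s0 s1 k0 M : R).
Hypothesis gc : continuous g.
Hypothesis s00 : 0 < s0.
Hypothesis s01 : s0 < s1.
Hypothesis k00 : 0 < k0.
Hypothesis k0s1 : k0 * s1 < pi / 2.
Hypothesis g0 : forall s, s <= s0 \/ s1 <= s -> g s = 0.
Hypothesis gM : forall s, `|g s| <= M.

(* Chosen so that c * profile (c ^ 2) = g (acos c / k0). *)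
Let profile (u : R) : R :=
  if 0 < u < 1 then g (acos (Num.sqrt u) / k0) / Num.sqrt u else 0.

Let quarter (t : R) : 0 <= t -> t <= pi / 2 -> t \in `[0, pi].
Proof.
by move=> h1 h2; rewrite in_itv/= h1 (le_trans h2)// ler_pdivrMr// ler_peMr ?pi_ge0// ler1n.
Qed.

Let s10 : 0 < s1. Proof. exact: lt_trans s01. Qed.

Let sqrt01 (u : R) : 0 < u < 1 -> 0 < Num.sqrt u < 1.
Proof.
move=> /andP[u0 u1]; rewrite sqrtr_gt0 u0/=.
by rewrite -[X in _ < X]sqrtr1 ltr_sqrt.
Qed.

Let acos_sqrt (u : R) : 0 < u < 1 -> [/\ 0 <= acos (Num.sqrt u), acos (Num.sqrt u) <= pi &
  cos (acos (Num.sqrt u)) = Num.sqrt u].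
Proof.
move=> /sqrt01/andP[c0 c1].
have h : -1 <= Num.sqrt u <= 1 by rewrite (ltW c1) andbT (le_trans _ (ltW c0)).
by have [/andP[? ?] ?] := acos_def h.
Qed.

Let C1_gt0 : 0 < cos (k0 * s1).
Proof.
apply: cos_gt0_pihalf; rewrite k0s1 andbT (lt_trans _ (mulr_gt0 k00 s10))//.
by rewrite oppr_lt0 divr_gt0// pi_gt0.
Qed.

Let C0_gt0 : 0 < cos (k0 * s0).
Proof.
apply: cos_gt0_pihalf; apply/andP; split.
  by rewrite (lt_trans _ (mulr_gt0 k00 s00))// oppr_lt0 divr_gt0// pi_gt0.
by apply: lt_trans k0s1; rewrite ltr_pM2l.
Qed.

Let C0_lt1 : cos (k0 * s0) < 1.
Proof.
rewrite -cos0 ltr_cos ?mulr_gt0//.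
- by apply: quarter => //; rewrite divr_ge0// pi_ge0.
- apply: quarter; first by rewrite mulr_ge0// ltW.
  by apply: ltW; apply: lt_trans k0s1; rewrite ltr_pM2l.
Qed.

Let profile_low (u : R) : u <= cos (k0 * s1) ^+ 2 -> profile u = 0.
Proof.
move=> uC; rewrite /profile; case: ifP => // u01.
have [a0 api ca] := acos_sqrt u01; have /andP[c0 c1] := sqrt01 u01.
rewrite g0 ?mul0r//; right; rewrite ler_pdivlMr// mulrC leNgt -ltr_cos ?in_itv/= ?a0//; last first.
  by have := quarter (ltW (mulr_gt0 k00 s10)) (ltW k0s1); rewrite in_itv.
rewrite ca -leNgt -(ger0_norm (ltW C1_gt0)) -sqrtr_sqr ler_wsqrtr//.
Qed.

Let profile_high (u : R) : cos (k0 * s0) ^+ 2 <= u -> profile u = 0.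
Proof.
move=> uC; rewrite /profile; case: ifP => // u01.
have [a0 api ca] := acos_sqrt u01; have /andP[c0 c1] := sqrt01 u01.
have ks0 : k0 * s0 <= pi / 2.
  by apply: ltW; apply: lt_trans k0s1; rewrite ltr_pM2l.
rewrite g0 ?mul0r//; left; rewrite ler_pdivrMr// mulrC leNgt -ltr_cos ?in_itv/= ?a0//; last first.
  by have := quarter (ltW (mulr_gt0 k00 s00)) ks0; rewrite in_itv.
rewrite ca -leNgt -(ger0_norm (ltW C0_gt0)) -sqrtr_sqr ler_wsqrtr//.
Qed.

(** The support of g keeps [profile] zero near 0 and near 1, away from the singularities of the
    division and of [acos]; in between a continuous formula holds. *)
Let profile_continuous (u : R) : 0 <= u <= 1 -> {for u, continuous profile}.
Proof.
move=> /andP[u0 u1].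
have zero r : 0 < r -> (forall v, `|u - v| < r -> profile v = 0) -> {for u, continuous profile}.
  move=> r0 h; have pu : profile u = 0 by apply: h; rewrite subrr normr0.
  change (profile v @[v --> u] --> profile u); rewrite pu; apply: cvg_near_cst.
  by exists r => // v /= uv; exact: h.
have [uE|u_n0] := eqVneq u 0.
  apply: (zero (cos (k0 * s1) ^+ 2)); first by rewrite exprn_gt0.
  move=> v; rewrite uE sub0r normrN => /ltW v1; apply: profile_low.
  exact: le_trans (ler_norm _) v1.
have [uE|u_n1] := eqVneq u 1.
  apply: (zero (1 - cos (k0 * s0) ^+ 2)).
    by rewrite subr_gt0 expr_lt1// ltW.
  move=> v; rewrite uE => v1; apply: profile_high.
  by have := le_lt_trans (ler_norm _) v1; rewrite ltrD2l ltrN2 => /ltW.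
have u01 : 0 < u < 1 by rewrite !lt_neqAle u0 u1 eq_sym u_n0 u_n1.
have /andP[c0 c1] := sqrt01 u01; have /andP[u0' u1'] := u01.
have formula : {for u, continuous (fun v => g (acos (Num.sqrt v) / k0) / Num.sqrt v)}.
  have sc : {for u, continuous (@Num.sqrt R)} by exact: sqrt_continuous.
  apply: cvgM; last by apply: cvgV => //; rewrite gt_eqF.
  apply: (@continuous_comp _ _ _ (fun v => acos (Num.sqrt v) / k0) g); last exact: gc.
  apply: cvgM; last exact: cvg_cst.
  apply: (@continuous_comp _ _ _ (@Num.sqrt R) (@acos R)) => //.
  by apply: continuous_acos; rewrite c1 andbT (lt_trans _ c0).
change (profile v @[v --> u] --> profile u); rewrite {2}/profile u01.
apply: cvg_trans formula; apply: near_eq_cvg.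
near=> v; rewrite /profile ifT//; apply/andP; split.
- by near: v; exact: lt_nbhsr.
- by near: v; exact: lt_nbhsl.
Unshelve. all: by end_near. Qed.

Let profile_bounded (u : R) : `|profile u| <= M / cos (k0 * s1).
Proof.
have M0 : 0 <= M by apply: le_trans (gM 0).
have B0 : 0 <= M / cos (k0 * s1) by rewrite divr_ge0// (ltW C1_gt0).
have [uC|Cu] := leP u (cos (k0 * s1) ^+ 2); first by rewrite profile_low// normr0.
rewrite /profile; case: ifP => u01; last by rewrite normr0.
have /andP[c0 c1] := sqrt01 u01.
rewrite normrM normfV (gtr0_norm c0) ler_pM ?invr_ge0 ?(ltW c0)//.
rewrite lef_pV2 ?posrE// -(ger0_norm (ltW C1_gt0)) -sqrtr_sqr ler_wsqrtr//.
exact: ltW.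
Qed.

(** A Bernstein polynomial of [profile], taken at cos^2 t and multiplied by cos t, is an odd cosine
    sum; for t = k0 s in the first quarter period it approaches g s. The bound M + e holds on the
    whole line because |cos t * profile (cos t ^ 2)| <= M for every t. *)
Lemma odd_cos_approx (e : R) : 0 < e -> exists n c,
  (forall s, 0 <= s -> k0 * s <= pi / 2 -> `|odd_cos_sum n c (k0 * s) - g s| <= e) /\
  forall t, `|odd_cos_sum n c t| <= M + e.
Proof.
move=> e0.
have [n nP] := bernstein e0 profile_continuous (fun u _ => profile_bounded u).
have [m [c [_ cE]]] := odd_trig_binomial_mean n (fun i => profile (i%:R / n%:R)).
exists m, c.
have cos2 (t : R) : 0 <= cos t ^+ 2 <= 1.
  by rewrite sqr_ge0/= -(real_normK (num_real _)) expr_le1// normr_cos_le1.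
have dist (t : R) : `|odd_cos_sum m c t - cos t * profile (cos t ^+ 2)| <= e.
  rewrite -cE -mulrBr normrM; apply: le_trans (nP _ (cos2 t)).
  by rewrite ler_piMl// normr_cos_le1.
split.
  move=> s sge ks; have := dist (k0 * s); congr (`|_ - _| <= _).
  have k0s : 0 <= k0 * s by rewrite mulr_ge0// ltW.
  have sq := quarter k0s ks.
  have [sp|sp] := eqVneq (k0 * s) (pi / 2).
    rewrite sp cos_pihalf mul0r g0//; right.
    by rewrite -(ler_pM2l k00) sp ltW.
  have cpos : 0 < cos (k0 * s).
    apply: cos_gt0_pihalf; rewrite [k0 * s < _]lt_neqAle sp ks !andbT.
    by rewrite (lt_le_trans _ k0s)// oppr_lt0 divr_gt0// pi_gt0.
  have [sz|sz] := eqVneq s 0.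
    rewrite sz mulr0 cos0 expr1n mul1r /profile ltxx andbF g0//.
    by left; exact: ltW.
  have c1 : cos (k0 * s) < 1.
    rewrite -cos0 ltr_cos ?mulr_gt0// ?lt_neqAle ?sge ?[0 == s]eq_sym ?sz//.
    by apply: quarter; rewrite ?divr_ge0 ?pi_ge0.
  rewrite /profile exprn_gt0//= expr_lt1 ?c1 ?ltW// sqrtr_sqr gtr0_norm//.
  rewrite cosK// (_ : k0 * s / k0 = s); last by field; rewrite gt_eqF.
  by field; rewrite gt_eqF.
move=> t; have := ler_distD (cos t * profile (cos t ^+ 2)) (odd_cos_sum m c t) 0.
rewrite !subr0; have := dist t.
have : `|cos t * profile (cos t ^+ 2)| <= M.
  rewrite normrM /profile; case: ifP => u01; last first.
    by rewrite normr0 mulr0; exact: le_trans (gM 0).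
  have c0 : `|cos t| != 0.
    by move: u01 => /andP[+ _]; apply: contraL => /eqP; move/normr0_eq0 => ->; rewrite expr0n ltxx.
  by rewrite sqrtr_sqr normrM normfV normr_id mulrCA mulfV// mulr1.
by move=> h1 h2 h3; apply: (le_trans h3); rewrite addrC lerD.
Qed.
End CosineSubstitution.

End TrigonometricApproximation.

(** * Vanishing of integrable functions *)

Section FundamentalLemma.
Context {R : realType}.
Notation mu := (@lebesgue_measure R).

Definition ramp (t : R) : R := (`|t| - `|t - 1| + 1) / 2.

Lemma ramp_le0 t : t <= 0 -> ramp t = 0.
Proof. by move=> t0; rewrite /ramp !ler0_norm; [field|lra|lra]. Qed.

Lemma ramp_ge1 t : 1 <= t -> ramp t = 1.
Proof. by move=> t1; rewrite /ramp !ger0_norm; [field|lra|lra]. Qed.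

Lemma ramp01 t : 0 <= ramp t <= 1.
Proof.
have [t0|t0] := leP t 0; first by rewrite ramp_le0// lexx ler01.
have [t1|t1] := leP 1 t; first by rewrite ramp_ge1// lexx ler01.
rewrite /ramp (gtr0_norm t0) ltr0_norm ?subr_lt0//.
by apply/andP; split; clear -t0 t1; lra.
Qed.

Lemma continuous_ramp : continuous ramp.
Proof.
move=> t; apply: cvgM; last exact: cvg_cst.
apply: cvgD; last exact: cvg_cst.
apply: cvgB; first by apply: cvg_norm; exact: cvg_id.
by apply: cvg_norm; apply: cvgB; [exact: cvg_id|exact: cvg_cst].
Qed.

(** The ramps start at distance d / 2 from the ends and are complete at distance d, so the support
    is compact in ]a, b[. *)
Definition cutoff (a b d x : R) : R :=
  ramp (2 / d * (x - a) - 1) * ramp (2 / d * (b - x) - 1).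

Lemma cutoff01 a b d x : 0 <= cutoff a b d x <= 1.
Proof.
have /andP[h1 h2] := ramp01 (2 / d * (x - a) - 1).
have /andP[h3 h4] := ramp01 (2 / d * (b - x) - 1).
by rewrite /cutoff mulr_ge0//= -[leRHS]mulr1 ler_pM.
Qed.

Lemma continuous_cutoff a b d : continuous (cutoff a b d).
Proof.
move=> x; apply: cvgM.
  apply: (@continuous_comp _ _ _ (fun x => 2 / d * (x - a) - 1)); last exact: continuous_ramp.
  apply: cvgB; last exact: cvg_cst.
  by apply: cvgM; [exact: cvg_cst|apply: cvgB; [exact: cvg_id|exact: cvg_cst]].
apply: (@continuous_comp _ _ _ (fun x => 2 / d * (b - x) - 1)); last exact: continuous_ramp.
apply: cvgB; last exact: cvg_cst.
by apply: cvgM; [exact: cvg_cst|apply: cvgB; [exact: cvg_cst|exact: cvg_id]].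
Qed.

Lemma cutoff_out a b d x : 0 < d -> x <= a + d / 2 \/ b - d / 2 <= x ->
  cutoff a b d x = 0.
Proof.
move=> d0 [xa|bx]; rewrite /cutoff.
  rewrite ramp_le0 ?mul0r// subr_le0 mulrAC ler_pdivrMr//; lra.
rewrite [X in _ * X]ramp_le0 ?mulr0// subr_le0 mulrAC ler_pdivrMr//; lra.
Qed.

Lemma cutoff_in a b d x : 0 < d -> a + d <= x -> x <= b - d -> cutoff a b d x = 1.
Proof.
move=> d0 ax xb; rewrite /cutoff !ramp_ge1 ?mulr1// lerBrDr mulrAC ler_pdivlMr//; lra.
Qed.

(** A continuous approximation of the sign of p, cut off near the ends, is an admissible g. With I
    the integral of |p|, it turns the hypothesis into I <= I / 2 up to a small error, hence I =
    0. *)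
Lemma L1_zero (a b : R) (p : R -> R) : a < b ->
  mu.-integrable `]a, b[ (EFin \o p) ->
  (forall (g : R -> R) (a' b' : R), a < a' -> a' < b' -> b' < b -> continuous g ->
     (forall x, `|g x| <= 1) -> (forall x, x <= a' \/ b' <= x -> g x = 0) ->
     `|\int[mu]_(x in `]a, b[) (p x * g x)| <= 2^-1 * \int[mu]_(x in `]a, b[) `|p x|) ->
  {ae mu, forall x, `]a, b[%classic x -> p x = 0}.
Proof.
move=> ab pi H.
have pn := integrable_normR pi.
pose I := \int[mu]_(x in `]a, b[) `|p x|.
have I0 : 0 <= I by exact: Rintegral_ge0.
suff IE : I = 0.
  have e0 : (\int[mu]_(x in `]a, b[) `|(p x)%:E| = 0)%E.
    have /fineK : (\int[mu]_(x in `]a, b[) (`|p x|)%:E)%E \is a fin_num.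
      exact: integrable_fin_num.
    by move=> <-; congr EFin.
  have := (ae_eq_integral_abs mu (measurable_itv `]a, b[) (measurable_int _ pi)).1 e0.
  move=> [N [mN N0 NS]]; exists N; split => // x /= nP; apply: NS => /= h.
  by apply: nP => abx; have := h abx => -[].
(* The errors are e at each end, 2 e for replacing p by a continuous function, and e (b - a) for
   regularizing the sign; the outer 2 compensates the factor 1/2. *)
apply: (@eq_of_small _ _ _ (2 * (4 + (b - a)))) => e e0.
rewrite subr0 ger0_norm//.
have pi' : mu.-integrable setT (EFin \o (fun x => `|(p \_ `]a, b[) x|)).
  by apply: integrable_normR; rewrite -restrict_EFin -integrable_mkcond.
have [d d0 dP] := Rintegral_small pi' (fun t => normr_ge0 _) e0.
have [|g_ [gc gi gl]] := @approximation_continuous_integrable R `]a, b[ p (measurable_itv _) _ pi.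
  change (mu `]a, b[%classic < +oo)%E.
  by rewrite lebesgue_measure_itv/=; case: ifP => _; rewrite ltry.
move/fine_cvgP : gl => [gfin /cvgrPdist_lt /(_ _ e0) gl].
have [N [_ gfin' gN]] : exists N, [/\ True, (\int[mu]_(z in `]a, b[) `|(p z - g_ N z)%:E|)%E \is a fin_num
   & `|0 - fine (\int[mu]_(z in `]a, b[) `|(p z - g_ N z)%:E|)%E| < e].
  have := filterI gfin gl; move=> [N _ /(_ N (leqnn N)) /= [? ?]].
  by exists N.
pose f := g_ N; pose dd := Num.min d ((b - a) / 4).
have dd0 : 0 < dd by rewrite lt_min d0 divr_gt0// subr_gt0.
have ddd : dd <= d by rewrite ge_min lexx.
have ddb : dd <= (b - a) / 4 by rewrite ge_min lexx orbT.
(* The quotient f / (|f| + e) is a continuous substitute for the sign of f, and f is L^1-close to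
   p. *)
pose g x := cutoff a b dd x * (f x / (`|f x| + e)).
have den0 x : 0 < `|f x| + e by rewrite ltr_wpDl.
have phi1 x : `|f x / (`|f x| + e)| <= 1.
  rewrite normrM normfV (gtr0_norm (den0 x)) ler_pdivrMr// mul1r lerDl.
  exact: ltW.
have g1 x : `|g x| <= 1.
  have /andP[c0 c1] := cutoff01 a b dd x.
  by rewrite /g normrM -[leRHS]mulr1 ler_pM// ger0_norm.
have fc := gc N.
have cg : continuous g.
  move=> x; apply: cvgM; first exact: continuous_cutoff.
  apply: cvgM; first exact: fc.
  apply: cvgV; first by rewrite gt_eqF.
  by apply: cvgD; [apply: cvg_norm; exact: fc|exact: cvg_cst].
have g0 x : x <= a + dd / 2 \/ b - dd / 2 <= x -> g x = 0.
  by move=> /(cutoff_out dd0) h; rewrite /g h mul0r.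
have := H g (a + dd / 2) (b - dd / 2).
move=> /(_ _ _ _ cg g1 g0) Hg.
have {}Hg : `|\int[mu]_(x in `]a, b[) (p x * g x)| <= 2^-1 * I.
  by apply: Hg; clear -dd0 ddb ab; lra.
have mab := measurable_itv `]a, b[.
pose F x := `|(p \_ `]a, b[) x|.
have Fi A : measurable A -> mu.-integrable setT (EFin \o (F \_ A)).
  by move=> mA; rewrite -restrict_EFin -integrable_mkcond//; exact: integrableS pi'.
pose A1 : set R := `]a, a + dd]%classic; pose A2 : set R := `]b - dd, b]%classic.
have h1i : mu.-integrable `]a, b[ (EFin \o (F \_ A1)).
  exact: (@integrableS _ _ _ mu setT `]a, b[ _ measurableT mab (@subsetT _ _) (Fi A1 (measurable_itv _))).
have h2i : mu.-integrable `]a, b[ (EFin \o (F \_ A2)).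
  exact: (@integrableS _ _ _ mu setT `]a, b[ _ measurableT mab (@subsetT _ _) (Fi A2 (measurable_itv _))).
have F0 x : 0 <= F x by rewrite /F.
have h_small (x y : R) : y - x <= d -> \int[mu]_(t in `]a, b[) (F \_ `]x, y]) t <= e.
  move=> xyd; rewrite -Rintegral_mkcondr; apply: le_trans (dP x y xyd).
  apply: le_Rintegral_subset => //; first exact: measurableI.
  exact: integrableS pi'.
have h1e : \int[mu]_(t in `]a, b[) (F \_ A1) t <= e.
  by apply: h_small; rewrite addrAC subrr add0r.
have h2e : \int[mu]_(t in `]a, b[) (F \_ A2) t <= e.
  by apply: h_small; rewrite opprB addrC subrK.
have fi : mu.-integrable `]a, b[ (EFin \o f) by exact: gi.
have pfi : mu.-integrable `]a, b[ (EFin \o (fun x => `|p x - f x|)).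
  apply: integrable_normR.
  by have := @integrableB _ _ R mu _ mab _ _ pi fi.
have pfe : \int[mu]_(x in `]a, b[) `|p x - f x| <= e.
  move: gN; rewrite sub0r normrN => /ltW; apply: le_trans.
  exact: ler_norm.
have ei : mu.-integrable `]a, b[ (EFin \o cst e).
  apply/integrableP; split; first by apply/measurable_EFinP; exact: measurable_cst.
  apply: (@le_lt_trans _ _ (\int[mu]_(x in `]a, b[) (cst (`|e|%:E) x))%E) => //.
  rewrite integral_cst//= lebesgue_measure_itv/=; case: ifP => _.
    by rewrite -EFinB -EFinM ltry.
  by rewrite mule0 ltry.
have eI : \int[mu]_(x in `]a, b[) e = e * (b - a).
  rewrite Rintegral_cst//; congr (_ * _).
  change (fine (mu `]a, b[%classic) = b - a).
  by rewrite lebesgue_measure_itv/= lte_fin ab.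
have pgi : mu.-integrable `]a, b[ (EFin \o (fun x => p x * g x)).
  apply: (@integrableMb _ _ _ _ 1) => //.
  by apply: measurable_funTS; exact: continuous_measurable_fun.
have s1 : mu.-integrable `]a, b[ (EFin \o (fun x => (F \_ A1) x + (F \_ A2) x)).
  by have := @integrableD _ _ R mu _ mab _ _ h1i h2i.
have s2 : mu.-integrable `]a, b[ (EFin \o (fun x => 2 * `|p x - f x| + e)).
  by have := @integrableD _ _ R mu _ mab _ _ (integrableZlR 2 mab pfi) ei.
have s3 : mu.-integrable `]a, b[ (EFin \o (fun x =>
    ((F \_ A1) x + (F \_ A2) x) + (2 * `|p x - f x| + e))).
  by have := @integrableD _ _ R mu _ mab _ _ s1 s2.
have s4 : mu.-integrable `]a, b[ (EFin \o (fun x => `|p x| -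
    (((F \_ A1) x + (F \_ A2) x) + (2 * `|p x - f x| + e)))).
  by have := @integrableB _ _ R mu _ mab _ _ pn s3.
have key x : `]a, b[%classic x -> `|p x| -
    (((F \_ A1) x + (F \_ A2) x) + (2 * `|p x - f x| + e)) <= p x * g x.
  move=> abx; have /andP[c0 c1] := cutoff01 a b dd x.
  have px : F x = `|p x| by rewrite /F patchE mem_set.
  have cut : `|p x| * (1 - cutoff a b dd x) <= (F \_ A1) x + (F \_ A2) x.
    have FA0 A : 0 <= (F \_ A) x by rewrite patchE; case: ifP.
    have [xa|ax] := leP x (a + dd).
      rewrite -[leLHS]addr0; apply: lerD => //.
      rewrite patchE mem_set; last first.
        by move: abx; rewrite /A1 /= !in_itv/= => /andP[-> _].
      by rewrite px ler_piMr// lerBlDr lerDl.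
    have [bx|xb] := ltP (b - dd) x.
      rewrite -[leLHS]add0r; apply: lerD => //.
      rewrite patchE mem_set; last first.
        by move: abx; rewrite /A2 /= !in_itv/= bx => /andP[_ /ltW].
      by rewrite px ler_piMr// lerBlDr lerDl.
    by rewrite (cutoff_in dd0 (ltW ax) xb) subrr mulr0 addr_ge0.
  have pphi : `|p x| - (2 * `|p x - f x| + e) <= p x * (f x / (`|f x| + e)).
    have ff : `|f x| - e <= f x * (f x / (`|f x| + e)).
      rewrite mulrA ler_pdivlMr// -expr2 -(real_normK (num_real (f x))).
      have := sqr_ge0 e; rewrite !expr2; move: `|f x| => y; clear; nra.
    have pf : - `|p x - f x| <= (p x - f x) * (f x / (`|f x| + e)).
      rewrite lerNl; apply: (le_trans (ler_norm _)).
      by rewrite normrN normrM ler_piMr.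
    have := ler_distD (f x) (p x) 0; rewrite !subr0.
    by move: ff pf; clear; lra.
  rewrite /g mulrCA.
  move: cut pphi; have := normr_ge0 (p x - f x); have := normr_ge0 (p x).
  move: (cutoff a b dd x) c0 c1 ((F \_ A1) x + (F \_ A2) x) `|p x| `|p x - f x|
    (p x * (f x / (`|f x| + e))) e0.
  clear => c c0 c1 h P D W e0 P0 D0 cut pphi.
  have : c * (P - (2 * D + e)) <= c * W by rewrite ler_wpM2l.
  nra.
have := @le_Rintegral _ _ R mu _ _ _ mab s4 pgi key.
rewrite RintegralB// RintegralD// RintegralD// RintegralD//; last exact: integrableZlR.
rewrite RintegralZl// eI -/I.
have := ler_norm (\int[mu]_(x in `]a, b[) (p x * g x)).
move: Hg h1e h2e pfe; clear; lra.
Qed.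

End FundamentalLemma.

(** * Products of Jost solutions *)

Section JostProducts.
Context {R : realType}.
Notation mu := (@lebesgue_measure R).

Lemma volterra_tail_lin q (k Xm a b : R) E F (u v : R -> R) :
  0 < k -> 0 <= Xm -> mu.-integrable `]0, +oo[ (EFin \o q) ->
  volterra_tail q k E Xm u -> volterra_tail q k F Xm v ->
  volterra_tail q k (fun x => a * E x + b * F x) Xm (fun x => a * u x + b * v x).
Proof.
move=> k0 Xm0 qi hu hv.
have [mu_ [M M0 MP] eu] := hu; have [mv [N N0 NP] ev] := hv.
split.
- apply: measurable_funD; exact: measurable_funM.
- exists (`|a| * M + `|b| * N); first by rewrite addr_ge0// mulr_ge0.
  move=> x Xx; apply: (le_trans (ler_normD _ _)); rewrite !normrM.
  by apply: lerD; apply: ler_wpM2l => //; [exact: MP|exact: NP].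
move=> x Xx.
have ui := volterra_tail_integrable k0 Xm0 Xx qi hu.
have vi := volterra_tail_integrable k0 Xm0 Xx qi hv.
have -> : \int[mu]_(t in `]x, +oo[)
      (q t * ((a * u t + b * v t) * dAlembert_kernel k (t - x))) =
    \int[mu]_(t in `]x, +oo[) (a * (q t * (u t * dAlembert_kernel k (t - x))) +
                              b * (q t * (v t * dAlembert_kernel k (t - x)))).
  by apply: eq_Rintegral => t _; ring.
rewrite RintegralD//; [|exact: integrableZlR|exact: integrableZlR].
by rewrite !RintegralZl// {1}eu// {1}ev//; ring.
Qed.

Lemma jost_volterra q f (k Xm : R) : mu.-integrable `]0, +oo[ (EFin \o q) ->
  is_jost_plus q f -> 0 < k -> 0 < Xm ->
  volterra_tail q k (fun x => cos (k * x)) Xm (fun x => complex.Re (f x k)) /\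
  volterra_tail q k (fun x => sin (k * x)) Xm (fun x => complex.Im (f x k)).
Proof.
move=> qi jf k0 Xm0; have [s1 s2 l1 l2] := jost_components k jf.
have kn0 : k != 0 by rewrite gt_eqF.
have E1 x : `|cos (k * x)| <= 1 by exact: normr_cos_le1.
have E2 x : `|sin (k * x)| <= 1 by exact: normr_sin_le1.
have kp x (n : nat) : k * (x + pi *+ 2 *+ n / k) = k * x + pi *+ 2 *+ n by field.
have p1 x (n : nat) : cos (k * (x + pi *+ 2 *+ n / k)) = cos (k * x).
  by rewrite kp periodicn//; exact: cosD2pi.
have p2 x (n : nat) : sin (k * (x + pi *+ 2 *+ n / k)) = sin (k * x).
  by rewrite kp periodicn//; exact: sinD2pi.
have meas u : solution `]0, +oo[ q k u -> measurable_fun `]Xm, +oo[ u.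
  move=> su; apply: derivable_measurable => x; rewrite in_itv/= andbT => Xx.
  exact: derivable_solution su (lt_trans Xm0 Xx).
split; split; [exact: meas| | |exact: meas| |].
- have [M M0 MP] := solution_tail_bounded Xm0 s1 E1 l1.
  by exists M => // x /ltW; exact: MP.
- move=> x Xx; exact: asymptotic_integral_eq k0 (lt_trans Xm0 Xx) qi s1 E1 p1 l1.
- have [M M0 MP] := solution_tail_bounded Xm0 s2 E2 l2.
  by exists M => // x /ltW; exact: MP.
- move=> x Xx; exact: asymptotic_integral_eq k0 (lt_trans Xm0 Xx) qi s2 E2 p2 l2.
Qed.

(** The order of the quantifiers matters: the weight and ep0 depend on q and th only, and just the
    threshold for X1 comes after de. Thus the step of the later iteration is independent of the
    accuracy. *)
Lemma tail_data_exists q (th : R) : L11 `]0, +oo[ q -> 0 < th ->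
  exists (m w : R -> R) (K ep0 : R), 0 < ep0 /\
    forall ep de, 0 < ep -> ep <= ep0 -> 0 < de -> exists2 N, 0 <= N &
      forall X1, N <= X1 -> tail_data q m w K th de ep X1.
Proof.
move=> Lq th0; have [_ mi0] := L11_integrable (measurable_itv _) Lq.
pose m := (fun x => (1 + `|x|) * `|q x|) \_ `]0, +oo[.
have m0 t : 0 <= m t.
  by rewrite /m patchE; case: ifP => // _; rewrite mulr_ge0// addr_ge0.
have mi : mu.-integrable setT (EFin \o m).
  by rewrite /m -restrict_EFin -integrable_mkcond.
have mE t : 0 < t -> m t = (1 + t) * `|q t|.
  by move=> t0; rewrite /m patchE mem_set/= ?in_itv/= ?t0// (gtr0_norm t0).
have [w [K K1 [wK mw wd wi]]] := exists_decreasing_weight th0 mi m0.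
pose I := \int[mu]_(t in `]0, +oo[) m t.
have I0 : 0 <= I by exact: Rintegral_ge0.
exists m, w, K, (th / (I + 1)); split; first by rewrite divr_gt0// ltr_wpDl.
move=> ep de ep0 epI de0.
have [N NP] := integral_tail measurableT mi (mulr_gt0 th0 de0).
exists (Num.max N 0); first by rewrite le_max lexx orbT.
move=> X1; rewrite ge_max => /andP[NX X10]; split => //.
- by move=> t t0; rewrite mE// ler_peMl// lerDl ltW.
- move=> x t x0 xt; have t0 : 0 < t by exact: le_lt_trans xt.
  rewrite mE// mulrC ler_wpM2r//; move: x0 xt; clear; lra.
- have := NP X1 NX; rewrite setTI => /ltW; apply: le_trans.
  rewrite le_eqVlt; apply/orP; left; apply/eqP; apply: eq_Rintegral => t _.
  by rewrite ger0_norm.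
- apply: (@le_trans _ _ (th / (I + 1) * I)); first by rewrite ler_wpM2r.
  rewrite mulrAC ler_pdivrMr ?ltr_wpDl// mulrDr mulr1 lerDl; exact: ltW.
Qed.

(** The earlier bounds depend on the distance to 0. The wave estimate for a single frequency, with
    [Xm] equal to x / 2, returns a bound in which [Xm] no longer appears, hence one that holds up to
    0. *)
Lemma jost_uniform_bound q f (k : R) : L11 `]0, +oo[ q -> is_jost_plus q f -> 0 < k ->
  exists2 M, 0 <= M & forall x, 0 < x ->
    `|complex.Re (f x k)| <= M /\ `|complex.Im (f x k)| <= M.
Proof.
move=> Lq jf k0; have [qi _] := L11_integrable (measurable_itv _) Lq.
pose th : R := 40^-1.
have th0 : 0 < th by rewrite invr_gt0.
have th1 : 2 * th < 1 by rewrite /th; lra.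
have [m [w [K [ep0 [ep00 tdP]]]]] := tail_data_exists Lq th0.
have [N0 N00 td0] := tdP ep0 1 ep00 (lexx _) ltr01.
have td1 := td0 N0 (lexx _).
pose I := \int[mu]_(t in `]0, +oo[) m t.
have I0 : 0 <= I by apply: Rintegral_ge0 => t _; exact: (td_m0 td1).
(* With X1 = 0 the tail is the whole integral of m, and de is taken large enough to absorb it. *)
pose de := I / th + 1.
have Ith : 0 <= I / th by rewrite divr_ge0// ltW.
have de0 : 0 < de by rewrite ltr_wpDl.
have td : tail_data q m w K th de ep0 0.
  case: td1 => *; split => //.
  rewrite /de mulrDr mulr1 mulrCA mulfV ?gt_eqF// mulr1.
  by rewrite lerDl ltW.
have K0 : 0 <= K by have /andP[h1 h2] := td_w td 0; apply: le_trans h2; apply: le_trans h1.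
have bnd (A B EA EB : R -> R) : (forall Xm, 0 < Xm ->
    volterra_tail q k EA Xm A /\ volterra_tail q k EB Xm B) ->
   (forall x z, `|cos (k * z) * EA x - sin (k * z) * EB x| <= 1) ->
   forall x, 0 < x -> `|A x| <= (1 - 2 * th)^-1 * (1 + 1 * K * (1 + 1 + de)).
  move=> vAB E1 x x0; have x20 : 0 < x / 2 by rewrite divr_gt0.
  have [vA vB] := vAB _ x20.
  have := @jost_step _ q m w K th de ep0 0 td 1 (fun=> k) (fun=> A) (fun=> B)
    (fun=> EA) (fun=> EB) (x / 2) 1 1 0 (2 * ep0).
  move=> /(_ (fun _ _ => k0) (ltW x20) qi (fun _ _ => vA) (fun _ _ => vB) ler01 ltr01 th1).
  move=> /(_ _ x 0) h; have {h} [||h _] := h.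
  - move=> y z [xy _]; rewrite /wave big_ord1; apply: (le_trans (E1 _ _)).
    have y0 : 0 < y by exact: lt_trans xy.
    rewrite /tail_majorant y0 -[leLHS]add0r; apply: lerD; first by rewrite mulr_ge0.
    have /andP[w1 _] := td_w td y.
    rewrite mul1r -[leLHS]mulr1; apply: ler_pM => //.
    by rewrite -addrA lerDl addr_ge0// ltW.
  - by split; [rewrite gtr_pMr// invf_lt1 ?ltr1n|rewrite subrr addr0 ltW].
  move: h; rewrite /wave big_ord1 mulr0 cos0 sin0 mul1r mul0r subr0.
  move=> h; apply: (le_trans h); apply: ler_wpM2l.
    by rewrite invr_ge0 subr_ge0 ltW.
  rewrite /tail_majorant; have /andP[w1 wK] := td_w td x.
  have w0 : 0 <= w x by exact: le_trans w1.
  apply: lerD; first by rewrite mul1r lern1 leq_b1.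
  apply: ler_pM => //; first by rewrite mul1r.
  - by apply: addr_ge0; [apply: addr_ge0; exact: ler0n|exact: ltW].
  - by rewrite !mul1r.
  by rewrite lerD2r; apply: lerD; rewrite lern1 leq_b1.
have E1 x z : `|cos (k * z) * cos (k * x) - sin (k * z) * sin (k * x)| <= 1.
  by rewrite -cosD normr_cos_le1.
have E2 x z : `|cos (k * z) * sin (k * x) - sin (k * z) * (- 1 * cos (k * x) + 0 * sin (k * x))| <= 1.
  rewrite mul0r addr0 mulN1r mulrN opprK addrC.
  by rewrite -sinD normr_sin_le1.
set C := (1 - 2 * th)^-1 * (1 + 1 * K * (1 + 1 + de)) in bnd.
exists C.
  apply: mulr_ge0; first by rewrite invr_ge0 subr_ge0 ltW.
  rewrite mul1r; apply: addr_ge0 => //; apply: mulr_ge0 => //.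
  by rewrite !addr_ge0.
move=> x x0; split.
  exact: (bnd _ _ _ _ (fun Xm h => jost_volterra qi jf k0 h) E1 x x0).
(* The imaginary part of f is the real part of - i f, whose imaginary part is minus the real part of
   f. *)
apply: (bnd (fun x => complex.Im (f x k)) (fun x => - 1 * complex.Re (f x k) + 0 * complex.Im (f x k)) (fun x => sin (k * x)) (fun x => - 1 * cos (k * x) + 0 * sin (k * x)) _ E2 x x0) => Xm Xm0.
have [h1 h2] := jost_volterra qi jf k0 Xm0; split => //.
by apply: volterra_tail_lin => //; exact: ltW.
Qed.

Definition jost_product_sum (n : nat) (k0 : R) (c : nat -> R) (f1 f2 : R -> R -> R[i]) (x : R) : R :=
  \sum_(j < n) c j * complex.Re (f1 x (odd_freq k0 j) * f2 x (odd_freq k0 j)).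

(** With x frozen in f2, the numbers c_j f2(x, k_j) are complex coefficients of a wave built on f1,
    taken at z = 0. By [wave_exponential] the corresponding free wave depends only on the sum of its
    two variables. *)
Lemma jost_product_sumE n k0 c f1 f2 x : jost_product_sum n k0 c f1 f2 x =
  wave n (odd_freq k0)
    (fun j y => c j * complex.Re (f2 x (odd_freq k0 j)) * complex.Re (f1 y (odd_freq k0 j)) +
       - (c j * complex.Im (f2 x (odd_freq k0 j))) * complex.Im (f1 y (odd_freq k0 j)))
    (fun j y => c j * complex.Im (f2 x (odd_freq k0 j)) * complex.Re (f1 y (odd_freq k0 j)) +
       c j * complex.Re (f2 x (odd_freq k0 j)) * complex.Im (f1 y (odd_freq k0 j))) x 0.
Proof.
apply: eq_bigr => j _; rewrite mulr0 cos0 sin0 mul1r mul0r subr0.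
case: (f1 _ _) => a b; case: (f2 _ _) => a' b' /=; ring.
Qed.

Lemma wave_exponential n k (P Q : nat -> R) x z :
  wave n k (fun j y => P j * cos (k j * y) + - Q j * sin (k j * y))
    (fun j y => Q j * cos (k j * y) + P j * sin (k j * y)) x z =
  \sum_(j < n) (cos (k j * (x + z)) * P j - sin (k j * (x + z)) * Q j).
Proof.
rewrite /wave; apply: eq_bigr => j _; rewrite [k j * (x + z)]mulrDr cosD sinD; ring.
Qed.

End JostProducts.

(** * Two-pass estimate for products of Jost solutions *)

Section JostProductEstimate.
Context {R : realType}.
Notation mu := (@lebesgue_measure R).

Lemma wave_odd_cos n (k0 : R) c x z :
  wave n (odd_freq k0) (fun j y => c j * cos (odd_freq k0 j * y) + 0 * sin (odd_freq k0 j * y))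
    (fun j y => c j * sin (odd_freq k0 j * y) + 0 * cos (odd_freq k0 j * y)) x z =
  odd_cos_sum n c (k0 * (x + z)).
Proof.
rewrite /wave /odd_cos_sum; apply: eq_bigr => j _.
have -> : j.*2.+1%:R * (k0 * (x + z)) = odd_freq k0 j * x + odd_freq k0 j * z.
  by rewrite /odd_freq; ring.
by rewrite cosD; ring.
Qed.

(* Multiplying by the two Jost solutions one after the other amounts to two
   passes of jost_step: the first with the plane waves as data, the second
   with the output of the first one at a fixed x as data. *)
Lemma jost_product_estimate (q1 q2 : R -> R) f1 f2 :
  L11 `]0, +oo[ q1 -> L11 `]0, +oo[ q2 -> is_jost_plus q1 f1 -> is_jost_plus q2 f2 ->
  exists ep C : R, [/\ 0 < ep, 0 <= C & forall de, 0 < de -> de <= 1 ->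
    exists2 N, 0 <= N & forall X1 (a : R), N <= X1 -> 0 <= a ->
    forall n c k0, 0 < k0 ->
    (forall s, `|odd_cos_sum n c (k0 * s)| <= 2) ->
    (forall s, 2 * (a + ep) <= s -> s <= 4 * X1 + 1 -> `|odd_cos_sum n c (k0 * s)| <= de) ->
    forall x, 0 < x -> a <= x ->
      (x <= X1 -> `|jost_product_sum n k0 c f1 f2 x - odd_cos_sum n c (k0 * (2 * x))| <=
         2^-1 * (x < a + ep)%R%:R + C * de) /\
      (X1 < x -> `|jost_product_sum n k0 c f1 f2 x| <= C)].
Proof.
move=> L1 L2 j1 j2.
have [qi1 _] := L11_integrable (measurable_itv _) L1.
have [qi2 _] := L11_integrable (measurable_itv _) L2.
(* Each pass leaves the relative error 2 th ka = 1 / 19, so that the strip contributes 2 / 19 + (40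
   / 19) / 19 < 1 / 2 in the end. *)
pose th : R := 40^-1; pose ka : R := (1 - 2 * th)^-1.
have kaE : ka = 20 / 19 by rewrite /ka /th; field.
have th0 : 0 < th by rewrite invr_gt0.
have th1 : 2 * th < 1 by rewrite /th; lra.
have kag0 : 0 < ka by rewrite kaE; lra.
have ka0 : 0 <= ka by exact: ltW.
have [m1 [w1 [K1 [e1 [e10 td1P]]]]] := tail_data_exists L1 th0.
have [m2 [w2 [K2 [e2 [e20 td2P]]]]] := tail_data_exists L2 th0.
pose ep := Num.min e1 e2.
have ep0 : 0 < ep by rewrite lt_min e10.
have epe1 : ep <= e1 by rewrite ge_min lexx.
have epe2 : ep <= e2 by rewrite ge_min lexx orbT.
have [N1 _ td1_] := td1P ep 1 ep0 epe1 ltr01.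
have [N2 _ td2_] := td2P ep 1 ep0 epe2 ltr01.
have W1 x : 1 <= w1 x <= K1 by exact: (td_w (td1_ N1 (lexx _))).
have W2 x : 1 <= w2 x <= K2 by exact: (td_w (td2_ N2 (lexx _))).
have K11 : 1 <= K1 by have /andP[h1 h2] := W1 0; exact: le_trans h2.
have K21 : 1 <= K2 by have /andP[h1 h2] := W2 0; exact: le_trans h2.
have K10 : 0 <= K1 by exact: le_trans K11.
have K20 : 0 <= K2 by exact: le_trans K21.
(* A bound for the first wave on its whole domain: the two indicators and de add up to at most 3. It
   is used for x > X1. *)
pose M2 := ka * (2 + 2 * K2 * 3).
have M20 : 0 < M2.
  apply: mulr_gt0; first by rewrite kaE; lra.
  by apply: ltr_pwDl => //; rewrite !mulr_ge0.
have M2E : M2 = ka * (2 + 2 * K2 * 3) by [].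
move: (M2) M2E M20 => {}M2 M2E M20.
pose C := 2 * (ka * K2 * K1) + 2 * K2 + ka * (M2 + M2 * K1 * 3).
have C0 : 0 <= C.
  have kKK : 0 <= ka * K2 * K1 by rewrite !mulr_ge0.
  have MK : 0 <= M2 * K1 * 3 by rewrite !mulr_ge0// ltW.
  have kM : 0 <= ka * (M2 + M2 * K1 * 3) by rewrite mulr_ge0// addr_ge0// ltW.
  by apply: addr_ge0 => //; apply: addr_ge0; rewrite mulr_ge0.
exists ep, C; split => // de de0 de1.
have [n1 n10 TD1] := td1P ep de ep0 epe1 de0.
have [n2 n20 TD2] := td2P ep de ep0 epe2 de0.
exists (Num.max n1 n2); first by rewrite le_max n10.
move=> X1 a; rewrite ge_max => /andP[nX1 nX2] a0 n c k0 k00 psi2 psid x x0 ax.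
have td1 := TD1 X1 nX1; have td2 := TD2 X1 nX2.
have X10 := td_X1 td1.
pose k := odd_freq k0.
have kp j : (j < n)%N -> 0 < k j by move=> _; rewrite /k /odd_freq mulr_gt0// ltr0n.
pose be := 2 * (a + ep).
(* At the points of evaluation the Y-indicators of the two passes amount to Y <= 2 X1 and Y <= 4 X1
   - 2 x; this choice makes both false. *)
pose Y := 4 * X1 + 1.
pose psi s := odd_cos_sum n c (k0 * s).
pose A2 j y := c j * complex.Re (f2 y (k j)) + 0 * complex.Im (f2 y (k j)).
pose B2 j y := c j * complex.Im (f2 y (k j)) + 0 * complex.Re (f2 y (k j)).
pose EA2 j y := c j * cos (k j * y) + 0 * sin (k j * y).
pose EB2 j y := c j * sin (k j * y) + 0 * cos (k j * y).
pose Xm := x / 2.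
have Xm0 : 0 < Xm by rewrite divr_gt0.
have Xmx : Xm < x by rewrite gtr_pMr// invf_lt1// ltr1n.
have hA2 j : (j < n)%N -> volterra_tail q2 (k j) (EA2 j) Xm (A2 j).
  move=> jn; have [h1 h2] := jost_volterra qi2 j2 (kp j jn) Xm0.
  by apply: volterra_tail_lin => //; [exact: kp|exact: ltW].
have hB2 j : (j < n)%N -> volterra_tail q2 (k j) (EB2 j) Xm (B2 j).
  move=> jn; have [h1 h2] := jost_volterra qi2 j2 (kp j jn) Xm0.
  by apply: volterra_tail_lin => //; [exact: kp|exact: ltW].
have psiE y z : wave n k EA2 EB2 y z = psi (y + z) by exact: wave_odd_cos.
have step1 := @jost_step _ q2 m2 w2 K2 th de ep X1 td2 n k A2 B2 EA2 EB2 Xm 2 2 Y be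
  kp (ltW Xm0) qi2 hA2 hB2 (ler0n _ 2) (ltr0n _ 2) th1.
have {}step1 := step1 _.
have {}step1 : forall y z, Xm < y /\ be - 2 * ep <= y + z ->
    `|wave n k A2 B2 y z| <= ka * tail_majorant w2 2 2 de X1 Y be y z /\
    `|wave n k A2 B2 y z - psi (y + z)| <= 2 * th * ka * tail_majorant w2 2 2 de X1 Y be y z.
  move=> y z Dyz; rewrite -psiE; apply: step1 => // {Dyz}y {}z [Xy ayz].
  rewrite psiE /tail_majorant; have /andP[wy _] := W2 y.
  have wy0 : 0 <= w2 y by exact: le_trans wy.
  have n0 (b : bool) : 0 <= b%:R :> R by exact: ler0n.
  have [yb|by_] := ltP (y + z) be.
    rewrite mulr1 -[leLHS]addr0; apply: lerD; first exact: psi2.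
    by rewrite !mulr_ge0// !addr_ge0// ltW.
  rewrite mulr0 add0r; have [yY|Yy] := leP (y + z) Y.
    apply: (@le_trans _ _ (1 * de)); first by rewrite mul1r; exact: psid.
    apply: ler_pM => //; [exact: ltW| |by rewrite lerDr addr_ge0].
    by rewrite -[leLHS]mulr1; apply: ler_pM => //; rewrite ler1n.
  apply: (le_trans (psi2 _)); rewrite -mulrA -[leLHS]mulr1 ler_wpM2l//.
  apply: (@le_trans _ _ (1 * 1)); first by rewrite mulr1.
  apply: ler_pM => //; have [X1y|yX1] := ltP X1 y.
    by rewrite -addrA lerDl addr_ge0// ltW.
  rewrite (_ : Y <= z - y + 2 * X1); first by rewrite add0r lerDl ltW.
  by move: Yy yX1; clear; lra.
pose V z := wave n k A2 B2 x z.
pose P j := c j * complex.Re (f2 x (k j)).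
pose Q j := c j * complex.Im (f2 x (k j)).
pose A1 j y := P j * complex.Re (f1 y (k j)) + - Q j * complex.Im (f1 y (k j)).
pose B1 j y := Q j * complex.Re (f1 y (k j)) + P j * complex.Im (f1 y (k j)).
pose EA1 j y := P j * cos (k j * y) + - Q j * sin (k j * y).
pose EB1 j y := Q j * cos (k j * y) + P j * sin (k j * y).
have VE y z : wave n k EA1 EB1 y z = V (y + z).
  rewrite /EA1 /EB1 wave_exponential /V /wave; apply: eq_bigr => j _.
  by rewrite /A2 /B2 /P /Q !mul0r !addr0.
have UE : jost_product_sum n k0 c f1 f2 x = wave n k A1 B1 x 0.
  exact: jost_product_sumE.
have hA1 Z : 0 < Z -> forall j, (j < n)%N -> volterra_tail q1 (k j) (EA1 j) Z (A1 j).
  move=> Z0 j jn; have [h1 h2] := jost_volterra qi1 j1 (kp j jn) Z0.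
  by apply: volterra_tail_lin => //; [exact: kp|exact: ltW].
have hB1 Z : 0 < Z -> forall j, (j < n)%N -> volterra_tail q1 (k j) (EB1 j) Z (B1 j).
  move=> Z0 j jn; have [h1 h2] := jost_volterra qi1 j1 (kp j jn) Z0.
  by apply: volterra_tail_lin => //; [exact: kp|exact: ltW].
have /andP[w1x w1K] := W1 x; have /andP[w2x w2K] := W2 x.
have w10 : 0 <= w1 x by exact: le_trans w1x.
have w20 : 0 <= w2 x by exact: le_trans w2x.
have n0 (b : bool) : 0 <= b%:R :> R by exact: ler0n.
have nle1 (b : bool) : b%:R <= 1 :> R by rewrite lern1 leq_b1.
have UD : be - x - 2 * ep <= x + 0 by rewrite /be; move: ax; clear; lra.
split => xX1.
- have nX : (X1 < x) = false by rewrite ltNge xX1.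
  pose i2 : R := (2 * x < be)%R%:R.
  (* If y <= X1 and Y <= (y + z) - x + 2 X1, then z - y + 2 X1 >= y + z >= Y2, so the Y-indicator of
     the first pass is dominated by that of the second; for y > X1 the step indicator takes over. *)
  pose Y2 := Y + x - 2 * X1.
  have step2 := @jost_step _ q1 m1 w1 K1 th de ep X1 td1 n k A1 B1 EA1 EB1 Xm
    (2 * ka) (2 * ka * K2) Y2 (be - x) kp (ltW Xm0) qi1 (hA1 _ Xm0) (hB1 _ Xm0).
  have ka2 : 0 <= 2 * ka by rewrite mulr_ge0.
  have kaK : 0 < 2 * ka * K2.
    by rewrite !mulr_gt0// (lt_le_trans _ K21).
  have {}step2 := step2 ka2 kaK th1.
  have v0 y z : Xm < y /\ be - x - 2 * ep <= y + z -> `|wave n k EA1 EB1 y z| <=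
      tail_majorant w1 (2 * ka) (2 * ka * K2) de X1 Y2 (be - x) y z.
    move=> [Xmy ayz]; rewrite VE.
    have D : Xm < x /\ be - 2 * ep <= x + (y + z).
      by split => //; move: ayz; clear; lra.
    apply: (le_trans (step1 x (y + z) D).1); rewrite /tail_majorant nX add0r.
    have /andP[w1y _] := W1 y; have w1y0 : 0 <= w1 y by exact: le_trans w1y.
    rewrite mulrDr mulrA [ka * 2]mulrC; apply: lerD.
      by apply: ler_wpM2l => //; rewrite (_ : (x + (y + z) < be) = (y + z < be - x))// ltrBrDl.
    rewrite !mulrA [ka * 2]mulrC; apply: ler_pM; rewrite ?mulr_ge0 ?addr_ge0 ?(ltW de0)//.
      rewrite -[leLHS]mulr1; apply: ler_pM; rewrite ?mulr_ge0//.
      by apply: ler_wpM2l.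
    rewrite lerD2r; have [Yz|zY] := leP Y (y + z - x + 2 * X1); last by rewrite addr_ge0.
    have [Xy|yX] := ltP X1 y; first by rewrite lerDl.
    rewrite (_ : Y2 <= z - y + 2 * X1) ?add0r// /Y2.
    move: Yz yX xX1; clear; lra.
  have D2 : Xm < x /\ be - x - 2 * ep <= x + 0 by split.
  have [_ h2] := step2 v0 x 0 D2.
  have D1 : Xm < x /\ be - 2 * ep <= x + x.
    by split => //; rewrite /be; move: ax; clear; lra.
  have [_ h1] := step1 x x D1.
  rewrite -UE VE addr0 in h2.
  have M1 : tail_majorant w2 2 2 de X1 Y be x x <= 2 * i2 + 2 * K2 * de.
    rewrite /tail_majorant nX add0r (_ : (Y <= x - x + 2 * X1) = false); last first.
      by apply/negbTE; rewrite -ltNge /Y; move: X10; clear; lra.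
    rewrite add0r -[x + x]mulr2n -[x *+ 2]mulr_natl lerD2l ler_wpM2r ?(ltW de0)//.
    by rewrite ler_wpM2l.
  have M2' : tail_majorant w1 (2 * ka) (2 * ka * K2) de X1 Y2 (be - x) x 0 <=
      2 * ka * i2 + 2 * ka * K2 * K1 * de.
    rewrite /tail_majorant nX add0r (_ : (Y2 <= 0 - x + 2 * X1) = false); last first.
      by apply/negbTE; rewrite -ltNge /Y2 /Y; move: X10 x0; clear; lra.
    rewrite add0r addr0 (_ : (x < be - x) = (2 * x < be)); last first.
      by rewrite ltrBrDl -mulr2n -[x *+ 2]mulr_natl.
    by rewrite lerD2l ler_wpM2r ?(ltW de0)// ler_wpM2l// ltW.
  have tk : 2 * th * ka = 19^-1 by rewrite kaE /th; field.
  rewrite tk in h1 h2.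
  have iE : (x < a + ep)%R%:R = i2 by rewrite /i2 /be ltr_pM2l.
  rewrite iE [2 * x](_ : _ = x + x); last by rewrite mulr_natl mulr2n.
  have := ler_distD (V x) (jost_product_sum n k0 c f1 f2 x) (psi (x + x)).
  rewrite -/(psi (x + x)).
  have i20 : 0 <= i2 by [].
  have CC : 2 * (ka * K2 * K1) + 2 * K2 <= C.
    by rewrite /C lerDl mulr_ge0// addr_ge0 ?mulr_ge0// ltW.
  have CCd := ler_wpM2r (ltW de0) CC.
  have kk0 : 0 <= ka * K2 * K1 * de by rewrite !mulr_ge0// ltW.
  have kk1 : 0 <= K2 * de by rewrite mulr_ge0// ltW.
  move: h1 h2 M1 M2' CCd kk0 kk1 i20; rewrite -/(V x) kaE.
  move: `|_ - _| `|_ - _| `|_ - _| (tail_majorant _ _ _ _ _ _ _ _ _) (tail_majorant _ _ _ _ _ _ _ _ _) => u v w s t.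
  rewrite !mulrDl; clear.
  move: (20 / 19 * K2 * K1 * de) => z1.
  by lra.
- have om_le y z (A B D Z b : R) m : 0 <= A -> 0 <= B -> 0 <= m y -> m y <= D ->
      tail_majorant m A B de X1 Z b y z <= A + B * D * 3.
    move=> A0 B0 my myD; rewrite /tail_majorant; apply: lerD; first by rewrite ler_piMr.
    apply: ler_pM; rewrite ?mulr_ge0 ?addr_ge0 ?(ltW de0)//; first by rewrite ler_wpM2l.
    have -> : 3 = 1 + 1 + 1 :> R by ring.
    by apply: lerD => //; apply: lerD.
  (* For y > Z > X1 the step indicator is 1, so the constant bound M2 on the data fits under the
     majorant. *)
  pose Z := (X1 + x) / 2.
  have X1Z : X1 < Z by rewrite /Z; move: xX1; clear; lra.
  have Zx : Z < x by rewrite /Z; move: xX1; clear; lra.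
  have Z0 : 0 < Z by exact: le_lt_trans X1Z.
  have step2 := @jost_step _ q1 m1 w1 K1 th de ep X1 td1 n k A1 B1 EA1 EB1 Z
    M2 M2 Y (be - x) kp (ltW Z0) qi1 (hA1 _ Z0) (hB1 _ Z0) (ltW M20) M20 th1.
  have v0 y z : Z < y /\ be - x - 2 * ep <= y + z -> `|wave n k EA1 EB1 y z| <=
      tail_majorant w1 M2 M2 de X1 Y (be - x) y z.
    move=> [Zy ayz]; rewrite VE.
    have D : Xm < x /\ be - 2 * ep <= x + (y + z).
      by split => //; move: ayz; clear; lra.
    apply: (le_trans (step1 x (y + z) D).1).
    apply: (@le_trans _ _ M2); first by rewrite M2E; apply: ler_wpM2l => //; exact: om_le.
    rewrite /tail_majorant (lt_trans X1Z Zy) -[leLHS]add0r; apply: lerD.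
      by rewrite mulr_ge0// ltW.
    have /andP[w1y _] := W1 y; rewrite -mulrA ler_peMr ?(ltW M20)//.
    rewrite -[leLHS]mulr1; apply: ler_pM => //.
    by rewrite -addrA lerDl addr_ge0// ltW.
  have D2 : Z < x /\ be - x - 2 * ep <= x + 0 by split.
  have [h2 _] := step2 v0 x 0 D2.
  rewrite UE; apply: (le_trans h2).
  apply: (@le_trans _ _ (ka * (M2 + M2 * K1 * 3))).
    by apply: ler_wpM2l => //; apply: om_le => //; exact: ltW.
  by rewrite /C lerDr addr_ge0// !mulr_ge0.
Qed.

End JostProductEstimate.

(** * Property [C_+] *)

Section PropertyCPlus.
Context {R : realType}.
Notation mu := (@lebesgue_measure R).

Lemma ae_zero_bigcup (D : nat -> set R) (p : R -> R) :
  (forall n, ae_zero (D n) p) -> ae_zero (\bigcup_n D n) p.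
Proof.
move=> h; rewrite /ae_zero.
have [] := @negligible_bigcup _ _ _ mu (fun n => ~` [set x | D n x -> p x = 0]) h.
move=> N [mN N0 NS]; exists N; split => // x /= nP; apply: NS.
apply: contrapT => nB; apply: nP => -[n _ Dnx]; apply: contrapT => px.
by apply: nB; exists n => //= hh; apply: px; exact: hh.
Qed.

Lemma ae_zeroU (D E : set R) (p : R -> R) :
  ae_zero D p -> ae_zero E p -> ae_zero (D `|` E) p.
Proof.
move=> hD hE; apply: filterS2 hD hE; first exact: (ae_filter_ringOfSetsType mu).
by move=> x h1 h2 [].
Qed.

Lemma ae_zero_set1 (a : R) (p : R -> R) : ae_zero [set a] p.
Proof.
exists [set a]; split => //; first exact: lebesgue_measure_set1.
by move=> x /=; apply: contra_notP => xa /xa.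
Qed.

Lemma ae_zeroS (D E : set R) (p : R -> R) : D `<=` E -> ae_zero E p -> ae_zero D p.
Proof.
move=> DE; apply: filterS; first exact: (ae_filter_ringOfSetsType mu).
by move=> x h Dx; apply: h; exact: DE.
Qed.

Lemma Rintegral_ae_zero_setD (D E : set R) (p h : R -> R) : measurable D -> measurable E ->
  mu.-integrable D (EFin \o (fun x => p x * h x)) -> ae_zero (D `\` E) p ->
  \int[mu]_(x in D) (p x * h x) = \int[mu]_(x in D `&` E) (p x * h x).
Proof.
move=> mD mE phi p0; rewrite (Rintegral_split mD mE phi).
rewrite [X in _ + X](_ : _ = 0) ?addr0//.
have mDE : measurable (D `\` E) by exact: measurableD.
rewrite (@eq_Rintegral_ae _ _ _ (cst 0) mDE).
- by rewrite Rintegral_cst// mul0r.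
- apply: measurable_funS (integrable_meas phi) => //; exact: subDsetl.
- exact: measurable_cst.
apply: filterS p0; first exact: (ae_filter_ringOfSetsType mu).
by move=> x h0 Dx; rewrite h0// mul0r.
Qed.

Lemma jost_measurable q (f : R -> R -> R[i]) (k : R) : is_jost_plus q f ->
  measurable_fun (`]0, +oo[ : set R) (fun x : R => complex.Re (f x k)) /\
  measurable_fun (`]0, +oo[ : set R) (fun x : R => complex.Im (f x k)).
Proof.
move=> jf; have [s1 s2 _ _] := jost_components k jf.
split; apply: derivable_measurable => x; rewrite in_itv/= andbT => x0.
- exact: derivable_solution s1 x0.
- exact: derivable_solution s2 x0.
Qed.

Lemma jost_product_integrable q1 q2 f1 f2 (p : R -> R) k : L11 `]0, +oo[ q1 -> L11 `]0, +oo[ q2 ->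
  is_jost_plus q1 f1 -> is_jost_plus q2 f2 ->
  mu.-integrable `]0, +oo[ (EFin \o p) -> 0 < k ->
  mu.-integrable `]0, +oo[ (EFin \o (fun x => p x * complex.Re (f1 x k * f2 x k))).
Proof.
move=> L1 L2 j1 j2 ip k0; have [M1 M10 M1P] := jost_uniform_bound L1 j1 k0.
have [M2 M20 M2P] := jost_uniform_bound L2 j2 k0.
have ReE x : complex.Re (f1 x k * f2 x k) =
    complex.Re (f1 x k) * complex.Re (f2 x k) - complex.Im (f1 x k) * complex.Im (f2 x k).
  by case: (f1 x k); case: (f2 x k).
have [m1 m1'] := jost_measurable k j1; have [m2 m2'] := jost_measurable k j2.
apply: (@integrableMb _ _ _ _ (M1 * M2 + M1 * M2)) => //.
  rewrite (funext ReE).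
  by apply: measurable_funB; exact: measurable_funM.
move=> x; rewrite /= in_itv/= andbT => x0; rewrite ReE.
have [h1 h2] := M1P x x0; have [h3 h4] := M2P x x0.
by apply: (le_trans (ler_normB _ _)); rewrite !normrM; apply: lerD; exact: ler_pM.
Qed.

Lemma jost_product_sum_integrable q1 q2 f1 f2 (p : R -> R) n (k0 : R) c : L11 `]0, +oo[ q1 -> L11 `]0, +oo[ q2 ->
  is_jost_plus q1 f1 -> is_jost_plus q2 f2 ->
  mu.-integrable `]0, +oo[ (EFin \o p) ->
  (forall k : R, 0 < k ->
    \int[mu]_(x in `]0, +oo[) (p x * complex.Re (f1 x k * f2 x k)) = 0) ->
  0 < k0 ->
  mu.-integrable `]0, +oo[ (EFin \o (fun x => p x * jost_product_sum n k0 c f1 f2 x)) /\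
  \int[mu]_(x in `]0, +oo[) (p x * jost_product_sum n k0 c f1 f2 x) = 0.
Proof.
move=> L1 L2 j1 j2 ip orth k00; have kp j : 0 < odd_freq k0 j by rewrite /odd_freq mulr_gt0// ltr0n.
have E x : jost_product_sum n k0 c f1 f2 x =
    \sum_(j < n) (c j * complex.Re (f1 x (odd_freq k0 j) * f2 x (odd_freq k0 j)) - 0 * 0).
  by apply: eq_bigr => j _; rewrite mul0r subr0.
have z : mu.-integrable `]0, +oo[ (EFin \o (fun x => p x * 0)).
  rewrite (_ : (fun x => p x * 0) = cst 0); first exact: integrable0.
  by apply/funext => x; rewrite mulr0.
have [h1 h2] := @Rintegral_wave _ `]0, +oo[ n c (fun=> 0)
  (fun j x => complex.Re (f1 x (odd_freq k0 j) * f2 x (odd_freq k0 j))) (fun _ _ => 0) p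
  (measurable_itv _) (fun j _ => jost_product_integrable L1 L2 j1 j2 ip (kp j)) (fun _ _ => z).
have {}E := funext E.
rewrite E; split => //.
rewrite h2 big1// => j _; rewrite (orth _ (kp j)).
by rewrite mulr0 mul0r subr0.
Qed.

(** As ep is fixed before a, finitely many steps reach any point. The error beyond a + ep is split
    at X1: proportional to de before it, and after it bounded by C against a small integral of
    |p|. *)
Lemma C_plus_local q1 q2 f1 f2 (p : R -> R) : L11 `]0, +oo[ q1 -> L11 `]0, +oo[ q2 ->
  is_jost_plus q1 f1 -> is_jost_plus q2 f2 ->
  mu.-integrable `]0, +oo[ (EFin \o p) ->
  (forall k : R, 0 < k ->
    \int[mu]_(x in `]0, +oo[) (p x * complex.Re (f1 x k * f2 x k)) = 0) ->
  exists2 ep : R, 0 < ep & forall a, 0 <= a ->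
  ae_zero `]0, a[ p -> ae_zero `]0, a + ep[ p.
Proof.
move=> L1 L2 j1 j2 ip orth; have [ep [C [ep0 C0 est]]] := jost_product_estimate L1 L2 j1 j2.
exists ep => // a a0 pa.
pose cc := a + ep.
have acc : a < cc by rewrite ltrDl.
suff pz : ae_zero `]a, cc[ p.
  apply: ae_zeroS (ae_zeroU (ae_zeroU pa (ae_zero_set1 a p)) pz) => x.
  rewrite /= !in_itv/= => /andP[x0 xc].
  by case: (ltgtP x a) => xa; [left; left; rewrite x0|right|left; right].
have pS (D : set R) : measurable D -> D `<=` `]0, +oo[ -> mu.-integrable D (EFin \o p).
  by move=> mD DS; exact: integrableS ip.
have accS : `]a, cc[ `<=` `]0, +oo[.
  by move=> x; rewrite /= !in_itv/= andbT => /andP[ax _]; exact: le_lt_trans ax.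
have aS : `]a, +oo[ `<=` `]0, +oo[ by apply: subset_itvr; rewrite bnd_simp.
apply: (L1_zero acc (pS _ (measurable_itv _) accS)) => g a' b' aa' ab' bc' gc g1 g0.
pose I := \int[mu]_(x in `]a, cc[) `|p x|; rewrite -/I.
pose Pn := \int[mu]_(x in `]a, +oo[) `|p x|.
have Pn0 : 0 <= Pn by exact: Rintegral_ge0.
apply/ler_addgt0Pl => e e0.
(* Absorbs (C + 1) de times the integral of |p|, from x <= X1, and C de, from x > X1. *)
pose B := (C + 1) * Pn + C + 1.
have B0 : 0 < B by rewrite /B ltr_wpDl// addr_ge0// mulr_ge0// addr_ge0.
pose de := Num.min 1 (e / B).
have de0 : 0 < de by rewrite lt_min ltr01 divr_gt0.
have de1 : de <= 1 by rewrite ge_min lexx.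
have deB : de * B <= e by rewrite -ler_pdivlMr// ge_min lexx orbT.
have [N N0 NP] := est de de0 de1.
have [N2 N2P] := integral_tail (measurable_itv _) (pS _ (measurable_itv `]a, +oo[) aS) de0.
pose X1 := Num.max N (Num.max N2 cc).
have NX : N <= X1 by rewrite le_max lexx.
have N2X : N2 <= X1 by rewrite !le_max lexx orbT.
have ccX : cc <= X1 by rewrite !le_max lexx !orbT.
have X10 : 0 <= X1 by exact: le_trans NX.
(* The quarter period pi / (2 k0) equals Y = 4 X1 + 1, so the approximation is valid on all of
   [0, Y]. *)
pose k0 : R := pi / 2 / (4 * X1 + 1).
have Y0 : 0 < 4 * X1 + 1 by rewrite ltr_wpDl// mulr_ge0.
have pi20 : 0 < pi / 2 :> R by rewrite divr_gt0// pi_gt0.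
have k00 : 0 < k0 by rewrite divr_gt0.
have k0Y s : s <= 4 * X1 + 1 -> k0 * s <= pi / 2.
  move=> sY; rewrite /k0 mulrAC ler_pdivrMr// ler_wpM2l// ltW//.
(* The product of two solutions doubles the phase: it is psi (2 x) that must approximate g x. *)
pose G s := g (s / 2).
have Gc : continuous G.
  move=> s; apply: (@continuous_comp _ _ _ (fun s : R => s / 2) g); last exact: gc.
  by apply: cvgM; [exact: cvg_id|exact: cvg_cst].
have a'0 : 0 < a' by exact: le_lt_trans aa'.
have s00 : 0 < 2 * a' by rewrite mulr_gt0.
have s01 : 2 * a' < 2 * b' by rewrite ltr_pM2l.
have ks1 : k0 * (2 * b') < pi / 2.
  rewrite /k0 mulrAC ltr_pdivrMr// ltr_pM2l//.
  move: bc' ccX X10; clear; lra.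
have G0 s : s <= 2 * a' \/ 2 * b' <= s -> G s = 0.
  by move=> h; apply: g0; case: h => h; [left|right]; move: h; clear; lra.
have G1 s : `|G s| <= 1 by exact: g1.
have [n [c [psiG psiM]]] := odd_cos_approx Gc s00 s01 k00 ks1 G0 G1 de0.
pose U x := jost_product_sum n k0 c f1 f2 x.
have [Ui Uz] := jost_product_sum_integrable n c L1 L2 j1 j2 ip orth k00.
have estU x : a < x -> (x <= X1 -> `|U x - g x| <= 2^-1 * (x < cc)%R%:R + (C + 1) * de) /\
    (X1 < x -> `|U x| <= C).
  move=> ax; have x0 : 0 < x by exact: le_lt_trans ax.
  have [||h1 h2] := NP X1 a NX a0 n c k0 k00 _ _ x x0 (ltW ax).
  - by move=> s; apply: (le_trans (psiM _)); move: de1; clear; lra.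
  - move=> s sc sY; have s0 : 0 <= s.
      by apply: le_trans sc; rewrite mulr_ge0// addr_ge0// ltW.
    have := psiG s s0 (k0Y s sY); rewrite G0 ?subr0//.
    by right; apply: le_trans sc; rewrite ler_wpM2l// ltW.
  split => // xX; have x20 : 0 <= 2 * x by rewrite mulr_ge0// ltW.
  have xY : 2 * x <= 4 * X1 + 1 by move: xX X10; clear; lra.
  have := psiG (2 * x) x20 (k0Y _ xY).
  rewrite {1}/G (_ : 2 * x / 2 = x); last by field.
  have := h1 xX; have := ler_distD (odd_cos_sum n c (k0 * (2 * x))) (U x) (g x).
  by rewrite /U mulrDl mul1r; clear; lra.
have mg : measurable_fun (`]0, +oo[ : set R) g.
  by apply: measurable_funTS; exact: continuous_measurable_fun.
have pgi : mu.-integrable `]0, +oo[ (EFin \o (fun x => p x * g x)).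
  exact: (@integrableMb _ _ _ _ 1).
have pgE : \int[mu]_(x in `]a, cc[) (p x * g x) = \int[mu]_(x in `]a, +oo[) (p x * g x).
  rewrite [RHS](Rintegral_eq0_setD (A := `]a, cc[%classic))//; first last.
  - move=> x; rewrite /= !in_itv/= andbT => ax /negP.
    rewrite ax/= -leNgt => cx; rewrite g0 ?mulr0//; right.
    exact: le_trans (ltW bc') cx.
  - exact: integrableS pgi.
  congr (Rintegral _ _ _); apply/seteqP; split => x /=; rewrite !in_itv/= ?andbT.
    by move=> /andP[-> ->].
  by move=> [].
have aE : `]0, +oo[%classic `&` `]a, +oo[%classic = `]a, +oo[%classic :> set R by exact/setIidPr.
have UE : \int[mu]_(x in `]a, +oo[) (p x * U x) = 0.
  rewrite -Uz [RHS](@Rintegral_ae_zero_setD _ `]a, +oo[%classic) ?aE//.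
  apply: ae_zeroS (ae_zeroU pa (ae_zero_set1 a p)) => x /=.
  rewrite !in_itv/= !andbT => -[x0 /negP]; rewrite -leNgt le_eqVlt => /orP[/eqP ->|xa].
    by right.
  by left; rewrite x0.
have Ui' : mu.-integrable `]a, +oo[ (EFin \o (fun x => p x * U x)) by exact: integrableS Ui.
have pgi' : mu.-integrable `]a, +oo[ (EFin \o (fun x => p x * g x)) by exact: integrableS pgi.
have man := measurable_itv `]a, +oo[.
have pn := integrable_normR (pS _ man aS).
rewrite pgE -[X in `|X|](subr0 _) -UE -RintegralB//.
pose J1 x := `|p x| * (x < cc)%R%:R.
pose J2 x := `|p x| * (X1 < x)%R%:R.
have J1i : mu.-integrable `]a, +oo[ (EFin \o J1).
  apply: integrable_natmul_bool => //; exact: measurable_fun_ltn.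
have J2i : mu.-integrable `]a, +oo[ (EFin \o J2).
  apply: integrable_natmul_bool => //; exact: measurable_fun_ltn.
have JJi : mu.-integrable `]a, +oo[ (EFin \o (fun x => 2^-1 * J1 x + C * J2 x)).
  by have := @integrableD _ _ R mu _ man _ _ (integrableZlR 2^-1 man J1i) (integrableZlR C man J2i).
have JJJi : mu.-integrable `]a, +oo[ (EFin \o (fun x => (C + 1) * de * `|p x| + (2^-1 * J1 x + C * J2 x))).
  by have := @integrableD _ _ R mu _ man _ _ (integrableZlR ((C + 1) * de) man pn) JJi.
have dif : mu.-integrable `]a, +oo[ (EFin \o (fun x => p x * g x - p x * U x)).
  by have := @integrableB _ _ R mu _ man _ _ pgi' Ui'.
apply: (le_trans (ler_norm_Rintegral man dif JJJi _)).
  move=> x; rewrite /= in_itv/= andbT => ax; have [e1 e2] := estU x ax.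
  rewrite -mulrBr normrM distrC /J1 /J2; have px := normr_ge0 (p x).
  have [xX|Xx] := leP x X1.
    rewrite mulr0 mulr0 addr0; apply: (le_trans (ler_wpM2l px (e1 xX))).
    by rewrite le_eqVlt; apply/orP; left; apply/eqP; ring.
  have cx : cc <= x by exact: le_trans ccX (ltW Xx).
  rewrite [x < cc]ltNge cx mulr0 mulr0 add0r mulr1 g0 ?subr0; last first.
    by right; exact: le_trans (ltW bc') cx.
  have := ler_wpM2l px (e2 Xx); have : 0 <= (C + 1) * de * `|p x|.
    by rewrite !mulr_ge0// ?addr_ge0// ltW.
  by clear; lra.
rewrite RintegralD//; last exact: integrableZlR.
rewrite RintegralD//; [|exact: integrableZlR|exact: integrableZlR].
rewrite !RintegralZl// -/Pn.
have J1E : \int[mu]_(x in `]a, +oo[) J1 x = I.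
  rewrite (Rintegral_eq0_setD (A := `]-oo, cc[%classic) _ _ J1i)//; last first.
    by move=> x; rewrite /= !in_itv/= => _ /negP xc; rewrite /J1 (negbTE xc) mulr0.
  rewrite (_ : `]a, +oo[%classic `&` `]-oo, cc[%classic = `]a, cc[%classic); last first.
    apply/seteqP; split => x /=; rewrite !in_itv/= ?andbT; first by move=> [-> ->].
    by move=> /andP[-> ->].
  apply: eq_Rintegral => x; rewrite inE/= in_itv/= => /andP[_ xc].
  by rewrite /J1 xc mulr1.
have J2E : \int[mu]_(x in `]a, +oo[) J2 x <= de.
  have := N2P X1 N2X => /ltW; apply: le_trans.
  rewrite (Rintegral_eq0_setD (A := `]X1, +oo[%classic) _ _ J2i)//; last first.
    by move=> x; rewrite /= !in_itv/= !andbT => _ /negP xc; rewrite /J2 (negbTE xc) mulr0.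
  rewrite le_eqVlt; apply/orP; left; apply/eqP.
  apply: eq_Rintegral => x; rewrite inE/= !in_itv/= !andbT => -[_ xc].
  by rewrite /J2 xc mulr1.
rewrite J1E; have := ler_wpM2l C0 J2E; move: deB de0; rewrite /B; clear; nra.
Qed.

Lemma C_plus_ae_zero q1 q2 f1 f2 (p : R -> R) : L11 `]0, +oo[ q1 -> L11 `]0, +oo[ q2 ->
  is_jost_plus q1 f1 -> is_jost_plus q2 f2 ->
  mu.-integrable `]0, +oo[ (EFin \o p) ->
  (forall k : R, 0 < k ->
    \int[mu]_(x in `]0, +oo[) (p x * complex.Re (f1 x k * f2 x k)) = 0) ->
  ae_zero `]0, +oo[ p.
Proof.
move=> L1 L2 j1 j2 ip orth; have [ep ep0 step] := C_plus_local L1 L2 j1 j2 ip orth.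
have zn n : ae_zero `]0, ep * n%:R[ p.
  elim: n => [|n IH].
    by rewrite mulr0 set_itvoo0; apply: aeW => x [].
  by rewrite -natr1 mulrDr mulr1; apply: step => //; rewrite mulr_ge0// ltW.
apply: ae_zeroS (ae_zero_bigcup zn) => x /=; rewrite in_itv/= andbT => x0.
exists (Num.bound (x / ep)) => //=; rewrite in_itv/= x0/=.
have := archi_boundP (divr_ge0 (ltW x0) (ltW ep0)).
by rewrite ltr_pdivrMr// mulrC.
Qed.

Lemma C_plus (q1 q2 : R -> R) : L11 `]0, +oo[ q1 -> L11 `]0, +oo[ q2 ->
  property_C_plus q1 q2.
Proof.
move=> L1 L2 f1 f2 j1 j2 p Lp orth.
have [ip _] := L11_integrable (measurable_itv _) Lp.
apply: (C_plus_ae_zero L1 L2 j1 j2 ip) => k k0.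
have := orth k k0; rewrite /cintegral => -[h _]; rewrite -[RHS]h.
apply: eq_Rintegral => x _; case: (f1 x k) => a b; case: (f2 x k) => c d /=; ring.
Qed.

End PropertyCPlus.

(** * Products of solutions with Cauchy data *)

Section CauchyProductEstimate.
Context {R : realType}.
Notation mu := (@lebesgue_measure R).

Lemma volterra0Z q (k b a : R) E (u : R -> R) : 0 < k ->
  mu.-integrable `]0, b[ (EFin \o q) -> volterra0 q k E b u ->
  volterra0 q k (fun x => a * E x) b (fun x => a * u x).
Proof.
move=> k0 qi hu; have [mu_ [M M0 MP] eu] := hu; split.
- exact: measurable_funM.
- exists (`|a| * M); first by rewrite mulr_ge0.
  by move=> x xb; rewrite normrM ler_wpM2l// MP.
move=> x xb; rewrite {1}eu// mulrDr; congr (_ + _).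
rewrite -RintegralZl//; last exact: volterra0_integrable k0 xb qi hu.
by apply: eq_Rintegral => t _; ring.
Qed.

Lemma volterra0_le q (k b b' : R) E (u : R -> R) : b' <= b ->
  volterra0 q k E b u -> volterra0 q k E b' u.
Proof.
move=> bb [mu_ [M M0 MP] eu]; split.
- by apply: measurable_funS mu_ => //; apply: subset_itvl; rewrite bnd_simp.
- by exists M => // x /andP[x0 xb]; apply: MP; rewrite x0 (le_trans xb).
- by move=> x /andP[x0 xb]; apply: eu; rewrite x0 (le_trans xb).
Qed.

Lemma cauchy_volterra q (k c0 c1 b : R) u : 0 < k -> 0 < b ->
  mu.-integrable `]0, +oo[ (EFin \o q) -> is_cauchy_solution q k c0 c1 u ->
  volterra0 q k (fun x => c0 * cos (k * x) + c1 * (sin (k * x) / k)) b u.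
Proof.
move=> k0 b0 qi cu; split.
- apply: derivable_measurable => x; rewrite in_itv/= => /andP[x0 _].
  by have [su _ _] := cu; exact: derivable_solution su x0.
- exact: cauchy_bounded cu b0.
- by move=> x /andP[x0 _]; exact: cauchy_integral_eq.
Qed.

(** One majorant, one weight and one ep0 serve for all b <= B, since b moves during the
    iteration. *)
Lemma cauchy_data_exists q (th B : R) : L11 `]0, +oo[ q -> 0 < th -> 0 < B ->
  exists (m w : R -> R) (K ep0 : R), 0 < ep0 /\
    forall ep b, 0 < ep -> ep <= ep0 -> b <= B -> cauchy_data q m w K th ep b.
Proof.
move=> Lq th0 B0; have [qi0 _] := L11_integrable (measurable_itv _) Lq.
pose m := (fun x => (1 + B) * `|q x|) \_ `]0, B[.
have B1 : 0 <= 1 + B by rewrite addr_ge0// ltW.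
have m0 t : 0 <= m t.
  by rewrite /m patchE; case: ifP => // _; rewrite mulr_ge0.
have qi : mu.-integrable `]0, B[ (EFin \o q).
  by apply: integrableS qi0 => //; apply: subset_itvl.
have mi : mu.-integrable setT (EFin \o m).
  rewrite /m -restrict_EFin -integrable_mkcond//.
  exact: integrableZlR (integrable_normR qi).
have mE t : 0 < t < B -> m t = (1 + B) * `|q t|.
  by move=> t0; rewrite /m patchE mem_set/= ?in_itv.
have [w [K K1 [wK mw wi]]] := exists_increasing_weight B th0 mi m0.
pose I := \int[mu]_(t in setT) m t.
have I0 : 0 <= I by exact: Rintegral_ge0.
exists m, w, K, (th / (I + 1)); split; first by rewrite divr_gt0// ltr_wpDl.
move=> ep b ep0 epI bB; split => //.
- move=> t /andP[t0 tb]; rewrite mE ?t0 ?(lt_le_trans tb)//.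
  by rewrite ler_peMl// lerDl ltW.
- move=> x t /andP[t0 tx] xb; rewrite mE ?t0 ?(lt_le_trans tx) ?(le_trans xb)//.
  rewrite mulrC ler_wpM2r//; move: t0 xb bB; clear; lra.
- by move=> x /andP[x0 xb]; apply: wi; rewrite x0 (le_trans xb).
- have Ib : \int[mu]_(t in `]0, b[) m t <= I by exact: le_Rintegral_subset.
  apply: (@le_trans _ _ (th / (I + 1) * I)).
    apply: ler_pM => //; first exact: ltW.
    by apply: Rintegral_ge0.
  rewrite mulrAC ler_pdivrMr ?ltr_wpDl// mulrDr mulr1 lerDl; exact: ltW.
Qed.

(* The free solution free_wave o (k x) has Cauchy data (1, 0) if o = false and
   (0, k) if o = true: it corresponds to psi, resp. to k phi. *)
Definition free_wave (o : bool) (t : R) : R := if o then sin t else cos t.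

Lemma free_waveM o (x z : R) : free_wave o z * free_wave o x =
  2^-1 * ((-1) ^+ o * cos (x + z) + cos (x - z)).
Proof.
by case: o; rewrite /free_wave ?expr1 ?expr0 cosD cosB; field.
Qed.

Lemma cos_free_wave o (y z : R) : cos z * free_wave o y =
  2^-1 * (free_wave o (y + z) + free_wave o (y - z)).
Proof.
case: o; rewrite /free_wave; first by rewrite sinD sinB; field.
by rewrite cosD cosB; field.
Qed.

(** The square of [free_wave o (k * x)] is half of (-1)^o cos (2 k x) + 1, whence the factor 2 and
    the sign. The constants 1 sum to psi 0, which is at most de. The first pass perturbs u2; the
    second, with x frozen, perturbs u1. *)
Lemma cauchy_product_estimate (q1 q2 : R -> R) (B : R) :
  L11 `]0, +oo[ q1 -> L11 `]0, +oo[ q2 -> 0 < B ->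
  exists ep0 C : R, [/\ 0 < ep0, 0 <= C &
    forall (o : bool) (u1 u2 : R -> R -> R),
    (forall k, 0 < k -> volterra0 q1 k (fun x => free_wave o (k * x)) B (u1 k)) ->
    (forall k, 0 < k -> volterra0 q2 k (fun x => free_wave o (k * x)) B (u2 k)) ->
    forall ep b de, 0 < ep -> ep <= ep0 -> ep <= b -> b <= B -> 0 < de ->
    forall n c k0, 0 < k0 ->
    (forall s, `|odd_cos_sum n c (k0 * s)| <= 2) ->
    (forall s, `|s| <= 2 * (b - ep) -> `|odd_cos_sum n c (k0 * s)| <= de) ->
    forall x, 0 < x <= b ->
      `|2 * (\sum_(j < n) c j * (u1 (odd_freq k0 j) x * u2 (odd_freq k0 j) x)) -
        (-1) ^+ o * odd_cos_sum n c (k0 * (2 * x))| <=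
        2^-1 * (b - ep < x)%R%:R + C * de].
Proof.
move=> L1 L2 B0.
have [qi1' _] := L11_integrable (measurable_itv _) L1.
have [qi2' _] := L11_integrable (measurable_itv _) L2.
(* The relative error of a pass is 1 / 39. After the doubling the strip contributes 4 / 39 from the
   first pass and 8 (40 / 39) / 39 from the second, where both indicators are active; the sum is
   below 1 / 2. *)
pose th : R := 80^-1; pose ka : R := (1 - 2 * th)^-1.
have kaE : ka = 40 / 39 by rewrite /ka /th; field.
have tk : 2 * th * ka = 39^-1 by rewrite kaE /th; field.
have th0 : 0 < th by rewrite invr_gt0.
have th1 : 2 * th < 1 by rewrite /th; lra.
have kag0 : 0 < ka by rewrite kaE; lra.
have ka0 : 0 <= ka by exact: ltW.
have [m1 [w1 [K1 [e1 [e10 cd1P]]]]] := cauchy_data_exists L1 th0 B0.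
have [m2 [w2 [K2 [e2 [e20 cd2P]]]]] := cauchy_data_exists L2 th0 B0.
pose ep0 := Num.min e1 e2.
have ep00 : 0 < ep0 by rewrite lt_min e10.
have W1 x : 1 <= w1 x <= K1 by exact: (cd_w (cd1P e1 B e10 (lexx _) (lexx _))).
have W2 x : 1 <= w2 x <= K2 by exact: (cd_w (cd2P e2 B e20 (lexx _) (lexx _))).
have K11 : 1 <= K1 by have /andP[h1 h2] := W1 0; exact: le_trans h2.
have K21 : 1 <= K2 by have /andP[h1 h2] := W2 0; exact: le_trans h2.
have K10 : 0 <= K1 by exact: le_trans K11.
have K20 : 0 <= K2 by exact: le_trans K21.
pose C := ka * K2 * K1 + K2 + 1.
have C0 : 0 <= C by rewrite /C !addr_ge0// !mulr_ge0.
exists ep0, C; split => // o u1 u2 hu1 hu2 ep b de epg epe epb bB de0 n c k0 k00 psi2 psid x xb.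
have cd1 : cauchy_data q1 m1 w1 K1 th ep b.
  by apply: cd1P => //; apply: le_trans epe _; rewrite ge_min lexx.
have cd2 : cauchy_data q2 m2 w2 K2 th ep b.
  by apply: cd2P => //; apply: le_trans epe _; rewrite ge_min lexx orbT.
have bS : `]0, b[ `<=` `]0, +oo[ by apply: subset_itvl.
have qi1 : mu.-integrable `]0, b[ (EFin \o q1) by exact: integrableS qi1'.
have qi2 : mu.-integrable `]0, b[ (EFin \o q2) by exact: integrableS qi2'.
pose k := odd_freq k0.
have kp j : (j < n)%N -> 0 < k j by move=> _; rewrite /k /odd_freq mulr_gt0// ltr0n.
pose be := 2 * (b - ep).
have be0 : 0 <= be by rewrite mulr_ge0// subr_ge0.
have bee : be + 2 * ep = 2 * b by rewrite /be; ring.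
pose psi s := odd_cos_sum n c (k0 * s).
have psiE s : psi s = \sum_(j < n) c j * cos (k j * s).
  by apply: eq_bigr => j _; rewrite /k /odd_freq; congr (_ * cos _); ring.
(* The wave has to carry [free_wave o (k * z)]: the coefficient goes to the cosine if o is false,
   and to the sine, with the minus sign of [wave], if o is true. *)
pose A2 j y := c j * (~~ o)%:R * u2 (k j) y.
pose B2 j y := - (c j * o%:R) * u2 (k j) y.
pose EA2 j y := c j * (~~ o)%:R * free_wave o (k j * y).
pose EB2 j y := - (c j * o%:R) * free_wave o (k j * y).
have hA2 j : (j < n)%N -> volterra0 q2 (k j) (EA2 j) b (A2 j).
  move=> jn; apply: volterra0Z => //; first exact: kp.
  by apply: volterra0_le bB _; apply: hu2; exact: kp.
have hB2 j : (j < n)%N -> volterra0 q2 (k j) (EB2 j) b (B2 j).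
  move=> jn; apply: volterra0Z => //; first exact: kp.
  by apply: volterra0_le bB _; apply: hu2; exact: kp.
pose V y z := \sum_(j < n) c j * (free_wave o (k j * z) * u2 (k j) y).
have VE y z : wave n k A2 B2 y z = V y z.
  by apply: eq_bigr => j _; rewrite /A2 /B2 /free_wave; case: (o) => /=; ring.
pose V0 y z := 2^-1 * ((-1) ^+ o * psi (y + z) + psi (y - z)).
have V0E y z : wave n k EA2 EB2 y z = V0 y z.
  rewrite /V0 !psiE mulr_sumr -big_split mulr_sumr; apply: eq_bigr => j _ /=.
  rewrite (_ : _ - _ = c j * (free_wave o (k j * z) * free_wave o (k j * y))); last first.
    by rewrite /EA2 /EB2 /free_wave; case: (o) => /=; ring.
  by rewrite free_waveM !mulrDr mulrN; ring.
have n0 (d : bool) : 0 <= d%:R :> R by exact: ler0n.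
have data1 y z : [/\ 0 < y <= b, y + z <= be + 2 * ep & y - z <= be + 2 * ep] ->
    `|wave n k EA2 EB2 y z| <= cauchy_majorant w2 2 de be y z.
  move=> [/andP[y0 yb] d1 d2]; rewrite V0E /V0 /cauchy_majorant.
  have /andP[wy _] := W2 y; have wy0 : 0 <= w2 y by exact: le_trans wy.
  have dw : de <= de * w2 y by rewrite ler_peMr// ltW.
  have dw0 : 0 <= de * w2 y by rewrite mulr_ge0// ltW.
  have bnd (M : R) : `|psi (y + z)| <= M -> `|psi (y - z)| <= M ->
      `|2^-1 * ((-1) ^+ o * psi (y + z) + psi (y - z))| <= M.
    move=> h1 h2; rewrite normrM ger0_norm//.
    have := ler_normD ((-1) ^+ o * psi (y + z)) (psi (y - z)).
    rewrite normrM normrX normrN1 expr1n mul1r; move: h1 h2.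
    by move: `|psi _| `|psi _| `|_ + _| => ? ? ?; clear; lra.
  have [i1|i1] := ltP be (y + z).
    apply: (@le_trans _ _ 2); first by apply: bnd; exact: psi2.
    rewrite -[leLHS]addr0 lerD// mulrDr mulr1 lerDl mulr_ge0//.
  have [i2|i2] := ltP be (y - z).
    apply: (@le_trans _ _ 2); first by apply: bnd; exact: psi2.
    by rewrite add0r mulr1 lerDl.
  rewrite addr0 mulr0 add0r; apply: le_trans dw; apply: bnd; apply: psid; rewrite -/be ler_norml.
    by rewrite i1 andbT; move: y0 i2; clear; lra.
  by rewrite i2 andbT; move: y0 i1; clear; lra.
have step1 y z : [/\ 0 < y <= b, y + z <= be + 2 * ep & y - z <= be + 2 * ep] ->
    `|V y z| <= ka * cauchy_majorant w2 2 de be y z /\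
    `|V y z - V0 y z| <= 39^-1 * cauchy_majorant w2 2 de be y z.
  rewrite -VE -V0E -tk.
  exact: (@cauchy_step _ q2 m2 w2 K2 th ep b cd2 n k A2 B2 EA2 EB2 2 de be
    kp qi2 hA2 hB2 (ler0n _ 2) de0 th1 data1).
have [x0 xb'] := andP xb.
(* The second wave has cosines only, so it is even in z; its free part averages [V x] over y + z and
   y - z. *)
pose A1 j y := c j * u2 (k j) x * u1 (k j) y.
pose EA1 j y := c j * u2 (k j) x * free_wave o (k j * y).
pose Z j y := 0 * u1 (k j) y.
pose EZ j y := 0 * free_wave o (k j * y).
have hA1 j : (j < n)%N -> volterra0 q1 (k j) (EA1 j) b (A1 j).
  move=> jn; apply: volterra0Z => //; first exact: kp.
  by apply: volterra0_le bB _; apply: hu1; exact: kp.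
have hZ j : (j < n)%N -> volterra0 q1 (k j) (EZ j) b (Z j).
  move=> jn; apply: volterra0Z => //; first exact: kp.
  by apply: volterra0_le bB _; apply: hu1; exact: kp.
have V1E y z : wave n k EA1 EZ y z = 2^-1 * (V x (y + z) + V x (y - z)).
  rewrite /V -big_split mulr_sumr; apply: eq_bigr => j _ /=.
  rewrite /EA1 /EZ [k j * (y + z)]mulrDr [k j * (y - z)]mulrDr mulrN.
  rewrite mul0r mulr0 subr0 [LHS]mulrCA cos_free_wave; ring.
pose U := \sum_(j < n) c j * (u1 (k j) x * u2 (k j) x).
have UE : wave n k A1 Z x 0 = U.
  apply: eq_bigr => j _; rewrite /A1 /Z mulr0 cos0 sin0; ring.
have data2 y z : [/\ 0 < y <= b, y + z <= be - x + 2 * ep & y - z <= be - x + 2 * ep] ->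
    `|wave n k EA1 EZ y z| <= cauchy_majorant w1 (2 * ka) (ka * K2 * de) (be - x) y z.
  move=> [/andP[y0 yb] d1 d2]; rewrite V1E.
  have [h1 _] : `|V x (y + z)| <= ka * cauchy_majorant w2 2 de be x (y + z) /\
     `|V x (y + z) - V0 x (y + z)| <= 39^-1 * cauchy_majorant w2 2 de be x (y + z).
    apply: step1; split => //; first by move: d1; clear; lra.
    by move: d2 y0 x0 xb' bee; clear; lra.
  have [h2 _] : `|V x (y - z)| <= ka * cauchy_majorant w2 2 de be x (y - z) /\
     `|V x (y - z) - V0 x (y - z)| <= 39^-1 * cauchy_majorant w2 2 de be x (y - z).
    apply: step1; split => //; first by move: d2; clear; lra.
    by move: d1 y0 x0 xb' bee; clear; lra.
  have /andP[wy _] := W1 y; have wy0 : 0 <= w1 y by exact: le_trans wy.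
  have /andP[_ wx] := W2 x.
  pose i1 : R := (be - x < y + z)%R%:R; pose i2 : R := (be - x < y - z)%R%:R.
  (* Passing from x - (y + z) to x + (y - z) adds 2 y > 0, so one indicator dominates the other. *)
  have le1 : (be < x - (y + z))%R%:R <= i2.
    rewrite /i2; have [h|//] := ltP be (x - (y + z)).
    by rewrite (_ : be - x < y - z)//; move: h y0; clear; lra.
  have le2 : (be < x - (y - z))%R%:R <= i1.
    rewrite /i1; have [h|//] := ltP be (x - (y - z)).
    by rewrite (_ : be - x < y + z)//; move: h y0; clear; lra.
  have M1 : cauchy_majorant w2 2 de be x (y + z) <= 2 * (i1 + i2) + de * K2.
    rewrite /cauchy_majorant (_ : (be < x + (y + z)) = (be - x < y + z)); last first.
      by rewrite ltrBlDl.
    by apply: lerD; [rewrite ler_wpM2l// lerD2l|rewrite ler_wpM2l// ltW].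
  have M2 : cauchy_majorant w2 2 de be x (y - z) <= 2 * (i1 + i2) + de * K2.
    rewrite /cauchy_majorant (_ : (be < x + (y - z)) = (be - x < y - z)); last first.
      by rewrite ltrBlDl.
    apply: lerD; last by rewrite ler_wpM2l// ltW.
    by rewrite ler_wpM2l// addrC lerD2r.
  have h1' := le_trans h1 (ler_wpM2l ka0 M1).
  have h2' := le_trans h2 (ler_wpM2l ka0 M2).
  rewrite normrM ger0_norm// /cauchy_majorant -/i1 -/i2.
  have tri := ler_normD (V x (y + z)) (V x (y - z)).
  have kd : ka * K2 * de <= ka * K2 * de * w1 y.
    by rewrite ler_peMr// !mulr_ge0// ltW.
  apply: (@le_trans _ _ (ka * (2 * (i1 + i2) + de * K2))).
    by move: tri h1' h2'; move: `|_ + _| `|V _ _| `|V _ _| (ka * _) => ? ? ? ?; clear; lra.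
  by rewrite mulrDr; apply: lerD; [rewrite mulrA [ka * 2]mulrC|rewrite [de * K2]mulrC mulrA].
have kKd : 0 < ka * K2 * de by rewrite !mulr_gt0// (lt_le_trans _ K21).
have Dx : [/\ 0 < x <= b, x + 0 <= be - x + 2 * ep & x - 0 <= be - x + 2 * ep].
  by rewrite addr0 subr0 xb; split => //; move: xb' bee; clear; lra.
have [_ h2] := @cauchy_step _ q1 m1 w1 K1 th ep b cd1 n k A1 Z EA1 EZ (2 * ka) (ka * K2 * de) (be - x)
    kp qi1 hA1 hZ (mulr_ge0 (ler0n _ 2) ka0) kKd th1 data2 x 0 Dx.
have [|_ h1] := step1 x x.
  by rewrite xb subrr; split => //; move: xb' x0 bee; clear; lra.
move: h2; rewrite -/ka tk UE V1E addr0 subr0 (_ : 2^-1 * (V x x + V x x) = V x x); last by field.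
move=> h2; rewrite -/U.
have psi0 : `|psi 0| <= de by apply: psid; rewrite normr0.
move: h1; rewrite /V0 subrr (_ : x + x = 2 * x); last by ring.
have /andP[w1x w1K] := W1 x; have /andP[w2x w2K] := W2 x.
pose i : R := (b - ep < x)%R%:R.
have iE : (be < 2 * x) = (b - ep < x) by rewrite /be ltr_pM2l.
rewrite /cauchy_majorant subrr (_ : x + x = 2 * x); last by ring.
rewrite iE [be < 0]ltNge be0/= addr0.
move: h2; rewrite /cauchy_majorant addr0 subr0 ltrBlDl (_ : x + x = 2 * x); last by ring.
rewrite iE -/i -/(psi _) => h2 h1.
have M1 := ler_wpM2l (ltW de0) w2K.
have kK0 : 0 <= ka * K2 * de by rewrite !mulr_ge0// ltW.
have M2 := ler_wpM2l kK0 w1K.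
have i0 : 0 <= i by [].
rewrite -/i.
set s := (-1) ^+ o * psi (2 * x).
have E : 2 * U - s = 2 * (U - V x x) + 2 * (V x x - 2^-1 * (s + psi 0)) + psi 0 by field.
rewrite E.
apply: (le_trans (ler_normD _ _)); apply: (le_trans (lerD (ler_normD _ _) (lexx _))).
rewrite !normrM [`|2|]ger0_norm//.
have CE : C * de = ka * K2 * de * K1 + de * K2 + de by rewrite /C; ring.
rewrite CE.
have kKK0 : 0 <= ka * K2 * de * K1 by rewrite mulr_ge0.
have dK0 : 0 <= de * K2 by rewrite mulr_ge0// ltW.
move: h1 h2 M1 M2 psi0 i0 kKK0 dK0; rewrite -/s kaE.
move: `|U - _| `|_ - _| `|psi 0| (40 / 39 * K2 * de * K1) (40 / 39 * K2 * de * w1 x) (de * K2) (de * w2 x).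
by clear; move=> ? ? ? ? ? ? ?; lra.
Qed.

End CauchyProductEstimate.

(** * Properties [C_phi] and [C_psi] *)

Section PropertyCCauchy.
Context {R : realType}.
Notation mu := (@lebesgue_measure R).

Lemma odd_cos_sum_normr n c (k0 s : R) :
  odd_cos_sum n c (k0 * `|s|) = odd_cos_sum n c (k0 * s).
Proof.
have [//|s0] := ger0P s; apply: eq_bigr => j _.
by rewrite !mulrN cosN.
Qed.

(** The step is cut down to b when b < ep0, which keeps the new end nonnegative. The smallness asked
    for on a symmetric interval around 0 follows from the evenness of cosine sums. *)
Lemma cauchy_orthogonal_local (q1 q2 : R -> R) (B : R) :
  L11 `]0, +oo[ q1 -> L11 `]0, +oo[ q2 -> 0 < B ->
  exists2 ep0 : R, 0 < ep0 & forall (o : bool) (u1 u2 : R -> R -> R) p,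
    (forall k, 0 < k -> volterra0 q1 k (fun x => free_wave o (k * x)) B (u1 k)) ->
    (forall k, 0 < k -> volterra0 q2 k (fun x => free_wave o (k * x)) B (u2 k)) ->
    mu.-integrable `]0, B[ (EFin \o p) ->
    (forall k, 0 < k -> \int[mu]_(x in `]0, B[) (p x * (u1 k x * u2 k x)) = 0) ->
    forall b, 0 < b -> b <= B -> ae_zero `]b, B[ p ->
      ae_zero `](b - Num.min ep0 b), B[ p.
Proof.
move=> L1 L2 B0; have [ep0 [C [ep00 C0 est]]] := cauchy_product_estimate L1 L2 B0.
exists ep0 => // o u1 u2 p hu1 hu2 ip orth b b0 bB pb.
pose ep := Num.min ep0 b; rewrite -/ep.
have epg : 0 < ep by rewrite lt_min ep00.
have epe : ep <= ep0 by rewrite ge_min lexx.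
have epb : ep <= b by rewrite ge_min lexx orbT.
pose a := b - ep; rewrite -/a.
have a0 : 0 <= a by rewrite subr_ge0.
have ab : a < b by rewrite ltrBlDr ltrDl.
suff pz : ae_zero `]a, b[ p.
  apply: ae_zeroS (ae_zeroU (ae_zeroU pz (ae_zero_set1 b p)) pb) => x.
  rewrite /= !in_itv/= => /andP[ax xB].
  by case: (ltgtP x b) => xb; [left; left; rewrite ax|right|left; right].
have pS (D : set R) : measurable D -> D `<=` `]0, B[ -> mu.-integrable D (EFin \o p).
  by move=> mD DS; exact: integrableS ip.
have bS : `]0, b[ `<=` `]0, B[ by apply: subset_itvl; rewrite bnd_simp.
have abS : `]a, b[ `<=` `]0, b[ by apply: subset_itvr; rewrite bnd_simp.
have mb := measurable_itv `]0, b[.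
have pbi := pS _ mb bS.
apply: (L1_zero ab (pS _ (measurable_itv _) (subset_trans abS bS))) => g a' b' aa' ab' bb' gc g1 g0.
pose I := \int[mu]_(x in `]a, b[) `|p x|; rewrite -/I.
pose Pn := \int[mu]_(x in `]0, b[) `|p x|.
have Pn0 : 0 <= Pn by exact: Rintegral_ge0.
apply/ler_addgt0Pl => e e0.
pose M := (C + 1) * Pn + 1.
have M0 : 0 < M by rewrite /M ltr_wpDl// mulr_ge0// addr_ge0.
pose de := Num.min 1 (e / M).
have de0 : 0 < de by rewrite lt_min ltr01 divr_gt0.
have de1 : de <= 1 by rewrite ge_min lexx.
have deM : de * M <= e by rewrite -ler_pdivlMr// ge_min lexx orbT.
(* The quarter period is 2 b, the largest value of 2 x. *)
pose k0 : R := pi / 2 / (2 * b).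
have b20 : 0 < 2 * b by rewrite mulr_gt0.
have pi20 : 0 < pi / 2 :> R by rewrite divr_gt0// pi_gt0.
have k00 : 0 < k0 by rewrite divr_gt0.
have k0b s : s <= 2 * b -> k0 * s <= pi / 2.
  by move=> sb; rewrite /k0 mulrAC ler_pdivrMr// ler_wpM2l// ltW.
pose G s := g (s / 2).
have Gc : continuous G.
  move=> s; apply: (@continuous_comp _ _ _ (fun s : R => s / 2) g); last exact: gc.
  by apply: cvgM; [exact: cvg_id|exact: cvg_cst].
have a'0 : 0 < a' by exact: le_lt_trans aa'.
have s00 : 0 < 2 * a' by rewrite mulr_gt0.
have s01 : 2 * a' < 2 * b' by rewrite ltr_pM2l.
have ks1 : k0 * (2 * b') < pi / 2.
  by rewrite /k0 mulrAC ltr_pdivrMr// ltr_pM2l// ltr_pM2l.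
have G0 s : s <= 2 * a' \/ 2 * b' <= s -> G s = 0.
  by move=> h; apply: g0; case: h => h; [left|right]; move: h; clear; lra.
have G1 s : `|G s| <= 1 by exact: g1.
have [n [c [psiG psiM]]] := odd_cos_approx Gc s00 s01 k00 ks1 G0 G1 de0.
pose u j x := u1 (odd_freq k0 j) x * u2 (odd_freq k0 j) x.
pose U x := \sum_(j < n) c j * u j x.
have kp j : 0 < odd_freq k0 j by rewrite /odd_freq mulr_gt0// ltr0n.
have pui j : mu.-integrable `]0, B[ (EFin \o (fun x => p x * u j x)).
  have [mu1 [M1 M10 M1P] _] := hu1 _ (kp j); have [mu2 [M2 M20 M2P] _] := hu2 _ (kp j).
  apply: (@integrableMb _ _ _ _ (M1 * M2)) => //; first exact: measurable_funM.
  move=> x; rewrite /= in_itv/= => /andP[x0 xB]; rewrite normrM.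
  by apply: ler_pM => //; [apply: M1P|apply: M2P]; rewrite x0 ltW.
have UE x : \sum_(j < n) (c j * u j x - 0 * u j x) = U x.
  by apply: eq_bigr => j _; rewrite mul0r subr0.
have [Ui Uz] := @Rintegral_wave _ `]0, B[%classic n c (fun=> 0) u u p (measurable_itv _)
  (fun j _ => pui j) (fun j _ => pui j).
rewrite (_ : (fun t => _) = (fun x => p x * U x)) in Ui; last by apply/funext => x; rewrite UE.
have {}Uz : \int[mu]_(x in `]0, B[) (p x * U x) = 0.
  rewrite -[RHS](_ : \sum_(j < n) (c j * \int[mu]_(t in `]0, B[) (p t * u j t) - 0 * \int[mu]_(t in `]0, B[) (p t * u j t)) = 0).
    by rewrite -Uz; apply: eq_Rintegral => x _; rewrite UE.
  by apply: big1 => j _; rewrite orth// mulr0 mul0r subr0.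
pose sg : R := (-1) ^+ o.
have sg1 : `|sg| = 1 by rewrite /sg normrX normrN1 expr1n.
have estU x : 0 < x -> x < b -> `|sg * g x - 2 * U x| <= 2^-1 * (a < x)%R%:R + (C + 1) * de.
  move=> x0 xb; have x0b : 0 < x <= b by rewrite x0 ltW.
  have psi2 s : `|odd_cos_sum n c (k0 * s)| <= 2.
    by apply: (le_trans (psiM _)); move: de1; clear; lra.
  have psid s : `|s| <= 2 * (b - ep) -> `|odd_cos_sum n c (k0 * s)| <= de.
    rewrite -/a => sa; have sa' : `|s| <= 2 * a' by move: sa aa'; clear; lra.
    have := psiG `|s| (normr_ge0 s); rewrite odd_cos_sum_normr G0 ?subr0; last by left.
    by apply; apply: k0b; move: sa' bb' ab'; clear; lra.
  have h1 := est o u1 u2 hu1 hu2 ep b de epg epe epb bB de0 n c k0 k00 psi2 psid x x0b.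
  have h2 := psiG (2 * x) (mulr_ge0 (ler0n _ 2) (ltW x0)) (k0b _ (ler_wpM2l (ler0n _ 2) (ltW xb))).
  rewrite {1}/G (_ : 2 * x / 2 = x) in h2; last by field.
  have {}h1 : `|sg * odd_cos_sum n c (k0 * (2 * x)) - 2 * U x| <= 2^-1 * (a < x)%R%:R + C * de.
    by rewrite distrC.
  rewrite distrC in h2.
  apply: (le_trans (ler_distD (sg * odd_cos_sum n c (k0 * (2 * x))) _ _)).
  rewrite -mulrBr normrM sg1 mul1r; apply: (le_trans (lerD h2 h1)).
  by rewrite le_eqVlt; apply/orP; left; apply/eqP; ring.
have mg : measurable_fun (`]0, b[ : set R) g.
  by apply: measurable_funTS; exact: continuous_measurable_fun.
have pgi : mu.-integrable `]0, b[ (EFin \o (fun x => p x * g x)).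
  exact: (@integrableMb _ _ _ _ 1).
have abE : `]0, b[%classic `&` `]a, +oo[%classic = `]a, b[%classic :> set R.
  apply/seteqP; split => x /=; rewrite !in_itv/= ?andbT; first by move=> [/andP[_ ->] ->].
  by move=> /andP[ax ->]; rewrite ax (le_lt_trans a0).
have pgE : \int[mu]_(x in `]a, b[) (p x * g x) = \int[mu]_(x in `]0, b[) (p x * g x).
  rewrite [RHS](Rintegral_eq0_setD (A := `]a, +oo[%classic))// ?abE//.
  move=> x; rewrite /= !in_itv/= andbT => _ /negP.
  by rewrite -leNgt => xa; rewrite g0 ?mulr0//; left; exact: le_trans (ltW aa').
have bE : `]0, B[%classic `&` `]0, b[%classic = `]0, b[%classic :> set R by exact/setIidPr.
have Ub : \int[mu]_(x in `]0, b[) (p x * U x) = 0.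
  apply: etrans Uz; rewrite [RHS](@Rintegral_ae_zero_setD _ _ `]0, b[%classic) ?bE//.
  apply: ae_zeroS (ae_zeroU pb (ae_zero_set1 b p)) => x /=.
  rewrite !in_itv/= => -[/andP[x0 xB] /negP]; rewrite x0/= -leNgt le_eqVlt => /orP[/eqP ->|bx].
    by right.
  by left; rewrite bx.
have Ui' : mu.-integrable `]0, b[ (EFin \o (fun x => p x * U x)) by exact: integrableS Ui.
have pn := integrable_normR pbi.
have sgE : \int[mu]_(x in `]0, b[) (p x * g x) =
    sg * \int[mu]_(x in `]0, b[) (sg * (p x * g x) - 2 * (p x * U x)).
  rewrite RintegralB//; [|exact: integrableZlR|exact: integrableZlR].
  rewrite !RintegralZl// Ub mulr0 subr0 mulrA.
  by rewrite /sg -expr2 sqrr_sign mul1r.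
rewrite pgE sgE normrM sg1 mul1r.
pose J x := `|p x| * (a < x)%R%:R.
have Ji : mu.-integrable `]0, b[ (EFin \o J).
  apply: integrable_natmul_bool => //; exact: measurable_fun_ltn.
have Jsum : mu.-integrable `]0, b[ (EFin \o (fun x => (C + 1) * de * `|p x| + 2^-1 * J x)).
  by have := @integrableD _ _ R mu _ mb _ _ (integrableZlR ((C + 1) * de) mb pn) (integrableZlR 2^-1 mb Ji).
have dif : mu.-integrable `]0, b[ (EFin \o (fun x => sg * (p x * g x) - 2 * (p x * U x))).
  by have := @integrableB _ _ R mu _ mb _ _ (integrableZlR sg mb pgi) (integrableZlR 2 mb Ui').
apply: (le_trans (ler_norm_Rintegral mb dif Jsum _)).
  move=> x; rewrite /= in_itv/= => /andP[x0 xb].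
  rewrite (_ : _ - _ = p x * (sg * g x - 2 * U x)); last by ring.
  rewrite normrM; apply: (le_trans (ler_wpM2l (normr_ge0 (p x)) (estU x x0 xb))).
  by rewrite /J le_eqVlt; apply/orP; left; apply/eqP; ring.
rewrite RintegralD//; [|exact: integrableZlR|exact: integrableZlR].
rewrite !RintegralZl// -/Pn.
have -> : \int[mu]_(x in `]0, b[) J x = I.
  rewrite (Rintegral_eq0_setD (A := `]a, +oo[%classic) _ _ Ji)// ?abE; last first.
    by move=> x; rewrite /= !in_itv/= andbT => _ /negP xa; rewrite /J (negbTE xa) mulr0.
  apply: eq_Rintegral => x; rewrite inE/= in_itv/= => /andP[ax _].
  by rewrite /J ax mulr1.
by move: deM de0; rewrite /M; clear; nra.
Qed.

Lemma cauchy_orthogonal_ae_zero (q1 q2 : R -> R) (B : R) (o : bool) (u1 u2 : R -> R -> R) p :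
  L11 `]0, +oo[ q1 -> L11 `]0, +oo[ q2 -> 0 < B ->
  (forall k, 0 < k -> volterra0 q1 k (fun x => free_wave o (k * x)) B (u1 k)) ->
  (forall k, 0 < k -> volterra0 q2 k (fun x => free_wave o (k * x)) B (u2 k)) ->
  mu.-integrable `]0, B[ (EFin \o p) ->
  (forall k, 0 < k -> \int[mu]_(x in `]0, B[) (p x * (u1 k x * u2 k x)) = 0) ->
  ae_zero `]0, B[ p.
Proof.
move=> L1 L2 B0 hu1 hu2 ip orth.
have [ep ep0 step] := cauchy_orthogonal_local L1 L2 B0.
have zn n : ae_zero `](Num.max 0 (B - ep * n%:R)), B[ p.
  elim: n => [|n IH].
    by rewrite mulr0 subr0 max_r ?(ltW B0)// set_itvoo0; apply: aeW => x [].
  have En : B - ep * n.+1%:R = B - ep * n%:R - ep by rewrite -natr1; ring.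
  move: IH; have [bn|bn] := leP (B - ep * n%:R) 0 => IH.
    by apply: ae_zeroS IH; apply: subset_itvr; rewrite bnd_simp le_max lexx.
  have bB : B - ep * n%:R <= B by rewrite gerBl mulr_ge0// ltW.
  apply: ae_zeroS (step o u1 u2 p hu1 hu2 ip orth _ bn bB IH).
  apply: subset_itvr; rewrite bnd_simp En.
  have [h|h] := leP ep (B - ep * n%:R); first by rewrite le_max lexx orbT.
  by rewrite subrr le_max lexx.
have := zn (Num.bound (B / ep)); rewrite max_l//.
have := archi_boundP (divr_ge0 (ltW B0) (ltW ep0)).
by rewrite ltr_pdivrMr// mulrC subr_le0 => /ltW.
Qed.

Lemma C_psi (q1 q2 : R -> R) : L11 `]0, +oo[ q1 -> L11 `]0, +oo[ q2 ->
  property_C_psi q1 q2.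
Proof.
move=> L1 L2 psi1 psi2 s1 s2 b b0 p ip orth.
have vol q psi : L11 `]0, +oo[ q -> is_psi q psi -> forall k, 0 < k ->
    volterra0 q k (fun x => free_wave false (k * x)) b (psi ^~ k).
  move=> Lq s k k0; have [qi _] := L11_integrable (measurable_itv _) Lq.
  have := cauchy_volterra k0 b0 qi (s k); congr (volterra0 _ _ _ _ _).
  by apply/funext => x; rewrite mul1r mul0r addr0.
apply: (cauchy_orthogonal_ae_zero (o := false) L1 L2 b0 (vol _ _ L1 s1) (vol _ _ L2 s2) ip).
by move=> k k0; rewrite -[RHS](orth k k0); apply: eq_Rintegral => x _; rewrite mulrA.
Qed.

Lemma C_phi (q1 q2 : R -> R) : L11 `]0, +oo[ q1 -> L11 `]0, +oo[ q2 ->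
  property_C_phi q1 q2.
Proof.
move=> L1 L2 phi1 phi2 s1 s2 b b0 p ip orth.
have qib q : L11 `]0, +oo[ q -> mu.-integrable `]0, b[ (EFin \o q).
  move=> Lq; have [qi _] := L11_integrable (measurable_itv _) Lq.
  by apply: integrableS qi => //; apply: subset_itvl.
have vol q phi : L11 `]0, +oo[ q -> is_phi q phi -> forall k, 0 < k ->
    volterra0 q k (fun x => free_wave true (k * x)) b (fun x => k * phi x k).
  move=> Lq s k k0; have [qi _] := L11_integrable (measurable_itv _) Lq.
  have := volterra0Z k k0 (qib _ Lq) (cauchy_volterra k0 b0 qi (s k)).
  congr (volterra0 _ _ _ _ _).
  by apply/funext => x; rewrite mul0r add0r mul1r mulrC divfK// gt_eqF.
apply: (cauchy_orthogonal_ae_zero (o := true) (u1 := fun k x => k * phi1 x k)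
  (u2 := fun k x => k * phi2 x k) L1 L2 b0 (vol _ _ L1 s1) (vol _ _ L2 s2) ip).
move=> k k0.
have phib q phi : L11 `]0, +oo[ q -> is_phi q phi -> measurable_fun `]0, b[ (phi ^~ k) /\
    exists2 M, 0 <= M & forall x, 0 < x <= b -> `|phi x k| <= M.
  move=> Lq s; have [qi _] := L11_integrable (measurable_itv _) Lq.
  by have [] := cauchy_volterra k0 b0 qi (s k).
have [mf1 [M1 M10 M1P]] := phib _ _ L1 s1; have [mf2 [M2 M20 M2P]] := phib _ _ L2 s2.
have E x : p x * (k * phi1 x k * (k * phi2 x k)) = k ^+ 2 * (p x * phi1 x k * phi2 x k) by ring.
rewrite (_ : Rintegral _ _ _ = \int[mu]_(x in `]0, b[) (k ^+ 2 * (p x * phi1 x k * phi2 x k))); last first.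
  by apply: eq_Rintegral => x _; exact: E.
rewrite RintegralZl// ?orth ?mulr0//.
rewrite (_ : (fun x => _) = (fun x => p x * (phi1 x k * phi2 x k))); last first.
  by apply/funext => x; rewrite mulrA.
apply: (@integrableMb _ _ _ _ (M1 * M2)) => //; first exact: measurable_funM.
move=> x; rewrite /= in_itv/= => /andP[x0 xB]; rewrite normrM.
by apply: ler_pM => //; [apply: M1P|apply: M2P]; rewrite x0 ltW.
Qed.

End PropertyCCauchy.

(** * Reflection *)

Section Reflection.
Context {R : realType}.
Notation mu := (@lebesgue_measure R).

Local Notation opp := (-%R : R -> measurableTypeR R).

Lemma preimage_opp_negative : opp @^-1` `]0, +oo[ = `]-oo, 0[%classic.
Proof. by apply/seteqP; split => x /=; rewrite !in_itv/= andbT oppr_gt0. Qed.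

(** Lebesgue measure is its own push-forward under the reflection. *)
Lemma ge0_integral_opp (D : set R) (f : R -> \bar R) : measurable D ->
  measurable_fun D f -> (forall x, D x -> (0 <= f x)%E) ->
  (\int[mu]_(x in D) f x = \int[mu]_(x in opp @^-1` D) f (opp x))%E.
Proof.
move=> mD mf f0; transitivity (\int[pushforward mu opp]_(x in D) f x)%E.
  by apply: eq_measure_integral => //= A mA AS; exact/esym/lebesgue_measureN.
rewrite ge0_integral_pushforward//.
by move=> x; rewrite inE => /f0.
Qed.

Lemma Rintegral_opp (D : set R) (f : R -> R) : measurable D -> measurable_fun D f ->
  \int[mu]_(x in D) f x = \int[mu]_(x in opp @^-1` D) f (- x).
Proof.
move=> mD /measurable_EFinP mf; rewrite /Rintegral; congr fine.
rewrite integralE [RHS]integralE; congr (_ - _)%E.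
- apply: etrans (ge0_integral_opp mD (measurable_funepos mf) _) _.
    by move=> x _; exact: funepos_ge0.
  by apply: eq_integral => x _; rewrite !funeposE.
- apply: etrans (ge0_integral_opp mD (measurable_funeneg mf) _) _.
    by move=> x _; exact: funeneg_ge0.
  by apply: eq_integral => x _; rewrite !funenegE.
Qed.

Lemma measurable_fun_opp (f : R -> R) : measurable_fun (`]-oo, 0[ : set R) f ->
  measurable_fun (`]0, +oo[ : set R) (fun x => f (- x)).
Proof.
have mo : measurable_fun (`]0, +oo[ : set R) opp by exact: oppr_measurable.
move=> mf; apply: (@measurable_comp _ _ _ _ _ _ (`]-oo, 0[%classic : set R)) mf mo => //.
by move=> _ [x /= xp <-]; move: xp; rewrite !in_itv/= andbT oppr_lt0.
Qed.

Lemma L11_opp q : L11 `]-oo, 0[ q -> L11 `]0, +oo[ (fun x : R => q (- x)).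
Proof.
move=> [mq qi]; have mq' := measurable_fun_opp mq; split => //.
apply: le_lt_trans qi; rewrite ge0_integral_opp//.
- rewrite preimage_opp_negative le_eqVlt; apply/orP; left; apply/eqP.
  by apply: eq_integral => x _; rewrite normrN opprK.
- apply/measurable_EFinP; apply: measurable_funM; last exact: measurableT_comp.
  by apply: measurable_funD => //; exact: measurableT_comp.
Qed.

Lemma ae_opp (P : R -> Prop) : {ae mu, forall x, P x} -> {ae mu, forall x, P (- x)}.
Proof.
move=> [N [mN N0 NS]]; exists (opp @^-1` N); split.
- by rewrite -[X in measurable X]setTI; exact: oppr_measurable.
- by rewrite -[RHS]N0; exact: lebesgue_measureN.
- by move=> x /= h; exact: NS.
Qed.

Lemma is_derive_opp_comp (s du : R) u (x : R) : is_derive (- x) 1 u du ->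
  is_derive x 1 (fun x => s * u (- x)) (- (s * du)).
Proof.
move=> h; have hN : is_derive x 1 (fun x : R => - x) (- 1).
  exact: is_deriveN.
have := @is_derive1_comp _ u _ x _ _ h hN; rewrite mulrN1 => h2.
have := @is_deriveZ _ _ _ _ s _ _ _ h2.
by rewrite /GRing.scale /= mulrN.
Qed.

Lemma abs_continuous_opp (a b s : R) (f : R -> R) : `|s| <= 1 ->
  abs_continuous (- b) (- a) f -> abs_continuous a b (fun x => s * f (- x)).
Proof.
move=> s1 acf e e0; have [d d0 dP] := acf e e0; exists d => // n l r lr disj sd.
apply: (@le_lt_trans _ _ (\sum_(i < n) `|f (- l i) - f (- r i)|)).
  apply: ler_sum => i _; rewrite -mulrBr normrM distrC.
  by rewrite (le_trans (ler_wpM2r _ s1))// mul1r.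
apply: dP.
- by move=> i; have [h1 [h2 h3]] := lr i; rewrite !lerN2.
- by move=> i j ij; rewrite !lerN2; case: (disj i j ij); [right|left].
- rewrite (_ : \sum_(i < n) _ = \sum_(i < n) (r i - l i))//.
  by apply: eq_bigr => i _; rewrite opprK addrC.
Qed.

Lemma abs_continuous_eq (a b : R) (f g : R -> R) :
  (forall x, a <= x <= b -> f x = g x) -> abs_continuous a b f -> abs_continuous a b g.
Proof.
move=> fg acf e e0; have [d d0 dP] := acf e e0; exists d => // n l r lr disj sd.
rewrite (_ : \sum_(i < n) _ = \sum_(i < n) `|f (r i) - f (l i)|); first exact: dP.
apply: eq_bigr => i _; have [h1 [h2 h3]] := lr i.
by rewrite !fg// ?h1 ?h3 ?(le_trans h1 h2) ?(le_trans h2 h3).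
Qed.

(** The two sign changes in the second derivative cancel. The factor s serves the imaginary part,
    which changes sign under conjugation. *)
Lemma solution_opp q (k s : R) u : `|s| <= 1 -> solution `]-oo, 0[ q k u ->
  solution `]0, +oo[ (fun x => q (- x)) k (fun x => s * u (- x)).
Proof.
move=> s1 [du acu u2].
have neg (x : R) : 0 < x -> `]-oo, 0[%classic (- x) by move=> x0; rewrite /= in_itv/= oppr_lt0.
have dv (x : R) : 0 < x -> is_derive x 1 (fun x => s * u (- x)) (- (s * derive1 u (- x))).
  move=> x0; apply: is_derive_opp_comp; rewrite derive1E; apply: DeriveDef => //.
  exact: du (neg x x0).
have v1 (x : R) : 0 < x -> derive1 (fun x => s * u (- x)) x = (- s) * derive1 u (- x).
  by move=> x0; rewrite derive1E (@derive_val _ _ _ _ _ _ _ (dv x x0)) mulNr.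
split.
- by move=> x; rewrite /= in_itv/= andbT => /dv [].
- move=> a b ab abD; have a0 : 0 < a.
    have : `]0, +oo[%classic a by apply: abD; rewrite /= in_itv/= lexx.
    by rewrite /= in_itv/= andbT.
  apply: (@abs_continuous_eq _ _ (fun x => (- s) * derive1 u (- x))).
    by move=> x /andP[ax _]; rewrite v1// (lt_le_trans a0).
  apply: abs_continuous_opp; first by rewrite normrN.
  apply: acu; first by rewrite lerN2.
  move=> x /=; rewrite !in_itv/= => /andP[_ xa].
  by rewrite (le_lt_trans xa)// oppr_lt0.
apply: filterS (ae_opp u2); first exact: (ae_filter_ringOfSetsType mu).
move=> x h; rewrite /= in_itv/= andbT => x0; have [du2 e2] := h (neg x x0).
have h2 : is_derive (- x) 1 (derive1 u) (derive1n 2 u (- x)).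
  by rewrite derive1nS derive1n1 derive1E; exact: DeriveDef.
have dw := is_derive_opp_comp (- s) h2.
(* The formula for the first derivative holds for positive arguments, that is, near x, which allows
   a second differentiation. *)
have nr : \forall y \near x, (- s) * derive1 u (- y) = derive1 (fun x => s * u (- x)) y.
  near=> y; rewrite v1//; near: y; exact: lt_nbhsr.
have dv2 : is_derive x 1 (derive1 (fun x => s * u (- x))) (- (- s * derive1n 2 u (- x))).
  by apply: near_eq_is_derive dw; rewrite ?oner_neq0.
split; first by case: dv2.
rewrite [X in X + _ - _]derive1E (@derive_val _ _ _ _ _ _ _ dv2).
rewrite mulNr opprK; rewrite (_ : _ - _ = s * (derive1n 2 u (- x) + k ^+ 2 * u (- x) - q (- x) * u (- x))).
  by rewrite e2 mulr0.
ring.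
Unshelve. all: by end_near. Qed.

(** At infinity g(-x, k) behaves like e^(-ikx). Its conjugate, again a solution as q and k are real,
    behaves like e^(ikx). *)
Lemma jost_minus_opp q (g : R -> R -> R[i]) : is_jost_minus q g ->
  is_jost_plus (fun x => q (- x))
    (fun x k => Complex (complex.Re (g (- x) k)) (- complex.Im (g (- x) k))).
Proof.
move=> jg k; have [[s1 s2] lim] := jg k; split.
  split => /=.
    have := solution_opp (s := 1) _ s1; rewrite normr1 => /(_ (lexx _)).
    by congr (solution _ _ _ _); apply/funext => x; rewrite mul1r.
  have := solution_opp (s := - 1) _ s2; rewrite normrN1 => /(_ (lexx _)).
  by congr (solution _ _ _ _); apply/funext => x; rewrite mulN1r.
move/cvgNy_compNP : lim.
rewrite (_ : _ \o _ = (fun x => Normc.normc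
  (Complex (complex.Re (g (- x) k)) (- complex.Im (g (- x) k)) - cexpi (k * x))))//.
apply/funext => x /=; case: (g (- x) k) => a b.
rewrite /cexpi /= mulrN cosN sinN; congr (Num.sqrt (_ + _)).
by rewrite -sqrrN; congr (_ ^+ 2); ring.
Qed.

Lemma C_minus (q1 q2 : R -> R) : L11 `]-oo, 0[ q1 -> L11 `]-oo, 0[ q2 ->
  property_C_minus q1 q2.
Proof.
move=> /L11_opp L1 /L11_opp L2 g1 g2 /jost_minus_opp j1 /jost_minus_opp j2 p /L11_opp Lp orth.
have [ip _] := L11_integrable (measurable_itv _) Lp.
have z : ae_zero `]0, +oo[ (fun x => p (- x)).
  (* Conjugating both factors leaves the real part of g1 g2 unchanged. *)
  apply: (C_plus_ae_zero L1 L2 j1 j2 ip) => k k0.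
  have := orth k k0; rewrite /cintegral => -[h _]; rewrite -[RHS]h.
  rewrite Rintegral_opp//; last first.
    exact: integrable_meas (jost_product_integrable L1 L2 j1 j2 ip k0).
  rewrite preimage_opp_negative; apply: eq_Rintegral => x _; rewrite !opprK.
  by case: (g1 x k) => a b; case: (g2 x k) => c d /=; ring.
apply: filterS (ae_opp z); first exact: (ae_filter_ringOfSetsType mu).
move=> x h xn; rewrite -[x]opprK; apply: h; move: xn.
by rewrite /= !in_itv/= andbT oppr_gt0.
Qed.

End Reflection.

Theorem theorem1p1 (R : realType) (q1 q2 : R -> R) :
  (L11 `]0, +oo[ q1 -> L11 `]0, +oo[ q2 ->
     property_C_plus q1 q2 /\ property_C_phi q1 q2 /\ property_C_psi q1 q2) /\
  (L11 `]-oo, 0[ q1 -> L11 `]-oo, 0[ q2 ->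
     property_C_minus q1 q2).
Proof.
split=> [L1 L2|L1 L2]; last exact: C_minus.
by split; [exact: C_plus|split; [exact: C_phi|exact: C_psi]].
Qed.
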